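(* Assume that $u_0:S^1\to\mathbb{R}$ is a nonnegative measurable function such that $\int_{S^1}(u_0-\log u_0)\,dx$ and $\int_{S^1}u_0\log u_0\,dx$ are finite. Let $u$ be a weak solution of $$u_t+(u(\log u)_{xx})_{xx}=0\quad\text{in }S^1\times(0,\infty),\qquad u(\cdot,0)=u_0,$$ constructed as the limit of the semi-discrete approximations described in the context, and set $\bar u=\int_{S^1}u_0(x)\,dx/L$. Then, for all $t>0$, $$\int_{S^1}u(\cdot,t)\log\left(\frac{u(\cdot,t)}{\bar u}\right)dx\le e^{-Mt}\int_{S^1}u_0\log\left(\frac{u_0}{\bar u}\right)dx,\qquad\text{where } M=\frac{32\pi^4}{L^4}.$$
   Context: $L>0$ is fixed and $S^1$ is the one-dimensional torus parametrized by $x\in[0,L]$ (functions on $S^1$ are $L$-periodic, real-valued). $W^{k,p}(S^1)$ and $H^k(S^1)=W^{k,2}(S^1)$ are the periodic Sobolev spaces, $H^{-2}(S^1):=(H^2(S^1))^*$, with duality pairing $\langle\cdot,\cdot\rangle_{H^{-2},H^2}$; an integrable function $f$ is identified with the functional $\phi\mapsto\int_{S^1}f\phi\,dx$ on $H^2(S^1)$. For a Banach space $X$, $L^p_{\rm loc}(0,\infty;X)$ and $W^{1,1}_{\rm loc}(0,\infty;X)$ denote the functions belonging to $L^p(0,T;X)$, respectively $W^{1,1}(0,T;X)$, for every $T>0$. Conventions: $-\log 0=+\infty$, $0\log 0=0$. Weak solution: a function $u$ with $u\in L^{5/2}_{\rm loc}(0,\infty;W^{1,1}(S^1))\cap W^{1,1}_{\rm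 loc}(0,\infty;H^{-2}(S^1))$ (identified with its representative that is continuous in time with values in $H^{-2}(S^1)$), $u\ge 0$ in $S^1\times(0,\infty)$, $\log u\in L^2_{\rm loc}(0,\infty;H^2(S^1))$, such that for all $T>0$ and all smooth test functions $\phi$ on $S^1\times[0,T]$, $$\int_0^T\langle u_t,\phi\rangle_{H^{-2},H^2}\,dt+\int_0^T\int_{S^1}u(\log u)_{xx}\phi_{xx}\,dx\,dt=0,$$ and $u(\cdot,0)=u_0$ in the sense of $H^{-2}(S^1)$. Construction of $u$: let $T>0$, $N\in\mathbb{N}$, $\tau=T/N$, $t_k=k\tau$ for $0\le k\le N$. Put $y_0=\log u_0$ and, recursively for $k=1,\dots,N$, let $y_k\in H^2(S^1)$ be a weak solution of $$\frac1\tau\left(e^{y_k}-e^{y_{k-1}}\right)+\left(e^{y_k}(y_k)_{xx}\right)_{xx}=0\quad\text{in }S^1,$$ that is, $\frac1\tau\int_{S^1}(e^{y_k}-e^{y_{k-1}})\phi\,dx+\int_{S^1}e^{y_k}(y_k)_{xx}\phi_{xx}\,dx=0$ for all $\phi\in H^2(S^1)$. Define $y^{(N)}(x,t)=y_k(x)$ for $x\in S^1$, $t\in(t_{k-1},t_k]$, $1\le k\le N$. The constructed weak solution $u$ is a weak solution such that, for every $T>0$, along a subsequence $N\to\infty$ (equivalently $\tau\to0$), $e^{y^{(N)}}\to u$ strongly in $L^2(0,T;L^2(S^1))$, $y^{(N)}\rightharpoonup\log u$ weakly in $L^2(0,T;H^2(S^1))$, and $\frac1\tau\left(e^{y^{(N)}}-e^{\sigma_N(y^{(N)})}\right)\rightharpoonup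 u_t$ weakly in $L^1(0,T;H^{-2}(S^1))$, where $(\sigma_N(y^{(N)}))(x,t)=y_{k-1}(x)$ for $t\in(t_{k-1},t_k]$. *)

(* Defs.v *)
(* The torus S^1 of length L is rendered by L-periodic
   functions R -> R (Borel representatives of a.e.-classes), integrated over
   [0, L] against the Lebesgue measure. *)
From HB Require Import structures.
From mathcomp Require Import all_boot all_order all_algebra.
From mathcomp Require Import all_classical all_reals all_analysis.

Set Implicit Arguments.
Unset Strict Implicit.
Unset Printing Implicit Defensive.
Import Order.TTheory GRing.Theory Num.Theory.
Import numFieldNormedType.Exports.

Local Open Scope classical_set_scope.
Local Open Scope ring_scope.

(* A normed space of classes of functions, given by the set of representatives
   of its elements inside an ambient space V and by the norm read on
   representatives (it is irrelevant outside the carrier).  Two representatives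
   denote the same element when their difference has norm 0. *)
Record nspace (R : realType) (V : lmodType R) := NSpace {
  carrier :> V -> Prop ;
  snorm : V -> R
}.

(* An element of the dual acts on representatives; being bounded, it
   identifies representatives of the same element. *)
Definition dual (R : realType) (V : lmodType R) (X : nspace V) :
    nspace (V -> R) :=
  {| carrier := [set F : V -> R |
       (forall (a : R) (u v : V), X u -> X v -> F (a *: u + v) = a * F u + F v)
       /\ exists C : R, forall v, X v -> `|F v| <= C * snorm X v] ;
     snorm := fun F => sup [set `|F v| | v in [set v | X v /\ snorm X v <= 1]]
  |}.

Definition strong_cvg (R : realType) (V : lmodType R) (X : nspace V)
    (s : nat -> V) (l : V) : Prop :=
  [/\ forall n, X (s n), X l & snorm X (s n - l) @[n --> \oo] --> (0 : R)].

Definition weak_cvg (R : realType) (V : lmodType R) (X : nspace V)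
    (s : nat -> V) (l : V) : Prop :=
  [/\ forall n, X (s n), X l &
      forall F : V -> R, dual X F -> F (s n) @[n --> \oo] --> F l].

(* s is a simple function on (0,T) with values in X, of Bochner integral I. *)
Definition simple_with_integral (R : realType) (T : R) (V : lmodType R)
    (X : nspace V) (s : R -> V) (I : V) : Prop :=
  exists (m : nat) (A : 'I_m -> set R) (v : 'I_m -> V),
    [/\ forall i, [/\ measurable (A i), A i `<=` `]0, T[ & X (v i)],
        s = (fun t => \sum_(i < m) (\1_(A i) t : R) *: v i) &
        I = \sum_(i < m) fine (lebesgue_measure (A i)) *: v i].

Definition strongly_measurable (R : realType) (T : R) (V : lmodType R)
    (X : nspace V) (f : R -> V) : Prop :=
  exists s : nat -> R -> V,
    (forall n, exists I, simple_with_integral T X (s n) I) /\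
    {ae lebesgue_measure, forall t : R, t \in `]0, T[ ->
       X (f t) /\ snorm X (s n t - f t) @[n --> \oo] --> (0 : R)}.

(* v is the Bochner integral of f over (0,T). *)
Definition is_bochner_integral (R : realType) (T : R) (V : lmodType R)
    (X : nspace V) (f : R -> V) (v : V) : Prop :=
  strongly_measurable T X f /\ X v /\
  exists (s : nat -> R -> V) (I : nat -> V),
    [/\ forall n, simple_with_integral T X (s n) (I n),
        (\int[lebesgue_measure]_(t in `]0%R, T[)
           (snorm X (s n t - f t)%R)%:E)%E @[n --> \oo] --> 0%E &
        snorm X (I n - v) @[n --> \oo] --> (0 : R)].

(* L^p(0,T;X) *)
Definition LpB (R : realType) (p T : R) (V : lmodType R) (X : nspace V) :
    nspace (R -> V) :=
  let N (f : R -> V) := Lnorm (@lebesgue_measure R) p%:E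
        (EFin \o ((fun t => snorm X (f t)) \_ `]0, T[)) in
  {| carrier := [set f : R -> V | strongly_measurable T X f /\ (N f < +oo)%E] ;
     snorm := fun f => fine (N f) |}.

Definition smooth (R : realType) (phi : R -> R) : Prop :=
  forall (n : nat) (x : R), derivable (derive1n n phi) x 1.

(* smooth functions with compact support in the open interval (0,T) *)
Definition test_time (R : realType) (T : R) (psi : R -> R) : Prop :=
  smooth psi /\ exists a b : R, [/\ 0 < a, a <= b, b < T &
    forall t, t \notin `[a, b] -> psi t = 0].

(* f and g are in L^1(0,T;X) and g is the weak derivative of f there *)
Definition is_W11_with_deriv (R : realType) (T : R) (V : lmodType R)
    (X : nspace V) (f g : R -> V) : Prop :=
  [/\ LpB 1 T X f, LpB 1 T X g &
      forall psi : R -> R, test_time T psi ->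
        exists v : V,
          is_bochner_integral T X (fun t => derive1 psi t *: f t) v /\
          is_bochner_integral T X (fun t => psi t *: g t) (- v)].

(* L^p(S^1) *)
Definition Lp (R : realType) (L p : R) : nspace (R -> R) :=
  let N (f : R -> R) :=
    Lnorm (@lebesgue_measure R) p%:E (EFin \o (f \_ `[0, L])) in
  {| carrier := [set f : R -> R | [/\ periodic f L, measurable_fun setT f
                           & (N f < +oo)%E]] ;
     snorm := fun f => fine (N f) |}.

Definition is_weak_deriv (R : realType) (L : R) (k : nat) (f g : R -> R) :
    Prop :=
  [/\ Lp L 1 f, Lp L 1 g &
      forall phi : R -> R, smooth phi -> periodic phi L ->
        \int[lebesgue_measure]_(x in `[0, L]) (f x * derive1n k phi x) =
        (-1) ^+ k * \int[lebesgue_measure]_(x in `[0, L]) (g x * phi x)].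

(* The k-th weak derivative on S^1 (a representative; the zero function when
   there is none). *)
Definition wderiv (R : realType) (L : R) (k : nat) (f : R -> R) : R -> R :=
  xget (fun=> 0) [set g : R -> R | is_weak_deriv L k f g].

(* W^{k,p}(S^1) *)
Definition sobolev (R : realType) (L : R) (k : nat) (p : R) :
    nspace (R -> R) :=
  {| carrier := [set f : R -> R | Lp L p f /\ forall j, (j <= k)%N ->
       exists2 g, is_weak_deriv L j f g & Lp L p g] ;
     snorm := fun f =>
       (\sum_(j < k.+1) snorm (Lp L p) (wderiv L j f) `^ p) `^ p^-1 |}.

Definition H2 (R : realType) (L : R) : nspace (R -> R) := sobolev L 2 2.

Definition Hm2 (R : realType) (L : R) : nspace ((R -> R) -> R) := dual (H2 L).

(* the functional on H^2(S^1) identified with an integrable function *)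
Definition functional (R : realType) (L : R) (f : R -> R) : (R -> R) -> R :=
  fun phi => \int[lebesgue_measure]_(x in `[0, L]) (f x * phi x).

Definition eqHm2 (R : realType) (L : R) (F G : (R -> R) -> R) : Prop :=
  forall phi, H2 L phi -> F phi = G phi.

Definition dt (R : realType) (phi : R -> R -> R) : R -> R -> R :=
  fun t x => derive1 (phi ^~ x) t.

Definition dx (R : realType) (phi : R -> R -> R) : R -> R -> R :=
  fun t x => derive1 (phi t) x.

Fixpoint Ck (R : realType) (k : nat) (phi : R -> R -> R) : Prop :=
  continuous (fun z : R * R => phi z.1 z.2) /\
  if k is k'.+1 then
    [/\ forall t x, derivable (phi ^~ x) t 1,
        forall t x, derivable (phi t) x 1, Ck k' (dt phi) & Ck k' (dx phi)]
  else True.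

(* A smooth function on S^1 x [0,T] is the restriction of such a function. *)
Definition test_space_time (R : realType) (L : R) (phi : R -> R -> R) : Prop :=
  (forall k, Ck k phi) /\ forall t, periodic (phi t) L.

(* u t x stands for u(x,t), and only a.e.-classes matter in it; U is the
   representative of u that is continuous in time with values in H^{-2}(S^1),
   and ut is the derivative u_t.  As ln takes the value 0 on ]-oo, 0], that
   log u(.,t) is an a.e. finite function has to be required separately. *)
Record weak_solution (R : realType) (L : R) (u0 : R -> R) (u : R -> R -> R)
    (U ut : R -> (R -> R) -> R) : Prop := WeakSolution {
  ws_W11 : forall T, 0 < T -> LpB (5 / 2) T (sobolev L 1 1) u ;
  ws_Hm2 : forall T, 0 < T ->
    is_W11_with_deriv T (Hm2 L) (fun t => functional L (u t)) ut ;
  ws_rep : {ae lebesgue_measure, forall t : R, 0 < t ->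
    eqHm2 L (U t) (functional L (u t))} ;
  ws_rep_Hm2 : forall t, 0 <= t -> Hm2 L (U t) ;
  ws_cont : forall t, 0 <= t ->
    snorm (Hm2 L) (U s - U t) @[s --> within [set s | 0 <= s] (nbhs t)]
      --> (0 : R) ;
  ws_ge0 : {ae lebesgue_measure, forall t : R, 0 < t ->
    {ae lebesgue_measure, forall x : R, 0 <= u t x}} ;
  ws_log_fin : {ae lebesgue_measure, forall t : R, 0 < t ->
    {ae lebesgue_measure, forall x : R, lne (u t x)%:E \is a fin_num}} ;
  ws_log : forall T, 0 < T ->
    LpB 2 T (H2 L) (fun t x => ln (u t x)) ;
  ws_eq : forall T, 0 < T -> forall phi, test_space_time L phi ->
    \int[lebesgue_measure]_(t in `[0, T]) ut t (phi t) +
    \int[lebesgue_measure]_(t in `[0, T])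
      (\int[lebesgue_measure]_(x in `[0, L])
        (u t x * wderiv L 2 (fun x => ln (u t x)) x * derive1n 2 (phi t) x)) = 0 ;
  ws_init : eqHm2 L (U 0) (functional L u0)
}.

(* exp y_k, where exp y_0 = u0 (also where u0 = 0 and y_0 = -oo) *)
Definition exp_iter (R : realType) (u0 : R -> R) (y : nat -> R -> R) (k : nat) :
    R -> R :=
  if k is 0 then u0 else fun x => expR (y k x).

Definition semidiscrete (R : realType) (L : R) (u0 : R -> R) (T : R) (N : nat)
    (y : nat -> R -> R) : Prop :=
  forall k, (k < N)%N ->
    H2 L (y k.+1) /\
    forall phi, H2 L phi ->
      (T / N%:R)^-1 * \int[lebesgue_measure]_(x in `[0, L])
        ((exp_iter u0 y k.+1 x - exp_iter u0 y k x) * phi x) +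
      \int[lebesgue_measure]_(x in `[0, L])
        (expR (y k.+1 x) * wderiv L 2 (y k.+1) x * wderiv L 2 phi x) = 0.

(* the function of t in (0,T] equal to a_k on (t_{k-1}, t_k], 1 <= k <= N *)
Definition step (R : realType) (V : lmodType R) (T : R) (N : nat)
    (a : nat -> V) : R -> V :=
  fun t => \sum_(k < N)
    (\1_(`](k%:R * (T / N%:R)), (k.+1%:R * (T / N%:R))]%classic) t : R)
      *: a k.+1.

Definition constructed (R : realType) (L : R) (u0 : R -> R) (u : R -> R -> R)
    (ut : R -> (R -> R) -> R) : Prop :=
  forall T, 0 < T -> exists y : nat -> nat -> R -> R,
    (forall N, (0 < N)%N -> semidiscrete L u0 T N (y N)) /\
    exists n : nat -> nat,
      [/\ {homo n : i j / (i < j)%N} /\ (forall i, (0 < n i)%N),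
          strong_cvg (LpB 2 T (Lp L 2))
            (fun i => step T (n i) (exp_iter u0 (y (n i)))) u,
          weak_cvg (LpB 2 T (H2 L))
            (fun i => step T (n i) (y (n i))) (fun t x => ln (u t x)) &
          weak_cvg (LpB 1 T (Hm2 L))
            (fun i => step T (n i) (fun k => functional L
               (fun x => (T / (n i)%:R)^-1 *
                  (exp_iter u0 (y (n i)) k x - exp_iter u0 (y (n i)) k.-1 x))))
            ut].

(* Main.v *)
(* Testing the implicit scheme with y_k shows that one step of size tau decreases
   the entropy by at least tau * int e^(y_k) (y_k)_xx^2.  With w = 2 pi / L, this
   dissipation is at least w^2 int e^y y_x^2, by Wirtinger's inequality for the
   derivative of v = e^(y/2) and an integration by parts, and the Fisher
   information int e^y y_x^2 is at least 2 w^2 times the relative entropy, by the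
   logarithmic Sobolev inequality of the circle.  So the entropy of the k-th
   iterate is at most (1 + tau M)^(-k) times the initial one, M = 2 w^4.  The
   logarithmic Sobolev inequality is obtained from the monotonicity of
   I - 2 w^2 H along the heat flow, which is only needed for trigonometric
   polynomials: convolution with a nonnegative trigonometric kernel reduces the
   general case to them.

   For a fixed t the strong convergence provides iterates, at times decreasing to
   t, which converge to U(t) when tested with H^2 functions.  Their entropies are
   bounded, so they are uniformly integrable, the limits of their integrals over
   Borel sets form an absolutely continuous measure, and its density represents
   U(t).  The entropy is lower semicontinuous along this weak convergence. *)
From HB Require Import structures.
Require Import Defs.
From mathcomp Require Import all_boot all_order all_algebra.
From mathcomp Require Import all_classical all_reals all_analysis.
From mathcomp Require Import measurable_realfun ring lra.
Set Implicit Arguments.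
Unset Strict Implicit.
Unset Printing Implicit Defensive.
Import Order.TTheory GRing.Theory Num.Theory.
Import numFieldNormedType.Exports.

Local Open Scope classical_set_scope.
Local Open Scope ring_scope.

(** * Calculus and integrals on [0, L] *)

Section Calculus.
Context {R : realType}.
Implicit Types (f g : R -> R).

(** One device links a.e. classes and weak derivatives to smooth inequalities: convolution with a
    nonnegative cosine polynomial of integral 1. It multiplies Fourier coefficients, so it commutes
    with differentiation, classical or weak, and it is self-adjoint without any use of Fubini. Being
    an average, it obeys Jensen's inequality, so convex functionals such as int g^2 or int w_x^2 / w
    do not increase under it. What is convolved differs. In the logarithmic Sobolev inequality it is
    the density; in the dissipation estimate it is its logarithm y, since y_xx is what appears
    there, and e^y is controlled because y has a Lipschitz representative. The estimate is claimed
    for every t, while the convergence of the scheme only speaks of almost every time. The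
    continuity of U in H^(-2) bridges the gap, but it yields a limit so weak that a density has to
    be recovered from it. One step gains the factor 1 / (1 + tau M) rather than e^(-tau M); the loss
    disappears as tau tends to 0. *)

Definition deriv1 f g := forall x : R, is_derive x 1 f (g x).

Lemma deriv1_eq f g h : deriv1 f g -> g =1 h -> deriv1 f h.
Proof. by move=> fg gh x; rewrite -gh. Qed.

Lemma deriv1_eqf f f' g : deriv1 f g -> f =1 f' -> deriv1 f' g.
Proof. by move=> fg /funext <-. Qed.

Lemma deriv1_cst (c : R) : deriv1 (fun=> c) (fun=> 0).
Proof. by move=> x; exact: is_derive_cst. Qed.

Lemma deriv1_id : deriv1 id (fun=> 1).
Proof. by move=> x; exact: is_derive_id. Qed.

Lemma deriv1D f f' g g' : deriv1 f f' -> deriv1 g g' ->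
  deriv1 (fun x => f x + g x) (fun x => f' x + g' x).
Proof. by move=> df dg x; have := df x; have := dg x => ? ?; exact: is_deriveD. Qed.

Lemma deriv1N f f' : deriv1 f f' -> deriv1 (fun x => - f x) (fun x => - f' x).
Proof. by move=> df x; have := df x => ?; exact: is_deriveN. Qed.

Lemma deriv1B f f' g g' : deriv1 f f' -> deriv1 g g' ->
  deriv1 (fun x => f x - g x) (fun x => f' x - g' x).
Proof. by move=> df dg; apply: deriv1D => //; exact: deriv1N. Qed.

Lemma deriv1M f f' g g' : deriv1 f f' -> deriv1 g g' ->
  deriv1 (fun x => f x * g x) (fun x => f' x * g x + f x * g' x).
Proof.
move=> df dg x; have := df x; have := dg x => ? ?.
apply: (is_derive_eq (is_deriveM _ _)).
by rewrite /GRing.scale/= addrC (mulrC (g x)).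
Qed.

Lemma deriv1Z (c : R) f f' : deriv1 f f' ->
  deriv1 (fun x => c * f x) (fun x => c * f' x).
Proof.
move=> df; apply: deriv1_eq; first exact: (deriv1M (deriv1_cst c) df).
by move=> x; rewrite mul0r add0r.
Qed.

Lemma deriv1_comp f f' g g' : deriv1 f f' -> deriv1 g g' ->
  deriv1 (fun x => f (g x)) (fun x => f' (g x) * g' x).
Proof.
move=> df dg x; have := df (g x); have := dg x => ? ?.
exact: (@is_derive1_comp _ f g).
Qed.

Lemma deriv1V f f' : (forall x, f x != 0) -> deriv1 f f' ->
  deriv1 (fun x => (f x)^-1) (fun x => - (f' x / f x ^+ 2)).
Proof.
move=> f0 df x; have := df x => ?.
apply: (is_derive_eq (is_deriveV (f0 x) _)).
by rewrite /GRing.scale/= mulNr mulrC.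
Qed.

Lemma deriv1_div f f' g g' : (forall x, g x != 0) -> deriv1 f f' -> deriv1 g g' ->
  deriv1 (fun x => f x / g x) (fun x => f' x / g x - f x * g' x / g x ^+ 2).
Proof.
move=> g0 df dg; apply: deriv1_eq; first exact: (deriv1M df (deriv1V g0 dg)).
by move=> x; rewrite mulrN mulrA.
Qed.

Lemma deriv1X f f' n : deriv1 f f' ->
  deriv1 (fun x => f x ^+ n) (fun x => n%:R * f x ^+ n.-1 * f' x).
Proof.
move=> df; elim: n => [|n IH].
  by apply: deriv1_eq; [exact: deriv1_cst|move=> x; rewrite !mul0r].
apply: (@deriv1_eqf (fun x => f x * f x ^+ n)); last by move=> x; rewrite exprS.
apply: deriv1_eq; first exact: (deriv1M df IH).
move=> x /=; case: n {IH} => [|n]; first by rewrite !mulr0n expr0; ring.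
rewrite /= exprS -(natr1 n.+1); ring.
Qed.

Lemma deriv1_expR f f' : deriv1 f f' ->
  deriv1 (fun x => expR (f x)) (fun x => expR (f x) * f' x).
Proof. by move=> df; apply: (@deriv1_comp expR expR) => // x; exact: is_derive_expR. Qed.

Lemma deriv1_cos f f' : deriv1 f f' ->
  deriv1 (fun x => cos (f x)) (fun x => - sin (f x) * f' x).
Proof.
move=> df; apply: (@deriv1_comp cos (fun x => - sin x)) => // x; exact: is_derive_cos.
Qed.

Lemma deriv1_sin f f' : deriv1 f f' ->
  deriv1 (fun x => sin (f x)) (fun x => cos (f x) * f' x).
Proof. by move=> df; apply: (@deriv1_comp sin cos) => // x; exact: is_derive_sin. Qed.

Lemma deriv1_ln f f' : (forall x, 0 < f x) -> deriv1 f f' ->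
  deriv1 (fun x => ln (f x)) (fun x => f' x / f x).
Proof.
move=> f0 df x; have := df x => ?; have := is_derive1_ln (f0 x) => ?.
by rewrite mulrC; exact: (@is_derive1_comp _ (@ln R) f).
Qed.

Lemma deriv1_sum (n : nat) (f g : nat -> R -> R) :
  (forall j, deriv1 (f j) (g j)) ->
  deriv1 (fun x => \sum_(j < n) f j x) (fun x => \sum_(j < n) g j x).
Proof.
move=> fg; elim: n => [|n IH].
  apply: deriv1_eq; last by move=> x; rewrite big_ord0.
  apply: (@deriv1_eqf (fun=> 0)); first exact: deriv1_cst.
  by move=> x; rewrite big_ord0.
apply: (@deriv1_eqf (fun x => \sum_(j < n) f j x + f n x)); last first.
  by move=> x; rewrite big_ord_recr.
apply: deriv1_eq; first exact: (deriv1D IH (fg n)).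
by move=> x; rewrite big_ord_recr.
Qed.

Lemma deriv1_continuous f g : deriv1 f g -> continuous f.
Proof.
move=> fg x; apply: differentiable_continuous; apply/derivable1_diffP.
by have := fg x => ?; exact: ex_derive.
Qed.

Lemma contD f g : continuous f -> continuous g -> continuous (fun x => f x + g x).
Proof. by move=> cf cg x; apply: cvgD; [exact: cf|exact: cg]. Qed.

Lemma contN f : continuous f -> continuous (fun x => - f x).
Proof. by move=> cf x; apply: cvgN; exact: cf. Qed.

Lemma contB f g : continuous f -> continuous g -> continuous (fun x => f x - g x).
Proof. by move=> cf cg; apply: contD => //; exact: contN. Qed.

Lemma contM f g : continuous f -> continuous g -> continuous (fun x => f x * g x).
Proof. by move=> cf cg x; apply: cvgM; [exact: cf|exact: cg]. Qed.

Lemma contZ (c : R) f : continuous f -> continuous (fun x => c * f x).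
Proof. by move=> cf; apply: contM => // x; exact: cvg_cst. Qed.

Lemma contX f n : continuous f -> continuous (fun x => f x ^+ n).
Proof.
move=> cf; elim: n => [|n IH]; first by move=> x; exact: cvg_cst.
rewrite (_ : (fun x => _) = fun x => f x * f x ^+ n); first exact: contM.
by apply/funext => x; rewrite exprS.
Qed.

Lemma contV f : (forall x, f x != 0) -> continuous f -> continuous (fun x => (f x)^-1).
Proof. by move=> f0 cf x; apply: cvgV => //; exact: cf. Qed.

Lemma cont_expR f : continuous f -> continuous (fun x => expR (f x)).
Proof. by move=> cf x; apply: continuous_comp; [exact: cf|exact: continuous_expR]. Qed.

Lemma cont_ln f : (forall x, 0 < f x) -> continuous f -> continuous (fun x => ln (f x)).
Proof. by move=> f0 cf x; apply: continuous_comp; [exact: cf|exact: continuous_ln]. Qed.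

Lemma deriv1_derivable f g x : deriv1 f g -> derivable f x 1.
Proof. by move=> fg; have := fg x => ?; exact: ex_derive. Qed.

Lemma deriv1E f g : deriv1 f g -> derive1 f = g.
Proof.
move=> fg; apply/funext => x; rewrite derive1E.
by have := fg x => ?; exact: derive_val.
Qed.

Lemma deriv1_LRcontinuous f g a b : deriv1 f g -> derivable_oo_LRcontinuous f a b.
Proof.
move=> fg; split => [x _||].
- exact: deriv1_derivable fg.
- apply: cvg_at_right_filter; exact: (deriv1_continuous fg).
- apply: cvg_at_left_filter; exact: (deriv1_continuous fg).
Qed.

End Calculus.

(** * Integrals over one period *)

Section Integrals.
Context {R : realType}.
Variable L : R.
Hypothesis L0 : 0 < L.
Implicit Types (f g : R -> R).
Local Notation mu := (@lebesgue_measure R).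

Definition intg f := mu.-integrable `[0, L] (EFin \o f).
Definition itg f : R := \int[mu]_(x in `[0, L]) f x.

Lemma mu0L : mu `[0, L]%classic = L%:E.
Proof. by rewrite lebesgue_measure_itv/= lte_fin L0 oppr0 addr0. Qed.

Lemma intg_continuous f : continuous f -> intg f.
Proof.
move=> cf; apply: continuous_compact_integrable; first exact: segment_compact.
exact: continuous_subspaceT.
Qed.

Lemma intg_bounded f (C : R) : measurable_fun `[0, L] f ->
  (forall x, x \in `[0, L] -> `|f x| <= C) -> intg f.
Proof.
move=> mf fC; apply: measurable_bounded_integrable => //.
  by rewrite [X in (X < _)%E]mu0L ltry.
exists C; split; first exact: num_real.
by move=> y Cy x /= /fC /le_trans; apply; exact: ltW.
Qed.

Lemma intg_cst (c : R) : intg (fun=> c).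
Proof. by apply: intg_continuous => x; exact: cvg_cst. Qed.

Lemma intg_meas f : intg f -> measurable_fun `[0, L] f.
Proof. by move=> /measurable_int /measurable_EFinP. Qed.

Lemma intgD f g : intg f -> intg g -> intg (fun x => f x + g x).
Proof. by move=> F G; exact: (integrableD _ F G). Qed.

Lemma intgN f : intg f -> intg (fun x => - f x).
Proof. by move=> F; exact: (integrableN F). Qed.

Lemma intgB f g : intg f -> intg g -> intg (fun x => f x - g x).
Proof. by move=> F G; apply: intgD => //; exact: intgN. Qed.

Lemma intgZ (c : R) f : intg f -> intg (fun x => c * f x).
Proof. by move=> F; exact: (integrableZl _ c F). Qed.

Lemma intg_le f g : measurable_fun `[0, L] f -> intg g ->
  (forall x, x \in `[0, L] -> `|f x| <= `|g x|) -> intg f.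
Proof.
move=> mf ig fg; apply: le_integrable ig => //; exact/measurable_EFinP.
Qed.

Lemma intgM f g (C : R) : intg f -> measurable_fun `[0, L] g ->
  (forall x, x \in `[0, L] -> `|g x| <= C) -> intg (fun x => f x * g x).
Proof.
move=> F mg gC; apply: (@intg_le _ (fun x => C * f x)).
- by apply: measurable_funM => //; exact: intg_meas.
- exact: intgZ.
- move=> x xI; rewrite !normrM mulrC ler_wpM2r//.
  by rewrite (le_trans (gC _ xI))// ler_norm.
Qed.

Lemma cont_bounded f : continuous f -> exists C : R, forall x, x \in `[0, L] -> `|f x| <= C.
Proof.
move=> cf.
have cN : {within `[0, L], continuous (fun x => `|f x|)}.
  by apply: continuous_subspaceT => x; apply: cvg_norm; exact: cf.
have [c _ cP] := EVT_max (ltW L0) cN.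
by exists `|f c| => x xI; exact: cP.
Qed.

Lemma intgMc f g : intg f -> continuous g -> intg (fun x => f x * g x).
Proof.
move=> F cg; have [C gC] := cont_bounded cg; apply: (intgM F _ gC).
exact: measurable_funTS (continuous_measurable_fun cg).
Qed.

Lemma intg_sum (n : nat) (f : nat -> R -> R) : (forall j, intg (f j)) ->
  intg (fun x => \sum_(j < n) f j x).
Proof.
move=> F; elim: n => [|n IH].
  rewrite (_ : (fun _ => _) = fun=> 0); first exact: intg_cst.
  by apply/funext => x; rewrite big_ord0.
rewrite (_ : (fun _ => _) = fun x => \sum_(j < n) f j x + f n x); first exact: intgD.
by apply/funext => x; rewrite big_ord_recr.
Qed.

Lemma itgD f g : intg f -> intg g -> itg (fun x => f x + g x) = itg f + itg g.
Proof. by move=> F G; exact: RintegralD. Qed.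

Lemma itgB f g : intg f -> intg g -> itg (fun x => f x - g x) = itg f - itg g.
Proof. by move=> F G; exact: RintegralB. Qed.

Lemma itgZ (c : R) f : intg f -> itg (fun x => c * f x) = c * itg f.
Proof. by move=> F; exact: RintegralZl. Qed.

Lemma itgZr (c : R) f : intg f -> itg (fun x => f x * c) = itg f * c.
Proof. by move=> F; exact: RintegralZr. Qed.

Lemma itgN f : intg f -> itg (fun x => - f x) = - itg f.
Proof.
move=> F; rewrite -mulN1r -itgZ//; congr itg; apply/funext => x.
by rewrite mulN1r.
Qed.

Lemma itg_cst (c : R) : itg (fun=> c) = c * L.
Proof. by rewrite /itg Rintegral_cst//= mu0L. Qed.

Lemma itg_sum (n : nat) (f : nat -> R -> R) : (forall j, intg (f j)) ->
  itg (fun x => \sum_(j < n) f j x) = \sum_(j < n) itg (f j).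
Proof.
move=> F; elim: n => [|n IH].
  rewrite big_ord0 (_ : (fun _ => _) = fun=> 0) ?itg_cst ?mul0r//.
  by apply/funext => x; rewrite big_ord0.
rewrite big_ord_recr/= -IH -itgD//; last exact: intg_sum.
by congr itg; apply/funext => x; rewrite big_ord_recr.
Qed.

Lemma itg_ge0 f : (forall x, x \in `[0, L] -> 0 <= f x) -> 0 <= itg f.
Proof. by move=> f0; exact: Rintegral_ge0. Qed.

Lemma itg_le f g : intg f -> intg g ->
  (forall x, x \in `[0, L] -> f x <= g x) -> itg f <= itg g.
Proof. by move=> F G fg; exact: le_Rintegral. Qed.

Lemma eq_itg f g : (forall x, x \in `[0, L] -> f x = g x) -> itg f = itg g.
Proof. by move=> fg; apply: eq_Rintegral => x /set_mem; exact: fg. Qed.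

Lemma itg_norm f : intg f -> `|itg f| <= itg (fun x => `|f x|).
Proof. by move=> F; exact: le_normr_Rintegral. Qed.

Lemma intg_norm f : intg f -> intg (fun x => `|f x|).
Proof. by move=> F; exact: (integrable_abse F). Qed.

Lemma ftc f g : deriv1 f g -> continuous g -> itg g = f L - f 0.
Proof.
move=> fg cg; rewrite /itg /Rintegral (@continuous_FTC2 _ _ f)//.
- exact: continuous_subspaceT.
- exact: deriv1_LRcontinuous fg.
- by move=> x _; rewrite (deriv1E fg).
Qed.

Lemma itg_periodic0 f g : deriv1 f g -> continuous g -> f L = f 0 -> itg g = 0.
Proof. by move=> fg cg fL; rewrite (ftc fg cg) fL subrr. Qed.

Lemma ae_eq_itg f g : intg f -> measurable_fun `[0, L] g ->
  ae_eq mu `[0, L]%classic f g -> intg g /\ itg f = itg g.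
Proof.
move=> F mg fg.
have fg' : ae_eq mu `[0, L]%classic (EFin \o f) (EFin \o g).
  by apply: filterS fg => x /= E /E ->.
have mf := intg_meas F.
split; last first.
  by rewrite /itg /Rintegral; congr fine; apply: ae_eq_integral => //;
    exact/measurable_EFinP.
have /integrableP[_ ifoo] := F; apply/integrableP; split; first exact/measurable_EFinP.
rewrite (_ : (\int[mu]_(x in _) _ = \int[mu]_(x in `[0%R, L]) `|(f x)%:E|)%E)//.
apply: ae_eq_integral => //.
- by apply: measurableT_comp => //; exact/measurable_EFinP.
- by apply: measurableT_comp => //; exact/measurable_EFinP.
- by apply: filterS fg => x /= E /E ->.
Qed.

End Integrals.

(** * Trigonometric polynomials *)

Section TrigPolynomials.
Context {R : realType}.
Variable L : R.
Hypothesis L0 : 0 < L.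
Implicit Types (f g h : R -> R) (a b : nat -> R).
Local Notation intg := (intg L).
Local Notation itg := (itg L).

(* The lock makes ring and field treat the frequency as an atom. *)
Definition freq : R := locked (2 * pi / L).

Lemma freqE : freq = 2 * pi / L.
Proof. by rewrite /freq -lock. Qed.

Lemma freq_gt0 : 0 < freq.
Proof. by rewrite freqE divr_gt0// mulr_gt0// pi_gt0. Qed.

Lemma freqL : freq * L = 2 * pi.
Proof. by rewrite freqE -mulrA mulVf ?mulr1// gt_eqF. Qed.

Lemma cos_int_period (j : nat) (x : R) : cos (x + j%:R * (2 * pi)) = cos x.
Proof.
elim: j => [|j IH]; first by rewrite mul0r addr0.
rewrite (_ : x + _ = x + j%:R * (2 * pi) + pi *+ 2) ?cosD2pi//.
by rewrite -natr1 -(mulr_natl pi 2); ring.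
Qed.

Lemma sin_int_period (j : nat) (x : R) : sin (x + j%:R * (2 * pi)) = sin x.
Proof.
elim: j => [|j IH]; first by rewrite mul0r addr0.
rewrite (_ : x + _ = x + j%:R * (2 * pi) + pi *+ 2) ?sinD2pi//.
by rewrite -natr1 -(mulr_natl pi 2); ring.
Qed.

Lemma cos_freq_period (j : nat) (x : R) :
  cos (j%:R * freq * (x + L)) = cos (j%:R * freq * x).
Proof. by rewrite mulrDr -(mulrA j%:R freq L) freqL cos_int_period. Qed.

Lemma sin_freq_period (j : nat) (x : R) :
  sin (j%:R * freq * (x + L)) = sin (j%:R * freq * x).
Proof. by rewrite mulrDr -(mulrA j%:R freq L) freqL sin_int_period. Qed.

Lemma deriv1_linear (c : R) : deriv1 (fun x => c * x) (fun=> c).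
Proof.
by apply: deriv1_eq; [exact: (deriv1Z c deriv1_id)|move=> x; rewrite mulr1].
Qed.

Lemma deriv1_cosl (c : R) : deriv1 (fun x => cos (c * x)) (fun x => - c * sin (c * x)).
Proof.
apply: deriv1_eq; first exact: (deriv1_cos (deriv1_linear c)).
by move=> x; rewrite !mulNr mulrC.
Qed.

Lemma deriv1_sinl (c : R) : deriv1 (fun x => sin (c * x)) (fun x => c * cos (c * x)).
Proof.
apply: deriv1_eq; first exact: (deriv1_sin (deriv1_linear c)).
by move=> x; rewrite mulrC.
Qed.

Definition tpterm (al be : R) (j : nat) (x : R) :=
  al * cos (j%:R * freq * x) + be * sin (j%:R * freq * x).

Definition tp (n : nat) a b (x : R) := \sum_(j < n) tpterm (a j) (b j) j x.

(** Cosine and sine coefficients of the derivative of [tp n a b]. The second derivative multiplies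
    both families by the same factors, which is [lapl]. *)
Definition dcos (a b : nat -> R) (j : nat) : R := j%:R * freq * b j.
Definition dsin (a b : nat -> R) (j : nat) : R := - (j%:R * freq * a j).
Definition lapl (a : nat -> R) (j : nat) : R := - ((j%:R * freq) ^+ 2 * a j).

Lemma deriv1_tpterm al be j : deriv1 (tpterm al be j)
  (tpterm (j%:R * freq * be) (- (j%:R * freq * al)) j).
Proof.
apply: deriv1_eq.
  by apply: deriv1D; apply: deriv1Z; [exact: deriv1_cosl|exact: deriv1_sinl].
move=> x; rewrite /tpterm; ring.
Qed.

Lemma deriv1_tp n a b : deriv1 (tp n a b) (tp n (dcos a b) (dsin a b)).
Proof.
exact: (@deriv1_sum _ n (fun j => tpterm (a j) (b j) j)
  (fun j => tpterm (dcos a b j) (dsin a b j) j) (fun j => deriv1_tpterm _ _ _)).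
Qed.

Lemma tp_continuous n a b : continuous (tp n a b).
Proof. exact: deriv1_continuous (deriv1_tp n a b). Qed.

Lemma tp_lapl n a b :
  tp n (dcos (dcos a b) (dsin a b)) (dsin (dcos a b) (dsin a b)) =
  tp n (lapl a) (lapl b).
Proof.
apply/funext => x; apply: eq_bigr => j _.
by rewrite /tpterm /dcos /dsin /lapl; ring.
Qed.

Lemma tpterm_period al be j x : tpterm al be j (x + L) = tpterm al be j x.
Proof. by rewrite /tpterm cos_freq_period sin_freq_period. Qed.

Lemma tp_period n a b x : tp n a b (x + L) = tp n a b x.
Proof. by apply: eq_bigr => j _; rewrite tpterm_period. Qed.

Lemma tp_0L n a b : tp n a b L = tp n a b 0.
Proof. by rewrite -[L in LHS]add0r tp_period. Qed.

Lemma tp_bound n a b x : `|tp n a b x| <= \sum_(j < n) (`|a j| + `|b j|).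
Proof.
apply: (le_trans (ler_norm_sum _ _ _)); apply: ler_sum => j _.
apply: (le_trans (ler_normD _ _)); rewrite !normrM; apply: lerD.
- by rewrite ler_piMr// cos_max.
- by rewrite ler_piMr// sin_max.
Qed.

Lemma itg_tpterm al be j : itg (tpterm al be j) = if j == 0%N then al * L else 0.
Proof.
case: eqP => [->|/eqP j0].
  rewrite (_ : tpterm _ _ _ = fun=> al) ?itg_cst//.
  by apply/funext => x; rewrite /tpterm !mul0r cos0 sin0 mulr0 addr0 mulr1.
have jw0 : j%:R * freq != 0.
  by rewrite mulf_neq0 ?pnatr_eq0// gt_eqF// freq_gt0.
apply: (itg_periodic0 L0 (f := tpterm (- (be / (j%:R * freq))) (al / (j%:R * freq)) j)).
- apply: deriv1_eq; first exact: deriv1_tpterm.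
  move=> x; move: jw0; rewrite /tpterm; move: (j%:R * freq) => k k0; field.
  exact: k0.
- exact: deriv1_continuous (deriv1_tpterm _ _ _).
- by rewrite -[L in LHS]add0r tpterm_period.
Qed.

(** Both factors are eigenfunctions of the second derivative, with distinct eigenvalues, so their
    product is, up to the constant [k], the derivative of their periodic Wronskian. *)
Lemma itg_tpterm_ortho al be al' be' i j : i != j ->
  itg (fun x => tpterm al be i x * tpterm al' be' j x) = 0.
Proof.
move=> ij.
pose d al be (j : nat) := tpterm (j%:R * freq * be) (- (j%:R * freq * al)) j.
have ijw : (j%:R * freq) ^+ 2 - (i%:R * freq) ^+ 2 != 0.
  have := freq_gt0; move: freq => w w0; rewrite !exprMn -mulrBl.
  by rewrite mulf_neq0 ?expf_neq0 ?[w == 0]gt_eqF// subr_eq0 eqrXn2// eqr_nat eq_sym.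
set k := (X in X != 0) in ijw.
apply: (itg_periodic0 L0 (f := fun x => k^-1 *
   (d al be i x * tpterm al' be' j x - tpterm al be i x * d al' be' j x))).
- apply: deriv1_eq.
    by apply: deriv1Z; apply: deriv1B; apply: deriv1M; exact: deriv1_tpterm.
  move=> x; rewrite /d.
  transitivity (k^-1 * (k * (tpterm al be i x * tpterm al' be' j x))).
    by congr (_ * _); rewrite /k /tpterm; ring.
  by rewrite mulKf.
- by apply: deriv1_continuous; apply: deriv1M; exact: deriv1_tpterm.
- by rewrite /d -[L in LHS]add0r !tpterm_period.
Qed.

Lemma intg_tpterm2 al be al' be' i j :
  intg (fun x => tpterm al be i x * tpterm al' be' j x).
Proof.
by apply: intg_continuous; apply: deriv1_continuous; apply: deriv1M;
  exact: deriv1_tpterm.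
Qed.

Lemma itg_tp_mul n a b a' b' : itg (fun x => tp n a b x * tp n a' b' x) =
  \sum_(j < n) itg (fun x => tpterm (a j) (b j) j x * tpterm (a' j) (b' j) j x).
Proof.
rewrite (_ : (fun x => _) = fun x => \sum_(i < n)
    \sum_(j < n) tpterm (a i) (b i) i x * tpterm (a' j) (b' j) j x); last first.
  apply/funext => x; rewrite /tp mulr_suml; apply: eq_bigr => i _.
  by rewrite mulr_sumr.
rewrite (itg_sum L0 n (f := fun i x => \sum_(j < n)
    tpterm (a i) (b i) i x * tpterm (a' j) (b' j) j x)); last first.
  move=> i; apply: (intg_sum n (f := fun j x =>
    tpterm (a i) (b i) i x * tpterm (a' j) (b' j) j x)) => j.
  exact: intg_tpterm2.
apply: eq_bigr => i _.
rewrite (itg_sum L0 n (f := fun j x =>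
    tpterm (a i) (b i) i x * tpterm (a' j) (b' j) j x)); last first.
  by move=> j; exact: intg_tpterm2.
rewrite (bigD1 i)//= big1 ?addr0// => j ji.
by rewrite itg_tpterm_ortho// eq_sym.
Qed.

Lemma itg_tp n a b : itg (tp n a b) = if n is 0%N then 0 else a 0%N * L.
Proof.
rewrite (itg_sum L0 n (f := fun j => tpterm (a j) (b j) j)); last first.
  by move=> j; apply: intg_continuous; exact: deriv1_continuous (deriv1_tpterm _ _ _).
case: n => [|n]; first by rewrite big_ord0.
rewrite big_ord_recl/= itg_tpterm/= big1 ?addr0// => j _.
by rewrite itg_tpterm.
Qed.

(** By parts, int f'^2 = - int f f'', which by orthogonality is the sum over the modes of (j freq)^2
    times their energy. Only the mode j = 0 has a factor below freq^2, and it vanishes because the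
    mean is zero. *)
Lemma tp_wirtinger n a b : itg (tp n a b) = 0 ->
  freq ^+ 2 * itg (fun x => tp n a b x ^+ 2) <=
  itg (fun x => tp n (dcos a b) (dsin a b) x ^+ 2).
Proof.
move=> m0.
have -> : itg (fun x => tp n (dcos a b) (dsin a b) x ^+ 2) =
    \sum_(j < n) (j%:R * freq) ^+ 2 *
      itg (fun x => tpterm (a j) (b j) j x * tpterm (a j) (b j) j x).
  transitivity (- itg (fun x => tp n a b x * tp n (lapl a) (lapl b) x)).
    apply/eqP; rewrite -subr_eq0 opprK -itgD//.
    - apply/eqP/(itg_periodic0 L0
        (f := fun x => tp n a b x * tp n (dcos a b) (dsin a b) x)).
      + apply: deriv1_eq; first by apply: deriv1M; exact: deriv1_tp.
        by move=> x; rewrite tp_lapl expr2.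
      + by apply: contD; [apply: contX|apply: contM]; exact: tp_continuous.
      + by rewrite !tp_0L.
    - by apply: intg_continuous; apply: contX; exact: tp_continuous.
    - by apply: intg_continuous; apply: contM; exact: tp_continuous.
  rewrite itg_tp_mul -sumrN; apply: eq_bigr => j _.
  rewrite -itgZ//; last exact: intg_tpterm2.
  rewrite -itgN; last exact: intg_tpterm2.
  by apply: eq_itg => x _; rewrite /tpterm /lapl; ring.
rewrite (_ : (fun x => tp n a b x ^+ 2) = fun x => tp n a b x * tp n a b x)//.
rewrite itg_tp_mul mulr_sumr; apply: ler_sum => -[[|j] jn] _ /=.
  rewrite mul0r expr0n mul0r.
  case: n jn m0 => // n _; rewrite itg_tp => /eqP.
  rewrite mulf_eq0 [L == 0]gt_eqF// orbF => /eqP ->.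
  rewrite (_ : (fun x => _) = fun=> 0) ?itg_cst ?mul0r ?mulr0//.
  by apply/funext => x; rewrite /tpterm !mul0r sin0 mulr0 addr0 mulr0.
rewrite ler_wpM2r//.
  by apply: itg_ge0 => x _; rewrite -expr2 sqr_ge0.
have := freq_gt0; move: freq => w w0.
by rewrite exprMn ler_peMl ?sqr_ge0// expr_ge1// ler1n.
Qed.

End TrigPolynomials.

(** * A nonnegative trigonometric kernel *)

Section Kernel.
Context {R : realType}.
Variable L : R.
Hypothesis L0 : 0 < L.
Implicit Types (f g h : R -> R) (a b : nat -> R).
Local Notation intg := (intg L).
Local Notation itg := (itg L).
Local Notation freq := (freq L).
Local Notation tp := (tp L).

(** This is cos^2 (freq x / 2), the L-periodic bump with maximum 1 at 0. *)
Definition cosbump (x : R) : R := (1 + cos (freq * x)) / 2.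

Lemma cosbump_ge0 x : 0 <= cosbump x.
Proof. by rewrite divr_ge0// addrC -lerBlDr sub0r cos_geN1. Qed.

Lemma cosbumpN x : cosbump (- x) = cosbump x.
Proof. by rewrite /cosbump mulrN cosN. Qed.

Lemma cosbump0 : cosbump 0 = 1.
Proof. by rewrite /cosbump mulr0 cos0 divff. Qed.

Lemma cosbump_continuous : continuous cosbump.
Proof.
apply: contM => [|x]; last exact: cvg_cst.
apply: contD => [x|]; first exact: cvg_cst.
exact: deriv1_continuous (deriv1_cosl _).
Qed.

Definition cospoly f := exists n b, forall x,
  f x = \sum_(j < n) b j * cos (j%:R * freq * x).

Lemma cospoly_cos j : cospoly (fun x => cos (j%:R * freq * x)).
Proof.
exists j.+1, (fun i => (i == j)%:R) => x.
rewrite big_ord_recr/= eqxx mul1r big1 ?add0r// => i _.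
by rewrite [(_ == _ :> nat)]ltn_eqF ?mul0r.
Qed.

Lemma cospolyD f g : cospoly f -> cospoly g -> cospoly (fun x => f x + g x).
Proof.
move=> [n [b fE]] [m [c gE]].
exists (n + m)%N, (fun j => (if (j < n)%N then b j else 0) + (if (j < m)%N then c j else 0)) => x.
rewrite fE gE; under [in RHS]eq_bigr do rewrite mulrDl.
rewrite big_split/=; congr (_ + _).
- rewrite big_split_ord/= [X in _ + X]big1 ?addr0.
    by apply: eq_bigr => i _; rewrite ltn_ord.
  by move=> i _; rewrite ltnNge leq_addr mul0r.
- rewrite addnC big_split_ord/= [X in _ + X]big1 ?addr0.
    by apply: eq_bigr => i _; rewrite ltn_ord.
  by move=> i _; rewrite ltnNge leq_addr mul0r.
Qed.

Lemma cospolyZ (c : R) f : cospoly f -> cospoly (fun x => c * f x).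
Proof.
move=> [n [b fE]]; exists n, (fun j => c * b j) => x.
by rewrite fE mulr_sumr; apply: eq_bigr => i _; rewrite mulrA.
Qed.

Lemma cospoly_ext f g : f =1 g -> cospoly f -> cospoly g.
Proof. by move=> /funext ->. Qed.

(** The product-to-sum formula; the case j = 0 is apart since the frequency j - 1 would be
    negative. *)
Lemma cosbump_cos j : cospoly (fun x => cosbump x * cos (j%:R * freq * x)).
Proof.
case: j => [|j].
  apply: (@cospoly_ext (fun x => 2^-1 * cos (0%:R * freq * x) + 2^-1 * cos (1%:R * freq * x))).
    by move=> x; rewrite /cosbump mul1r !mul0r cos0; field.
  by apply: cospolyD; apply: cospolyZ; exact: cospoly_cos.
apply: (@cospoly_ext (fun x => 2^-1 * cos (j.+1%:R * freq * x) +
    (4^-1 * cos (j.+2%:R * freq * x) + 4^-1 * cos (j%:R * freq * x)))).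
  move=> x; rewrite /cosbump.
  rewrite (_ : j.+2%:R * freq * x = j.+1%:R * freq * x + freq * x); last first.
    by rewrite -(natr1 j.+1); ring.
  rewrite (_ : j%:R * freq * x = j.+1%:R * freq * x - freq * x); last first.
    by rewrite -(natr1 j); ring.
  by rewrite cosD cosB; field.
by apply: cospolyD; [|apply: cospolyD]; apply: cospolyZ; exact: cospoly_cos.
Qed.

Lemma cospoly_bumpM f : cospoly f -> cospoly (fun x => cosbump x * f x).
Proof.
move=> [n [b /funext ->]]; elim: n => [|n IH].
  exists 0%N, b => x; rewrite !big_ord0 mulr0//.
apply: (@cospoly_ext (fun x => cosbump x * (\sum_(j < n) b j * cos (j%:R * freq * x)) +
    b n * (cosbump x * cos (n%:R * freq * x)))).
  by move=> x; rewrite big_ord_recr/=; ring.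
by apply: cospolyD => //; apply: cospolyZ; exact: cosbump_cos.
Qed.

Lemma cospoly_bumpX k : cospoly (fun x => cosbump x ^+ k).
Proof.
elim: k => [|k IH].
  apply: cospoly_ext (cospoly_cos 0) => x.
  by rewrite !mul0r cos0.
by apply: cospoly_ext (cospoly_bumpM IH) => x; rewrite exprS.
Qed.

Definition bumpmass k : R := itg (fun x => cosbump x ^+ k).

(* cosbump ^+ k is nonnegative, concentrates at 0, and is a cosine polynomial;
   hence the convolution of any integrable function with this kernel is a
   trigonometric polynomial. *)
Definition bumpker k (x : R) : R := cosbump x ^+ k / bumpmass k.

Lemma bumpX_continuous k : continuous (fun x => cosbump x ^+ k).
Proof. by apply: contX; exact: cosbump_continuous. Qed.

Lemma intg_indic (p q : R) : intg (\1_`[p, q]%classic : R -> R).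
Proof.
apply: (@intg_bounded _ _ L0 _ 1).
  by apply: measurable_indic.
by move=> x _; rewrite indicE; case: (_ \in _) => /=; rewrite ?normr1 ?normr0.
Qed.

Lemma itg_indic (p q : R) : 0 <= p -> p <= q -> q <= L ->
  itg (\1_`[p, q]%classic : R -> R) = q - p.
Proof.
move=> p0 pq qL; rewrite /itg /Rintegral integral_indic//=.
rewrite (setIidl _); last by apply: subset_itv; rewrite bnd_simp.
by rewrite lebesgue_measure_itv/= lte_fin; case: ltgtP pq => // ->; rewrite subrr.
Qed.

Lemma bump_near0 (d : R) : 0 < d -> exists2 r : R, 0 < r <= L &
  forall x, 0 <= x <= r -> 1 - d <= cosbump x.
Proof.
move=> d0.
have /cvgrPdist_lt /(_ _ d0) := @cosbump_continuous 0.
rewrite cosbump0 => -[e /= e0 He].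
exists (Num.min (e / 2) L).
  by rewrite lt_min divr_gt0// L0 ge_min lexx orbT.
move=> x /andP[x0]; rewrite le_min => /andP[xe _].
have /He : ball (0 : R) e x.
  by rewrite /ball/= sub0r normrN ger0_norm// (le_lt_trans xe)// ltr_pdivrMr// ltr_pMr ?ltr1n.
rewrite /= ltr_norml => /andP[_]; rewrite ltrBlDr -ltrBlDl => /ltW; exact.
Qed.

(** The mass decays more slowly than any geometric sequence of ratio below 1: near 0 the bump is at
    least 1 - d. *)
Lemma bumpmass_ge (d : R) : 0 < d -> d <= 1 -> exists2 r : R, 0 < r &
  forall k, (1 - d) ^+ k * r <= bumpmass k.
Proof.
move=> d0 d1; have [r /andP[r0 rL] Hr] := bump_near0 d0.
exists r => // k.
rewrite -[r in leLHS](subr0 r) -(@itg_indic 0 r)//; last exact: ltW.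
rewrite -itgZ; last exact: intg_indic.
apply: itg_le.
- by apply: intgZ; exact: intg_indic.
- by apply: intg_continuous; exact: bumpX_continuous.
- move=> x _; rewrite indicE; case: (boolP (x \in _)) => [/set_mem/=|_].
    rewrite in_itv/= => xr; rewrite mulr1 lerXn2r//.
      by rewrite nnegrE subr_ge0.
    by rewrite nnegrE cosbump_ge0.
    exact: Hr.
  by rewrite mulr0 exprn_ge0// cosbump_ge0.
Qed.

Lemma bumpmass_gt0 k : 0 < bumpmass k.
Proof.
have h2 : 0 < 2^-1 :> R by rewrite invr_gt0.
have [|r r0 /(_ k)] := bumpmass_ge h2; first by rewrite invf_le1// ler1n.
apply: lt_le_trans; rewrite mulr_gt0// exprn_gt0//.
by rewrite subr_gt0 invf_lt1// ltr1n.
Qed.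

Lemma bumpker_ge0 k x : 0 <= bumpker k x.
Proof. by rewrite divr_ge0 ?exprn_ge0 ?cosbump_ge0// ltW// bumpmass_gt0. Qed.

Lemma bumpker_continuous k : continuous (bumpker k).
Proof. by apply: contM => [|x]; [exact: bumpX_continuous|exact: cvg_cst]. Qed.

Lemma bumpkerN k x : bumpker k (- x) = bumpker k x.
Proof. by rewrite /bumpker cosbumpN. Qed.

(** Where the bump is at most 1 - d its power is at most (1 - d)^k, while the mass is at least (1 -
    d/2)^k r; the quotient is geometric of ratio [rho] < 1. *)
Lemma bumpker_small (d e : R) : 0 < d -> 0 < e -> exists K : nat, forall k, (K <= k)%N ->
  forall x, cosbump x <= 1 - d -> bumpker k x <= e.
Proof.
move=> d0 e0.
have [d1|d1] := ltP 1 d.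
  by exists 0%N => k _ x; rewrite leNgt (lt_le_trans _ (cosbump_ge0 x))// subr_lt0.
have [||r r0 Hr] := @bumpmass_ge (d / 2).
- by rewrite divr_gt0.
- by rewrite ler_pdivrMr// mul1r (le_trans d1)// ler1n.
have d2 : 0 < 1 - d / 2.
  by rewrite subr_gt0 ltr_pdivrMr// mul1r (le_lt_trans d1)// ltr1n.
pose rho := (1 - d) / (1 - d / 2).
have rho0 : 0 <= rho by apply: divr_ge0; [rewrite subr_ge0|exact: ltW].
have rho1 : rho < 1.
  by rewrite ltr_pdivrMr// mul1r ltrD2l ltrN2 ltr_pdivrMr// ltr_pMr// ltr1n.
have : (fun k => rho ^+ k) @ \oo --> (0 : R).
  by apply: cvg_expr; rewrite ger0_norm.
have er0 : 0 < e * r by rewrite mulr_gt0.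
move=> /cvgrPdist_lt /(_ _ er0) [K _ HK].
exists K => k Kk x xd.
have {HK} := HK _ Kk; rewrite /= sub0r normrN ger0_norm ?exprn_ge0// => rk.
rewrite /bumpker ler_pdivrMr ?bumpmass_gt0//.
apply: (@le_trans _ _ (e * ((1 - d / 2) ^+ k * r))); last first.
  by rewrite ler_wpM2l// ltW.
apply: (@le_trans _ _ ((1 - d) ^+ k)).
  by rewrite lerXn2r// nnegrE ?cosbump_ge0 ?subr_ge0.
rewrite mulrCA mulrC -ler_pdivrMr ?exprn_gt0//.
by rewrite -expr_div_n ltW.
Qed.

Definition conv k h (x : R) : R := itg (fun z => h z * bumpker k (x - z)).

Lemma bumpkerB_continuous k x : continuous (fun z => bumpker k (x - z)).
Proof.
move=> z; apply: (@continuous_comp _ _ _ (fun z => x - z) (bumpker k)).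
  by apply: cvgB; [exact: cvg_cst|exact: cvg_id].
exact: bumpker_continuous.
Qed.

Lemma bumpker_cospoly k : exists n b, forall x,
  bumpker k x = \sum_(j < n) b j * cos (j%:R * freq * x).
Proof.
apply: cospoly_ext (cospolyZ (bumpmass k)^-1 (cospoly_bumpX k)) => x.
by rewrite mulrC.
Qed.

Definition coscoef h (j : nat) : R := itg (fun z => h z * cos (j%:R * freq * z)).
Definition sincoef h (j : nat) : R := itg (fun z => h z * sin (j%:R * freq * z)).

Lemma intg_mul_cosl h (c : R) : intg h -> intg (fun z => h z * cos (c * z)).
Proof. by move=> ih; apply: intgMc => //; exact: deriv1_continuous (deriv1_cosl c). Qed.

Lemma intg_mul_sinl h (c : R) : intg h -> intg (fun z => h z * sin (c * z)).
Proof. by move=> ih; apply: intgMc => //; exact: deriv1_continuous (deriv1_sinl c). Qed.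

(** The addition formula for cos (j freq (x - z)) separates the variables, so convolution with the
    kernel multiplies Fourier coefficients. *)
Lemma convE k n b : (forall x, bumpker k x = \sum_(j < n) b j * cos (j%:R * freq * x)) ->
  forall h, intg h -> conv k h =
    tp n (fun j => b j * coscoef h j) (fun j => b j * sincoef h j).
Proof.
move=> kE h ih; apply/funext => x.
pose F j z := b j * cos (j%:R * freq * x) * (h z * cos (j%:R * freq * z)) +
   b j * sin (j%:R * freq * x) * (h z * sin (j%:R * freq * z)).
have iF j : intg (F j).
  by apply: intgD; apply: intgZ; [exact: intg_mul_cosl|exact: intg_mul_sinl].
rewrite /conv (_ : (fun z => _) = fun z => \sum_(j < n) F j z); last first.
  apply/funext => z; rewrite kE mulr_sumr; apply: eq_bigr => j _.
  by rewrite mulrBr cosB /F; ring.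
rewrite itg_sum//; apply: eq_bigr => j _.
rewrite itgD ?itgZ//.
- by rewrite /tpterm /coscoef /sincoef; ring.
- exact: intg_mul_sinl.
- exact: intg_mul_cosl.
- by apply: intgZ; exact: intg_mul_cosl.
- by apply: intgZ; exact: intg_mul_sinl.
Qed.

Lemma conv_tp k : exists n b, forall h, intg h -> conv k h =
  tp n (fun j => b j * coscoef h j) (fun j => b j * sincoef h j).
Proof. by have [n [b /convE]] := bumpker_cospoly k; exists n, b. Qed.

Lemma conv_continuous k h : intg h -> continuous (conv k h).
Proof. by have [n [b E]] := conv_tp k => ih; rewrite E//; exact: tp_continuous. Qed.

(** Both sides are the same symmetric bilinear form in the Fourier coefficients of [f] and [g]. *)
Lemma conv_selfadjoint k f g : intg f -> intg g ->
  itg (fun x => f x * conv k g x) = itg (fun x => g x * conv k f x).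
Proof.
move=> fi gi; have [n [b E]] := conv_tp k.
have aux f' g' : intg f' -> intg g' -> itg (fun x => f' x * conv k g' x) =
    \sum_(j < n) b j * (coscoef f' j * coscoef g' j + sincoef f' j * sincoef g' j).
  move=> if' ig'.
  pose F j z := b j * coscoef g' j * (f' z * cos (j%:R * freq * z)) +
   b j * sincoef g' j * (f' z * sin (j%:R * freq * z)).
  have iF j : intg (F j).
    by apply: intgD; apply: intgZ; [exact: intg_mul_cosl|exact: intg_mul_sinl].
  rewrite E// (_ : (fun z => _) = fun z => \sum_(j < n) F j z); last first.
    apply/funext => z; rewrite mulr_sumr; apply: eq_bigr => j _.
    by rewrite /F /tpterm; ring.
  rewrite itg_sum//; apply: eq_bigr => j _.
  rewrite itgD ?itgZ//.
  - by rewrite /coscoef /sincoef; ring.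
  - exact: intg_mul_sinl.
  - exact: intg_mul_cosl.
  - by apply: intgZ; exact: intg_mul_cosl.
  - by apply: intgZ; exact: intg_mul_sinl.
by rewrite !aux//; apply: eq_bigr => j _; ring.
Qed.

(** All coefficients of the constant 1 of index j > 0 vanish, so its convolution does not depend on
    x. At x = 0 evenness of the kernel gives the normalized mass. *)
Lemma conv_cst k c x : conv k (fun=> c) x = c.
Proof.
have [n [b kE]] := bumpker_cospoly k.
have coef0 (j : nat) al be : j != 0%N ->
    itg (fun z => al * cos (j%:R * freq * z) + be * sin (j%:R * freq * z)) = 0.
  by move=> /negbTE j0; have := itg_tpterm L0 al be j; rewrite j0.
have cc (j : nat) : j != 0%N -> coscoef (fun=> 1) j = 0.
  move=> j0; rewrite -(coef0 j 1 0 j0); apply: eq_itg => z _.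
  by rewrite mul0r addr0.
have cs (j : nat) : j != 0%N -> sincoef (fun=> 1) j = 0.
  move=> j0; rewrite -(coef0 j 0 1 j0); apply: eq_itg => z _.
  by rewrite mul0r add0r.
have h1 y : conv k (fun=> 1) y = conv k (fun=> 1) 0.
  rewrite (convE kE)//; last exact: intg_cst.
  apply: eq_bigr => -[[|j] jn] _ /=; rewrite /tpterm.
    by rewrite !mul0r.
  by rewrite cc// cs// !mulr0 !mul0r.
transitivity (c * conv k (fun=> 1) x).
  rewrite -itgZ; last exact: (intgMc L0 (intg_cst L 1) (@bumpkerB_continuous k x)).
  by apply: eq_itg => z _; rewrite mul1r.
rewrite h1 -[RHS]mulr1; congr (_ * _).
rewrite /conv (_ : (fun z => _) = fun z => cosbump z ^+ k / bumpmass k); last first.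
  by apply/funext => z; rewrite mul1r sub0r bumpkerN.
rewrite itgZr; last by apply: intg_continuous; exact: bumpX_continuous.
by rewrite mulfV// gt_eqF// bumpmass_gt0.
Qed.

Lemma intg_conv_arg k h x : intg h -> intg (fun z => h z * bumpker k (x - z)).
Proof. by move=> ih; apply: intgMc => //; exact: bumpkerB_continuous. Qed.

Lemma convD k f g : intg f -> intg g ->
  conv k (fun x => f x + g x) =1 (fun x => conv k f x + conv k g x).
Proof.
move=> fi gi x; rewrite /conv -itgD; try exact: intg_conv_arg.
by apply: eq_itg => z _; rewrite mulrDl.
Qed.

Lemma convZ k c f : intg f -> conv k (fun x => c * f x) =1 (fun x => c * conv k f x).
Proof.
move=> fi x; rewrite /conv -itgZ; last exact: intg_conv_arg.
by apply: eq_itg => z _; rewrite mulrA.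
Qed.

Lemma conv_le k f g x : intg f -> intg g ->
  (forall z, z \in `[0, L] -> f z <= g z) -> conv k f x <= conv k g x.
Proof.
move=> fi gi fg; apply: itg_le; try exact: intg_conv_arg.
by move=> z zL; rewrite ler_wpM2r ?bumpker_ge0// fg.
Qed.

(** The variance of [h] under the probability density [bumpker k (x - z)] is nonnegative. *)
Lemma conv_jensen k h x : intg h -> intg (fun z => h z ^+ 2) ->
  conv k h x ^+ 2 <= conv k (fun z => h z ^+ 2) x.
Proof.
move=> ih ih2; set m := conv k h x.
have : 0 <= conv k (fun z => h z ^+ 2 + ((- (2 * m)) * h z + m ^+ 2)) x.
  apply: itg_ge0 => z _; rewrite mulr_ge0 ?bumpker_ge0//.
  rewrite (_ : _ + _ = (h z - m) ^+ 2) ?sqr_ge0//; ring.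
rewrite convD//; last by apply: intgD; [exact: intgZ|exact: intg_cst].
rewrite convD; [|exact: intgZ|exact: intg_cst].
rewrite convZ// conv_cst -/m => H; rewrite -subr_ge0; apply: le_trans H _.
by rewrite le_eqVlt; apply/orP; left; apply/eqP; ring.
Qed.

(** Proximity on the circle is measured by [cosbump (x - z)]: near its maximum the oscillation of
    [h] is small, elsewhere the kernel is. The evaluation points are kept in a separate set [S] so
    that the lemma serves both for uniform convergence on [0, L] and for convergence at a single
    point. *)
Lemma conv_approx h (C : R) (S : set R) :
  measurable_fun `[0, L] h ->
  (forall x, x \in `[0, L] -> `|h x| <= C) -> (forall x, S x -> `|h x| <= C) ->
  (forall e : R, 0 < e -> exists2 d : R, 0 < d &
    forall x z, S x -> z \in `[0, L] -> 1 - d < cosbump (x - z) -> `|h z - h x| <= e) ->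
  forall e : R, 0 < e -> exists K : nat, forall k, (K <= k)%N -> forall x, S x ->
    `|conv k h x - h x| <= e.
Proof.
move=> mh hC hCS mod e e0.
have e2 : 0 < e / 2 by rewrite divr_gt0.
have [d d0 Hd] := mod _ e2.
have C0 : 0 <= C.
  by rewrite (le_trans _ (hC 0 _))// in_itv/= lexx ltW.
have ih : intg h := intg_bounded L0 mh hC.
(* Away from x the oscillation is at most 2 C, so this bound on the kernel makes the integrand at
   most e / 2 / L; the added 1 keeps the denominator positive when C = 0. *)
have e4 : 0 < e / 2 / ((2 * C + 1) * L).
  by rewrite divr_gt0// mulr_gt0// ltr_wpDl// mulr_ge0.
have [K HK] := bumpker_small d0 e4.
exists K => k /HK {}HK x Sx.
have ihx : intg (fun z => h z - h x) by apply: intgB => //; exact: intg_cst.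
have -> : conv k h x - h x = conv k (fun z => h z - h x) x.
  transitivity (conv k h x - conv k (fun=> h x) x); first by rewrite conv_cst.
  rewrite /conv -itgB; [|exact: intg_conv_arg|].
    by apply: eq_itg => z _; rewrite mulrBl.
  exact: (@intg_conv_arg k (fun=> h x) x (intg_cst L _)).
apply: le_trans (itg_norm (intg_conv_arg k x ihx)) _.
have -> : e = itg (fun z => e / 2 * bumpker k (x - z) + e / 2 / L).
  rewrite itgD; [|by apply: intgZ; apply: intg_continuous; exact: bumpkerB_continuous
    |exact: intg_cst].
  rewrite itg_cst// divfK ?gt_eqF//.
  by rewrite [X in X + _](conv_cst k (e / 2) x) -splitr.
apply: itg_le.
- by apply: intg_norm; exact: intg_conv_arg.
- apply: intgD; last exact: intg_cst.
  by apply: intgZ; apply: intg_continuous; exact: bumpkerB_continuous.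
- move=> z zL; rewrite normrM (ger0_norm (bumpker_ge0 _ _)).
  have [hx|hx] := ltP (1 - d) (cosbump (x - z)).
    rewrite -[leLHS]addr0 lerD//; last by rewrite divr_ge0// ltW.
    by rewrite ler_wpM2r ?bumpker_ge0//; exact: Hd.
  rewrite -[leLHS]add0r lerD//; first by rewrite mulr_ge0 ?bumpker_ge0// ltW.
  apply: (@le_trans _ _ (2 * C * (e / 2 / ((2 * C + 1) * L)))).
    apply: ler_pM; rewrite ?bumpker_ge0//; last exact: HK.
    by have := hC _ zL; have := hCS _ Sx; have := ler_normB (h z) (h x); lra.
  rewrite mulrC invfM (mulrC (2 * C + 1)^-1) mulrA -!mulrA ler_wpM2l//; first exact: ltW.
  rewrite mulrA ler_piMr//; first by rewrite mulr_ge0// invr_ge0// ltW.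
  by rewrite mulrC ler_pdivrMr ?mul1r ?lerDl// ltr_wpDl// mulr_ge0.
Qed.

Lemma cos_le_pi (x y : R) : 0 <= x -> x <= y -> y <= pi -> cos y <= cos x.
Proof.
move=> x0; rewrite le_eqVlt => /predU1P[->//|xy] ypi.
have x0p : x \in `[0, pi] by rewrite in_itv/= x0/= (le_trans (ltW xy)).
have y0p : y \in `[0, pi] by rewrite in_itv/= ypi (le_trans x0)// ltW.
by rewrite ltW// ltr_cos.
Qed.

(** The reflection t -> L - t reduces to the half period on which the cosine decreases. *)
Lemma cosbump_le (r t : R) : 0 <= r -> r <= t -> t <= L - r -> cosbump t <= cosbump r.
Proof.
move=> r0 rt tL.
have w0 := freq_gt0 L0.
rewrite ler_pM2r ?invr_gt0// lerD2l.
have wr0 : 0 <= freq * r by rewrite mulr_ge0// ltW.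
have [tp|tp] := leP (freq * t) pi.
  by apply: cos_le_pi => //; rewrite ler_pM2l.
have -> : cos (freq * t) = cos (freq * (L - t)).
  rewrite -[LHS]cosN -[LHS]cosD2pi; congr cos.
  by rewrite mulrBr freqL// -(mulr_natl pi 2) addrC.
apply: cos_le_pi => //.
- by rewrite ler_pM2l// lerBrDr addrC -lerBrDr.
- rewrite mulrBr freqL//; lra.
Qed.

Lemma cosbump_lt1 (r : R) : 0 < r -> 2 * r <= L -> cosbump r < 1.
Proof.
move=> r0 rL; have w0 := freq_gt0 L0.
rewrite ltr_pdivrMr// mul1r.
suff : cos (freq * r) < cos 0 by rewrite cos0; lra.
have pi0 := pi_gt0 R.
have wr : freq * r <= pi.
  have : freq * (2 * r) <= freq * L by rewrite ler_pM2l.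
  rewrite freqL// => ?; lra.
rewrite ltr_cos; first by rewrite mulr_gt0.
- by rewrite in_itv/= lexx ltW.
- by rewrite in_itv/= wr mulr_ge0// ltW.
Qed.

Lemma cosbump_norm x : cosbump `|x| = cosbump x.
Proof. by case: (ger0P x) => // _; rewrite cosbumpN. Qed.

(** For |x| <= L the two alternatives mean that x is within r of 0 on the circle, directly or around
    the end point. *)
Lemma cosbump_modulus (r : R) : 0 < r -> exists2 d : R, 0 < d &
  forall x, 1 - d < cosbump x -> `|x| < r \/ L - r < `|x|.
Proof.
move=> r0.
have [Lr|rL] := ltP L (2 * r).
  exists 1 => // x _; have [?|rx] := ltP `|x| r; first by left.
  by right; apply: lt_le_trans rx; lra.
exists (1 - cosbump r); first by rewrite subr_gt0 cosbump_lt1.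
move=> x; rewrite subKr => H.
have [?|rx] := ltP `|x| r; first by left.
have [?|xL] := ltP (L - r) `|x|; first by right.
by move: H; rewrite -(cosbump_norm x) ltNge (cosbump_le (ltW r0) rx xL).
Qed.

Lemma itv0L_normB x z : x \in `[0, L] -> z \in `[0, L] -> `|x - z| <= L.
Proof.
rewrite !in_itv/= => /andP[x0 xL] /andP[z0 zL].
rewrite ler_norml; apply/andP; split; lra.
Qed.

(** Lipschitz functions on the circle, described by their values on [0, L] only, because it is
    applied to primitives, which need not be periodic outside that interval. *)
Definition lipschitz_per (C : R) h := h 0 = h L /\
  forall x z, x \in `[0, L] -> z \in `[0, L] -> `|h x - h z| <= C * `|x - z|.

Lemma lipschitz_per_bounded C h : 0 <= C -> lipschitz_per C h ->
  forall x, x \in `[0, L] -> `|h x| <= `|h 0| + C * L.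
Proof.
move=> C0 [_ hl] x xL.
have z0 : 0 \in `[0, L] by rewrite in_itv/= lexx ltW.
rewrite -[h x](subrK (h 0)) addrC (le_trans (ler_normD _ _))// lerD2l.
by rewrite (le_trans (hl _ _ xL z0))// ler_wpM2l// itv0L_normB.
Qed.

(** The path from x to z through the identified end points 0 and L has length L - |x - z|. *)
Lemma lipschitz_per_circle C h x z : 0 <= C -> lipschitz_per C h -> x \in `[0, L] -> z \in `[0, L] ->
  `|h x - h z| <= C * (L - `|x - z|).
Proof.
move=> C0 [h0L hl].
have z0 : 0 \in `[0, L] by rewrite in_itv/= lexx ltW.
have zL : L \in `[0, L] by rewrite in_itv/= lexx ltW.
wlog xz : x z / x <= z => [H|] xI zI.
  have [|/ltW] := leP x z; first by move=> /H; exact.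
  by rewrite distrC (distrC x) => /H; exact.
have := xI; have := zI; rewrite !in_itv/= => /andP[z0' z1] /andP[x0 x1].
rewrite -[h x](subrK (h 0)) -addrA {2}h0L (le_trans (ler_normD _ _))//.
apply: (le_trans (lerD (hl _ _ xI z0) (hl _ _ zL zI))).
rewrite -mulrDr ler_wpM2l// subr0 (ger0_norm x0) (distrC x z).
by rewrite (@ger0_norm _ (L - z)) ?(@ger0_norm _ (z - x)) ?subr_ge0//; lra.
Qed.

Lemma lipschitz_per_modulus C h : 0 <= C -> lipschitz_per C h -> forall e : R, 0 < e ->
  exists2 d : R, 0 < d &
    forall x z, x \in `[0, L] -> z \in `[0, L] -> 1 - d < cosbump (x - z) ->
      `|h z - h x| <= e.
Proof.
move=> C0 hl e e0.
have r0 : 0 < e / (C + 1) by rewrite divr_gt0// ltr_wpDl.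
have [d d0 Hd] := cosbump_modulus r0.
have Ce : C * (e / (C + 1)) <= e.
  by rewrite mulrA ler_pdivrMr ?ltr_wpDl// mulrC ler_wpM2l ?lerDl// ltW.
exists d => // x z xI zI /Hd[H|H]; rewrite distrC.
- apply: (le_trans (hl.2 _ _ xI zI)); apply: le_trans Ce.
  by rewrite ler_wpM2l// ltW.
- apply: (le_trans (lipschitz_per_circle C0 hl xI zI)); apply: le_trans Ce.
  by rewrite ler_wpM2l//; lra.
Qed.

Lemma conv_lipschitz_per C h : 0 <= C -> lipschitz_per C h -> measurable_fun `[0, L] h ->
  forall e : R, 0 < e -> exists K : nat, forall k, (K <= k)%N ->
    forall x, x \in `[0, L] -> `|conv k h x - h x| <= e.
Proof.
move=> C0 hl mh.
apply: (@conv_approx h (`|h 0| + C * L) [set` `[0, L]]) => //.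
- exact: lipschitz_per_bounded.
- exact: lipschitz_per_bounded.
- exact: lipschitz_per_modulus hl.
Qed.

Lemma deriv1_lipschitz_per f g : deriv1 f g -> continuous g -> f 0 = f L ->
  exists2 C : R, 0 <= C & lipschitz_per C f.
Proof.
move=> fg cg f0; have [C gC] := cont_bounded L0 cg.
have C0 : 0 <= C.
  by rewrite (le_trans _ (gC 0 _))// in_itv/= lexx ltW.
exists C => //; split => // x z.
wlog xz : x z / z < x => [H xI zI|].
  have [/H|/H|->] := ltgtP z x; [exact| |by rewrite !subrr normr0 mulr0].
  by rewrite distrC (distrC x); exact.
rewrite !in_itv/= => /andP[x0 x1] /andP[z0 z1].
have [c] := MVT xz (fun y _ => fg y) (continuous_subspaceT (deriv1_continuous fg)).
rewrite in_itv/= => /andP[zc cx] ->.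
rewrite normrM ler_wpM2r// gC// in_itv/=; apply/andP; split; lra.
Qed.

End Kernel.

(** * Wirtinger's inequality and the heat flow *)

Section LogSobolev.
Context {R : realType}.
Variable L : R.
Hypothesis L0 : 0 < L.
Implicit Types (f g h : R -> R) (a b : nat -> R).
Local Notation intg := (intg L).
Local Notation itg := (itg L).
Local Notation freq := (freq L).
Local Notation tp := (tp L).
Local Notation conv := (conv L).

(** The restriction to e <= 1 lets an error e^2 be absorbed into e. *)
Lemma le_of_approx (x y c : R) : 0 <= c -> (forall e, 0 < e -> e <= 1 -> x <= y + e * c) -> x <= y.
Proof.
move=> c0 H; rewrite leNgt; apply/negP => yx.
have d0 : 0 < (x - y) / (2 * (c + 1)) by rewrite divr_gt0 ?subr_gt0// mulr_gt0// ltr_wpDl.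
have e0 : 0 < Num.min 1 ((x - y) / (2 * (c + 1))) by rewrite lt_min ltr01.
have := H _ e0; rewrite ge_min lexx => /(_ isT); apply/negP; rewrite -ltNge.
apply: (@le_lt_trans _ _ (y + (x - y) / (2 * (c + 1)) * c)).
  by rewrite lerD2l ler_wpM2r// ge_min lexx orbT.
rewrite -ltrBrDl mulrAC ltr_pdivrMr ?mulr_gt0 ?ltr_wpDl//.
by rewrite ltr_pM2l ?subr_gt0//; lra.
Qed.

Lemma itg_conv k f : intg f -> itg (conv k f) = itg f.
Proof.
move=> fi; transitivity (itg (fun x => 1 * conv k f x)).
  by apply: eq_itg => x _; rewrite mul1r.
rewrite conv_selfadjoint//; last exact: intg_cst.
by apply: eq_itg => x _; rewrite conv_cst// mulr1.
Qed.

Lemma coscoef_deriv1 f g j : deriv1 f g -> continuous g -> f 0 = f L ->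
  coscoef L g j = j%:R * freq * sincoef L f j.
Proof.
move=> fg cg f0.
have cf := deriv1_continuous fg.
rewrite /coscoef /sincoef -itgZ; last by apply: intg_mul_sinl => //; exact: intg_continuous.
apply/eqP; rewrite -subr_eq0 -itgB; first last.
- by apply: intgZ; apply: intg_mul_sinl => //; exact: intg_continuous.
- by apply: intg_mul_cosl => //; exact: intg_continuous.
apply/eqP/(itg_periodic0 L0 (f := fun x => f x * cos (j%:R * freq * x))).
- apply: deriv1_eq; first by apply: deriv1M; [exact: fg|exact: deriv1_cosl].
  by move=> x; ring.
- have c1 := deriv1_continuous (@deriv1_cosl R (j%:R * freq)).
  have c2 := deriv1_continuous (@deriv1_sinl R (j%:R * freq)).
  by apply: contB; [exact: contM|apply: contZ; exact: contM].
- by have := @cos_freq_period _ L L0 j 0; rewrite add0r f0 => ->.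
Qed.

Lemma sincoef_deriv1 f g j : deriv1 f g -> continuous g -> f 0 = f L ->
  sincoef L g j = - (j%:R * freq * coscoef L f j).
Proof.
move=> fg cg f0.
have cf := deriv1_continuous fg.
rewrite /coscoef /sincoef -itgZ; last by apply: intg_mul_cosl => //; exact: intg_continuous.
apply/eqP; rewrite -subr_eq0 opprK -itgD; first last.
- by apply: intgZ; apply: intg_mul_cosl => //; exact: intg_continuous.
- by apply: intg_mul_sinl => //; exact: intg_continuous.
apply/eqP/(itg_periodic0 L0 (f := fun x => f x * sin (j%:R * freq * x))).
- apply: deriv1_eq; first by apply: deriv1M; [exact: fg|exact: deriv1_sinl].
  by move=> x; ring.
- have c1 := deriv1_continuous (@deriv1_cosl R (j%:R * freq)).
  have c2 := deriv1_continuous (@deriv1_sinl R (j%:R * freq)).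
  by apply: contD; [exact: contM|apply: contZ; exact: contM].
- by have := @sin_freq_period _ L L0 j 0; rewrite add0r f0 => ->.
Qed.

(** Convolution multiplies Fourier coefficients and so does differentiation, hence they commute. *)
Lemma deriv1_conv k f g : deriv1 f g -> continuous g -> f 0 = f L ->
  deriv1 (conv k f) (conv k g).
Proof.
move=> fg cg f0; have [n [b E]] := conv_tp L0 k.
rewrite !E; [|exact: intg_continuous|by apply: intg_continuous; exact: deriv1_continuous fg].
apply: deriv1_eq; first exact: deriv1_tp.
move=> x; apply: eq_bigr => j _; rewrite /dcos /dsin.
by rewrite (coscoef_deriv1 j fg)// (sincoef_deriv1 j fg)//; congr (tpterm _ _ _ _ _); ring.
Qed.

(** The inequality for polynomials is applied to [conv k f], which still has mean zero. Jensen's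
    inequality and conservation of the integral bound the right-hand side by that of [f]; the
    left-hand side converges uniformly. *)
Lemma wirtinger f g : deriv1 f g -> continuous g -> f 0 = f L -> itg f = 0 ->
  freq ^+ 2 * itg (fun x => f x ^+ 2) <= itg (fun x => g x ^+ 2).
Proof.
move=> fg cg f0 m0.
have cf := deriv1_continuous fg.
have fi : intg f by exact: intg_continuous.
have gi : intg g by exact: intg_continuous.
have f2i : intg (fun x => f x ^+ 2) by apply: intg_continuous; exact: contX.
have g2i : intg (fun x => g x ^+ 2) by apply: intg_continuous; exact: contX.
have [C C0 lf] := deriv1_lipschitz_per L0 fg cg f0.
have [B fB] := cont_bounded L0 cf.
have B0 : 0 <= B by rewrite (le_trans _ (fB 0 _))// in_itv/= lexx ltW.
have H k : freq ^+ 2 * itg (fun x => conv k f x ^+ 2) <= itg (fun x => g x ^+ 2).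
  apply: (@le_trans _ _ (itg (fun x => conv k g x ^+ 2))).
    have [n [b E]] := conv_tp L0 k.
    have dE := deriv1E (deriv1_conv k fg cg f0).
    have dE' := deriv1E (deriv1_tp L n (fun j => b j * coscoef L f j) (fun j => b j * sincoef L f j)).
    rewrite -E// in dE'; rewrite dE in dE'; rewrite dE' E//.
    by apply: tp_wirtinger => //; rewrite -E// itg_conv.
  rewrite -(itg_conv k g2i); apply: itg_le.
  - by apply: intg_continuous; apply: contX; exact: conv_continuous.
  - by apply: intg_continuous; exact: conv_continuous.
  - by move=> x _; exact: conv_jensen.
apply: (@le_of_approx _ _ (freq ^+ 2 * ((2 * B + 1) * L))).
  by rewrite mulr_ge0 ?sqr_ge0// mulr_ge0 ?ltW// ltr_wpDl// mulr_ge0.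
move=> e e0 e1.
have [K HK] := conv_lipschitz_per L0 C0 lf (intg_meas fi) e0.
apply: le_trans (lerD (H K) (lexx _)); rewrite mulrCA -mulrDr ler_wpM2l ?sqr_ge0//.
rewrite (mulrA e) -(itg_cst L0) -itgD; [|by apply: intg_continuous; apply: contX; exact: conv_continuous|exact: intg_cst].
apply: itg_le => //.
  by apply: intgD; [apply: intg_continuous; apply: contX; exact: conv_continuous|exact: intg_cst].
move=> x xL; have := HK K (leqnn _) x xL; have := fB x xL.
move: (conv K f x) (f x) => p q; rewrite !ler_norml => /andP[q1 q2] /andP[p1 p2].
by rewrite -subr_ge0; nra.
Qed.

(* With v = e^(y/2):
   4 v_xx^2 = e^y y_xx^2 + (e^y y_x^3)_x / 3 - e^y y_x^4 / 12. *)
Lemma fisher_dissipation y y1 y2 : deriv1 y y1 -> deriv1 y1 y2 -> continuous y2 ->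
  y 0 = y L -> y1 0 = y1 L ->
  freq ^+ 2 * itg (fun x => expR (y x) * y1 x ^+ 2) <=
  itg (fun x => expR (y x) * y2 x ^+ 2).
Proof.
move=> d1 d2 c2 p0 p1.
have c1 := deriv1_continuous d2; have c0 := deriv1_continuous d1.
have ce := cont_expR c0.
pose E x := expR (2^-1 * y x).
have dE : deriv1 E (fun x => E x * (2^-1 * y1 x)) by apply: deriv1_expR; exact: deriv1Z.
have cE := deriv1_continuous dE.
have E2 x : E x ^+ 2 = expR (y x).
  by rewrite /E -expRM_natl mulrA mulfV// mul1r.
pose v1 x := E x * (2^-1 * y1 x).
pose v2 x := E x * (2^-1 * y2 x + 4^-1 * y1 x ^+ 2).
have dv : deriv1 v1 v2.
  apply: deriv1_eq; first by apply: deriv1M; [exact: dE|exact: (deriv1Z _ d2)].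
  by move=> x; rewrite /v2; field.
have cv2 : continuous v2.
  by apply: contM => //; apply: contD; apply: contZ => //; exact: contX.
have E0L : E 0 = E L by rewrite /E p0.
have := wirtinger dv cv2; rewrite {1 2}/v1 E0L p1 => /(_ erefl).
have -> : itg v1 = 0.
  apply: (itg_periodic0 L0 dE); first exact: (deriv1_continuous dv).
  by rewrite E0L.
move=> /(_ erefl) W.
have -> : itg (fun x => expR (y x) * y1 x ^+ 2) = 4 * itg (fun x => v1 x ^+ 2).
  rewrite -itgZ; last by apply: intg_continuous; apply: contX; exact: deriv1_continuous dv.
  by apply: eq_itg => x _; rewrite -E2 /v1; field.
apply: (@le_trans _ _ (4 * itg (fun x => v2 x ^+ 2))).
  by rewrite mulrCA ler_wpM2l.
have cQ : continuous (fun x => expR (y x) * y1 x * y1 x ^+ 3 + expR (y x) * (3 * y1 x ^+ 2 * y2 x)).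
  apply: contD; first by apply: contM; [exact: contM|exact: contX].
  by apply: contM => //; apply: contM => //; apply: contZ; exact: contX.
have Q0 : itg (fun x => expR (y x) * y1 x * y1 x ^+ 3 + expR (y x) * (3 * y1 x ^+ 2 * y2 x)) = 0.
  apply: (itg_periodic0 L0 (f := fun x => expR (y x) * y1 x ^+ 3)) => //.
    apply: deriv1_eq; first by apply: deriv1M; [exact: (deriv1_expR d1)|exact: (deriv1X 3 d2)].
    by [].
  by rewrite p0 p1.
rewrite -itgZ; last by apply: intg_continuous; apply: contX.
rewrite -[leRHS]addr0 -(mulr0 3^-1) -Q0 -itgZ; last exact: intg_continuous.
rewrite -itgD; [|by apply: intg_continuous; apply: contM => //; exact: contX|by apply: intgZ; exact: intg_continuous].
apply: itg_le.
- by apply: intgZ; apply: intg_continuous; exact: contX.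
- by apply: intgD; [apply: intg_continuous; apply: contM => //; exact: contX|
    apply: intgZ; exact: intg_continuous].
- move=> x _; rewrite -subr_ge0.
  rewrite (_ : _ - _ = 12^-1 * (expR (y x) * y1 x ^+ 4)); last first.
    by rewrite /v2 -E2; field.
  have y4 : 0 <= y1 x ^+ 4 by have := sqr_ge0 (y1 x ^+ 2); rewrite -exprM.
  by apply: mulr_ge0; [rewrite invr_ge0 ler0n|rewrite mulr_ge0// expR_ge0].
Qed.

Lemma leibniz (F dF : R -> R -> R) (p q C t : R) : p < t < q ->
  (forall s, p < s < q -> intg (F s)) ->
  (forall s x, p < s < q -> is_derive s 1 (F ^~ x) (dF s x)) ->
  (forall s x, p < s < q -> `|dF s x| <= C) ->
  is_derive t 1 (fun s => itg (F s)) (itg (dF t)).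
Proof.
move=> pq iF dFs bF.
have It : `]p, q[%classic t by rewrite /= in_itv/=.
have mI : measurable (`[0, L]%classic : set R) by exact: measurable_itv.
have hI s : `]p, q[%classic s -> lebesgue_measure.-integrable `[0, L] (EFin \o F s).
  by rewrite /= in_itv/= => /iF.
have hd s x : `]p, q[%classic s -> `[0, L]%classic x -> derivable (F^~ x) s 1.
  by rewrite /= in_itv/= => /(dFs _ x) ? _; exact: ex_derive.
have dE s x : p < s < q -> partial1of2 F s x = dF s x.
  by move=> /(dFs _ x) ?; rewrite partial1of2E derive_val.
have C0 : 0 <= C by rewrite (le_trans _ (bF t 0 pq)).
have hG s x : `]p, q[%classic s -> `[0, L]%classic x -> `|partial1of2 F s x| <= C.
  by rewrite /= in_itv/= => sI _; rewrite dE//; exact: bF.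
have iC : lebesgue_measure.-integrable `[0, L] (EFin \o (fun=> C)) by exact: intg_cst.
have D1 := @derivable_under_integral R _ _ (@lebesgue_measure R) F _ mI t p q It hI hd _ (fun=> C0) iC hG.
have D2 := @differentiation_under_integral R _ _ (@lebesgue_measure R) F _ mI t p q It hI hd _ (fun=> C0) iC hG.
apply: DeriveDef; first exact: D1.
rewrite -derive1E; apply: (etrans D2); apply: eq_itg => x _; exact: dE.
Qed.

Lemma le_of_deriv_le0 (f g : R -> R) (p q : R) : p <= q ->
  (forall s, p <= s <= q -> is_derive s 1 f (g s)) ->
  (forall s, p <= s <= q -> g s <= 0) -> f q <= f p.
Proof.
rewrite le_eqVlt => /predU1P[-> //|pq] df g0.
have cf : {within `[p, q], continuous f}.
  apply/continuous_within_itvP => //; split => [x|//|//].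
  - rewrite in_itv/= => /andP[px xq].
    have := df x; rewrite !ltW// => /(_ isT) ?.
    by apply: differentiable_continuous; apply/derivable1_diffP; exact: ex_derive.
  - apply: cvg_at_right_filter; have := df p; rewrite lexx ltW// => /(_ isT) ?.
    by apply: differentiable_continuous; apply/derivable1_diffP; exact: ex_derive.
  - apply: cvg_at_left_filter; have := df q; rewrite lexx ltW// => /(_ isT) ?.
    by apply: differentiable_continuous; apply/derivable1_diffP; exact: ex_derive.
have dpq x : x \in `]p, q[ -> is_derive x 1 f (g x).
  by rewrite in_itv/= => /andP[px xq]; apply: df; rewrite !ltW.
have [c] := MVT pq dpq cf.
rewrite in_itv/= => /andP[pc cq] E.
rewrite -subr_le0 E mulr_le0_ge0 ?subr_ge0 ?(ltW pq)// g0// !ltW//.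
Qed.

Lemma periodicz f : periodic f L -> forall (z : int) x, f (x + z%:~R * L) = f x.
Proof.
move=> pf [n|n] x; first by rewrite -pmulrn mulr_natl periodicn.
by rewrite NegzE mulrNz mulNr -[in RHS](subrK (n.+1%:R * L) x) mulr_natl periodicn.
Qed.

Definition fundom (x : R) : R := x - (Num.floor (x / L))%:~R * L.

Lemma fundom_itv x : fundom x \in `[0, L[.
Proof.
have := floor_itv (x / L); rewrite ler_pdivlMr// ltr_pdivrMr// => /andP[h1 h2].
rewrite in_itv/= subr_ge0 h1/= ltrBlDl; move: h2; rewrite intrD mulrDl mul1r.
by [].
Qed.

Lemma fundomE f : periodic f L -> forall x, f (fundom x) = f x.
Proof.
move=> pf x; have := periodicz pf (- Num.floor (x / L)) x.
by rewrite mulrNz mulNr.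
Qed.

Lemma fundom_id x : x \in `[0, L[ -> fundom x = x.
Proof.
rewrite in_itv/= => /andP[x0 xL]; rewrite /fundom (_ : Num.floor _ = 0) ?mul0r ?subr0//.
apply: floor_def; rewrite add0r mulr0z mulr1z divr_ge0 ?(ltW L0)//=.
by rewrite ltr_pdivrMr// mul1r.
Qed.

Lemma fundom_periodic : periodic fundom L.
Proof.
move=> x; rewrite /fundom mulrDl divff ?gt_eqF//.
rewrite floorDrz ?rpred1// floor1 intrD mulrDl mul1r; ring.
Qed.

(** Modewise solution of u_t = u_xx. As the sums are finite, it also makes sense for negative
    times. *)
Definition hcoef (t : R) a (j : nat) : R := a j * expR (- ((j%:R * freq) ^+ 2 * t)).

Definition heat n a b (t x : R) : R := tp n (hcoef t a) (hcoef t b) x.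

Lemma heat0 n a b x : heat n a b 0 x = tp n a b x.
Proof.
by apply: eq_bigr => j _; rewrite /tpterm /hcoef mulr0 oppr0 expR0 !mulr1.
Qed.

Lemma heat_period n a b t x : heat n a b t (x + L) = heat n a b t x.
Proof. exact: tp_period. Qed.

Lemma heat_0L n a b t : heat n a b t 0 = heat n a b t L.
Proof. by rewrite /heat tp_0L. Qed.

Lemma deriv1_heat_x n a b t :
  deriv1 (heat n a b t) (heat n (dcos L a b) (dsin L a b) t).
Proof.
apply: deriv1_eq; first exact: deriv1_tp.
by move=> x; apply: eq_bigr => j _; congr (tpterm _ _ _ _ _); rewrite /dcos /dsin /hcoef; ring.
Qed.

Lemma deriv1_heat_t n a b x :
  deriv1 (fun t => heat n a b t x) (fun t => heat n (lapl L a) (lapl L b) t x).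
Proof.
have dh (c : R) (j : nat) : deriv1 (fun t => c * expR (- ((j%:R * freq) ^+ 2 * t)))
    (fun t => - ((j%:R * freq) ^+ 2 * c) * expR (- ((j%:R * freq) ^+ 2 * t))).
  apply: deriv1_eq; first by apply: deriv1Z; apply: deriv1_expR; apply: deriv1N; exact: deriv1_linear.
  by move=> t; ring.
apply: (@deriv1_sum _ n (fun j t => tpterm L (hcoef t a j) (hcoef t b j) j x)
  (fun j t => tpterm L (hcoef t (lapl L a) j) (hcoef t (lapl L b) j) j x)) => j.
apply: deriv1_eq.
  by apply: deriv1D; apply: deriv1M; try exact: deriv1_cst; exact: dh.
by move=> t; rewrite /tpterm /hcoef /lapl; ring.
Qed.

Lemma lapl_dcos a b : dcos L (lapl L a) (lapl L b) = lapl L (dcos L a b).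
Proof. by apply/funext => j; rewrite /dcos /lapl; ring. Qed.

Lemma lapl_dsin a b : dsin L (lapl L a) (lapl L b) = lapl L (dsin L a b).
Proof. by apply/funext => j; rewrite /dsin /lapl; ring. Qed.

Lemma deriv1_heat_xx n a b t : deriv1 (heat n (dcos L a b) (dsin L a b) t)
  (heat n (lapl L a) (lapl L b) t).
Proof.
apply: deriv1_eq; first exact: deriv1_heat_x.
by move=> x; apply: eq_bigr => j _; congr (tpterm _ _ _ _ _);
  rewrite /hcoef /dcos /dsin /lapl; ring.
Qed.

Lemma heat_continuous n a b t : continuous (heat n a b t).
Proof. exact: tp_continuous. Qed.

(** Dominates the flow for all t >= -1. Negative times are included because derivatives in time are
    also taken at t = 0, from both sides. *)
Definition coefbound n a b : R :=
  \sum_(j < n) (`|a j| + `|b j|) * expR ((j%:R * freq) ^+ 2).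

Lemma coefbound_ge0 n a b : 0 <= coefbound n a b.
Proof. by apply: sumr_ge0 => j _; rewrite mulr_ge0 ?addr_ge0 ?expR_ge0. Qed.

Lemma heat_bound n a b t x : -1 <= t -> `|heat n a b t x| <= coefbound n a b.
Proof.
move=> t1; apply: (le_trans (tp_bound _ _ _ _ _)); apply: ler_sum => j _.
rewrite /hcoef !normrM -mulrDl (ger0_norm (expR_ge0 _)).
rewrite ler_wpM2l ?addr_ge0// ler_expR -mulrN -[leRHS]mulr1 ler_wpM2l ?sqr_ge0//.
by rewrite lerNl.
Qed.

Lemma heat_pos n a b (c : R) : (forall x, c <= tp n a b x) ->
  forall t x, 0 <= t -> c <= heat n a b t x.
Proof.
move=> hc t x t0; rewrite leNgt; apply/negP => uc.
pose u := heat n a b; pose B := coefbound n a b.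
pose u2 := heat n (lapl L a) (lapl L b); pose B2 := coefbound n (lapl L a) (lapl L b).
have B0 : 0 <= B := coefbound_ge0 _ _ _.
have B20 : 0 <= B2 := coefbound_ge0 _ _ _.
(* The integral of e^(-K u) decreases along the flow for every K > 0; a value
   of u below c on an interval contradicts this for large K. *)
have decay (K : R) : 0 < K -> itg (fun x => expR (- K * u t x)) <= expR (- K * c) * L.
  move=> K0; apply: (@le_trans _ _ (itg (fun x => expR (- K * u 0 x)))); last first.
    rewrite -itg_cst//; apply: itg_le.
    - by apply: intg_continuous; apply: cont_expR; apply: contZ; exact: heat_continuous.
    - exact: intg_cst.
    - move=> z _; rewrite ler_expR !mulNr lerN2 ler_wpM2l ?(ltW K0)//.
      by rewrite /u heat0.
  apply: (@le_of_deriv_le0 (fun s => itg (fun x => expR (- K * u s x)))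
    (fun s => itg (fun x => expR (- K * u s x) * (- K * u2 s x))) 0 t t0) => s /andP[s0 st].
    apply: (@leibniz _ (fun s x => expR (- K * u s x) * (- K * u2 s x)) (-1) (t + 1)
      (expR (K * B) * (K * B2))).
    - by apply/andP; split; lra.
    - by move=> r _; apply: intg_continuous; apply: cont_expR; apply: contZ; exact: heat_continuous.
    - move=> r z _; have : deriv1 (fun s => expR (- K * u s z)) (fun s => expR (- K * u s z) * (- K * u2 s z)).
        by apply: deriv1_expR; apply: deriv1Z; exact: deriv1_heat_t.
      exact.
    - move=> r z /andP[r1 _]; rewrite normrM (ger0_norm (expR_ge0 _)).
      have Br : `|u r z| <= B by apply: heat_bound; exact: ltW.
      have B2r : `|u2 r z| <= B2 by apply: heat_bound; exact: ltW.
      apply: ler_pM; rewrite ?expR_ge0//.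
        rewrite ler_expR mulNr -mulrN ler_wpM2l ?(ltW K0)//.
        by rewrite (le_trans _ Br)// -normrN ler_norm.
      by rewrite normrM normrN (gtr0_norm K0) ler_wpM2l// ltW.
  pose u1 := heat n (dcos L a b) (dsin L a b).
  have cE r : continuous (fun x => expR (- K * u r x)).
    by apply: cont_expR; apply: contZ; exact: heat_continuous.
  have cu2 r : continuous (u2 r) by exact: heat_continuous.
  have cu1 r : continuous (u1 r) by exact: heat_continuous.
  (* Integration by parts in space turns the time derivative into minus an integral of squares. *)
  have -> : itg (fun x => expR (- K * u s x) * (- K * u2 s x)) =
      - itg (fun x => expR (- K * u s x) * (K * u1 s x) ^+ 2).
    apply/eqP; rewrite -subr_eq0 opprK -itgD; first last.
    - by apply: intg_continuous; apply: contM => //; apply: contX; exact: contZ.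
    - by apply: intg_continuous; apply: contM => //; exact: contZ.
    apply/eqP/(itg_periodic0 L0 (f := fun x => expR (- K * u s x) * (- K * u1 s x))).
    - apply: deriv1_eq.
        apply: deriv1M; last by apply: deriv1Z; exact: deriv1_heat_xx.
        by apply: deriv1_expR; apply: deriv1Z; exact: deriv1_heat_x.
      by move=> z; rewrite /u1 /u2; ring.
    - by apply: contD; apply: contM => //; [exact: contZ|apply: contX; exact: contZ].
    - by rewrite /u /u1 !heat_0L.
  by rewrite oppr_le0; apply: itg_ge0 => z _; rewrite mulr_ge0 ?expR_ge0 ?sqr_ge0.
have : u t (fundom x) < c by rewrite fundomE// => z; exact: heat_period.
have := fundom_itv x; rewrite in_itv/= => /andP[].
move: (fundom x) => z z0 zL uz.
have ct : continuous (u t) by exact: heat_continuous.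
have d0 : 0 < (c - u t z) / 2 by rewrite divr_gt0// subr_gt0.
have /cvgrPdist_lt/(_ _ d0) [r /= r0 Hr] := ct z.
pose p := Num.max 0 (z - r / 2); pose q := Num.min L (z + r / 2).
have p0 : 0 <= p by rewrite le_max lexx.
have qL : q <= L by rewrite ge_min lexx.
have r2 : 0 < r / 2 by rewrite divr_gt0.
have pq : p < q.
  by rewrite gt_max !lt_min L0/=; apply/andP; split; [|apply/andP; split]; lra.
have Hpq y : y \in `[p, q] -> u t y <= (c + u t z) / 2.
  rewrite in_itv/= ge_max le_min => /andP[/andP[_ y1] /andP[_ y2]].
  have : `|z - y| < r by rewrite ltr_norml; apply/andP; split; lra.
  by move=> /Hr; rewrite /= ltr_norml => /andP[h1 h2]; lra.
(* With this [K], on [p, q] the exponential exceeds e^(-K c) by the factor exp (L / (q - p)) > L /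
   (q - p), so its integral there already exceeds e^(-K c) L. *)
pose K := L / (q - p) / ((c - u t z) / 2).
have K0 : 0 < K by rewrite !divr_gt0 ?subr_gt0.
have := decay _ K0.
have : expR (- K * ((c + u t z) / 2)) * (q - p) <= itg (fun x => expR (- K * u t x)).
  rewrite -(itg_indic p0 (ltW pq) qL) -itgZ; last exact: intg_indic.
  apply: itg_le.
  - by apply: intgZ; exact: intg_indic.
  - by apply: intg_continuous; apply: cont_expR; exact: contZ.
  - move=> y _; rewrite indicE; case: (boolP (y \in _)) => [/set_mem/= yI|_].
      rewrite mulr1 ler_expR !mulNr lerN2 ler_wpM2l ?(ltW K0)//; exact: Hpq.
    by rewrite mulr0 expR_ge0.
move=> /le_trans/[apply]; apply/negP; rewrite -ltNge.
have qp0 : 0 < q - p by rewrite subr_gt0.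
have -> : - K * ((c + u t z) / 2) = - K * c + L / (q - p).
  rewrite /K; field; rewrite gt_eqF//= gt_eqF// subr_gt0//.
rewrite expRD -mulrA ltr_pM2l ?expR_gt0//.
rewrite -ltr_pdivrMr//; apply: lt_le_trans (expR_ge1Dx _).
by rewrite ltrDr.
Qed.

End LogSobolev.

(** * The logarithmic Sobolev inequality *)

Section LogSobolevTrig.
Context {R : realType}.
Variable L : R.
Hypothesis L0 : 0 < L.
Implicit Types (f g h : R -> R) (a b : nat -> R).
Local Notation intg := (intg L).
Local Notation itg := (itg L).
Local Notation freq := (freq L).
Local Notation tp := (tp L).
Local Notation conv := (conv L).
Local Notation heat := (heat L).
Local Notation coefbound := (coefbound L).

Lemma ln_le_sub1 (x : R) : 0 < x -> ln x <= x - 1.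
Proof.
by move=> x0; have := expR_ge1Dx (ln x); rewrite lnK ?posrE//; lra.
Qed.

(** Needed to differentiate 1 / u and ln u in time at t = 0. The time derivative is bounded by [B],
    so losing c / 2 takes at least the time c / (2 (B + 1)); d <= 1 keeps [coefbound] applicable. *)
Lemma heat_pos_near0 n a b (c : R) : 0 < c -> (forall x, c <= tp n a b x) ->
  exists2 d : R, 0 < d <= 1 & forall t x, - d <= t -> c / 2 <= heat n a b t x.
Proof.
move=> c0 hc.
pose B := coefbound n (lapl L a) (lapl L b).
have B0 : 0 <= B := coefbound_ge0 _ _ _ _.
have e0 : 0 < c / (2 * (B + 1)) by rewrite divr_gt0// mulr_gt0// ltr_wpDl.
exists (Num.min 1 (c / (2 * (B + 1)))); first by rewrite lt_min ltr01 e0/= ge_min lexx.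
move=> t x; have [t0 _|t0] := leP 0 t.
  apply: le_trans (heat_pos L0 hc x t0); lra.
rewrite lerNl le_min => /andP[t1 tB].
have [s] := MVT t0 (fun s _ => @deriv1_heat_t _ L n a b x s)
  (continuous_subspaceT (deriv1_continuous (@deriv1_heat_t _ L n a b x))).
rewrite in_itv/= => /andP[ts s0].
rewrite heat0 sub0r => E.
have : `|heat n (lapl L a) (lapl L b) s x| <= B by apply: heat_bound; lra.
rewrite ler_norml => /andP[_ hB].
have : (B + 1) * - t <= c / 2.
  rewrite mulrC -ler_pdivlMr ?ltr_wpDl//; apply: le_trans tB _.
  by rewrite invfM mulrA.
have := hc x; nra.
Qed.

(** Integrand of I - 2 freq^2 H, with [u1] in the place of the space derivative of [u]. *)
Definition entfisher u u1 (x : R) : R :=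
  u1 x ^+ 2 / u x - 2 * freq ^+ 2 * (u x * ln (u x)).

Lemma is_derive_entfisher (U V : R -> R) (l r U' V' : R) : 0 < U r ->
  is_derive r 1 U U' -> is_derive r 1 V V' ->
  is_derive r 1 (fun s => V s ^+ 2 / U s - l * (U s * ln (U s)))
    (2 * V r * V' / U r - V r ^+ 2 * U' / U r ^+ 2 - l * (U' * ln (U r) + U')).
Proof.
move=> U0 dU dV; have Un : U r != 0 by rewrite gt_eqF.
have dl : is_derive r 1 (fun s => ln (U s)) ((U r)^-1 * U').
  by apply: (@is_derive1_comp _ (@ln R) U); exact: is_derive1_ln.
apply: (@is_derive_eq _ _ _ (fun s => V s ^+ 2 / U s - l * (U s * ln (U s)))).
by rewrite /GRing.scale/=; field.
Qed.

(* Along the heat flow the Fisher information I and H = int u ln u satisfy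
   H' = - I and I' = - 2 int u (ln u)_xx^2 <= - 2 freq^2 I. *)
Lemma entfisher_decreasing n a b (c : R) : 0 < c -> (forall x, c <= tp n a b x) ->
  forall t, 0 <= t ->
  itg (entfisher (heat n a b t) (heat n (dcos L a b) (dsin L a b) t)) <=
  itg (entfisher (heat n a b 0) (heat n (dcos L a b) (dsin L a b) 0)).
Proof.
move=> c0 hc t t0.
have [d /andP[d0 d1] hd] := heat_pos_near0 c0 hc.
pose u := heat n a b; pose u1 := heat n (dcos L a b) (dsin L a b).
pose u2 := heat n (lapl L a) (lapl L b).
pose u3 := heat n (lapl L (dcos L a b)) (lapl L (dsin L a b)).
pose l := 2 * freq ^+ 2.
have l0 : 0 <= l by rewrite mulr_ge0 ?sqr_ge0.
pose dF s x := 2 * u1 s x * u3 s x / u s x - u1 s x ^+ 2 * u2 s x / u s x ^+ 2 -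
   l * (u2 s x * ln (u s x) + u2 s x).
have up s x : - d <= s -> 0 < u s x by move=> /(hd s x); apply: lt_le_trans; rewrite divr_gt0.
have d1x s : deriv1 (u s) (u1 s) by exact: deriv1_heat_x.
have d2x s : deriv1 (u1 s) (u2 s) by exact: deriv1_heat_xx.
have d3x s : deriv1 (u2 s) (u3 s).
  by rewrite /u3 -lapl_dcos -lapl_dsin; exact: deriv1_heat_x.
have cu s : continuous (u s) by exact: heat_continuous.
have cu1 s : continuous (u1 s) by exact: heat_continuous.
have cu2 s : continuous (u2 s) by exact: heat_continuous.
have cu3 s : continuous (u3 s) by exact: heat_continuous.
have c2 : 0 < c / 2 by rewrite divr_gt0.
(* The added 1 makes [B] positive, so that [ln B] bounds ln u from above. *)
pose B := coefbound n a b + 1; pose B1 := coefbound n (dcos L a b) (dsin L a b).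
pose B2 := coefbound n (lapl L a) (lapl L b).
pose B3 := coefbound n (lapl L (dcos L a b)) (lapl L (dsin L a b)).
have B10 : 0 <= B1 := coefbound_ge0 _ _ _ _.
have B20 : 0 <= B2 := coefbound_ge0 _ _ _ _.
have B30 : 0 <= B3 := coefbound_ge0 _ _ _ _.
pose G := `|ln (c / 2)| + `|ln B|.
have G0 : 0 <= G by rewrite addr_ge0.
have cF s : - d <= s -> continuous (entfisher (u s) (u1 s)).
  move=> sd; have us x := up s x sd.
  apply: contB.
    by apply: contM; [exact: contX|apply: contV => // x; rewrite gt_eqF].
  by apply: contZ; apply: contM => //; exact: cont_ln.
have cdF s : - d <= s -> continuous (dF s).
  move=> sd; have us x := up s x sd.
  have un x : u s x != 0 by rewrite gt_eqF.
  have un2 x : u s x ^+ 2 != 0 by rewrite expf_neq0.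
  apply: contB; last by apply: contZ; apply: contD => //; apply: contM => //; exact: cont_ln.
  apply: contB; apply: contM.
  - by apply: contM => //; exact: contZ.
  - exact: contV.
  - by apply: contM => //; exact: contX.
  - by apply: contV => //; exact: contX.
apply: (@le_of_deriv_le0 _ (fun s => itg (entfisher (u s) (u1 s))) (fun s => itg (dF s)) 0 t t0)
  => s /andP[s0 st].
- apply: (@leibniz _ L (fun s => entfisher (u s) (u1 s)) dF (- d) (t + 1)
    (2 * B1 * B3 / (c / 2) + B1 ^+ 2 * B2 / (c / 2) ^+ 2 + l * (B2 * G + B2))).
  + apply/andP; split; lra.
  + by move=> r /andP[dr _]; apply: intg_continuous; apply: cF; exact: ltW.
  + move=> r x /andP[dr _].
    have ur : 0 < u r x by apply: up; exact: ltW.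
    have h0 : is_derive r 1 (fun s => u s x) (u2 r x) := @deriv1_heat_t _ L n a b x r.
    have h1 : is_derive r 1 (fun s => u1 s x) (u3 r x) := @deriv1_heat_t _ L n _ _ x r.
    exact: (@is_derive_entfisher (fun s => u s x) (fun s => u1 s x) l r _ _ ur h0 h1).
  + move=> r x /andP[/ltW dr _].
    have r1 : -1 <= r by apply: le_trans dr; rewrite lerN2.
    have b0 : `|u r x| <= B by rewrite (le_trans (heat_bound _ _ _ _ _ r1))// lerDl.
    have b1 : `|u1 r x| <= B1 by exact: heat_bound.
    have b2 : `|u2 r x| <= B2 by exact: heat_bound.
    have b3 : `|u3 r x| <= B3 by exact: heat_bound.
    have ul := hd r x dr; have ur := up r x dr.
    have Vu : (u r x)^-1 <= (c / 2)^-1 by rewrite lef_pV2 ?posrE.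
    have V0 : 0 <= (u r x)^-1 by rewrite invr_ge0 ltW.
    have lnb : `|ln (u r x)| <= G.
      have l1 : ln (c / 2) <= ln (u r x) by rewrite ler_ln ?posrE.
      have l2 : ln (u r x) <= ln B.
        rewrite ler_ln ?posrE//; first by rewrite (le_trans _ b0)// ler_norm.
        by rewrite ltr_wpDl// coefbound_ge0.
      have := ler_norm (ln B); have := ler_norm (- ln (c / 2)); rewrite normrN => h1 h2.
      have := normr_ge0 (ln (c / 2)); have := normr_ge0 (ln B).
      by rewrite /G ler_norml => ? ?; apply/andP; split; lra.
    rewrite /dF (le_trans (ler_normB _ _))// lerD//.
      rewrite (le_trans (ler_normB _ _))// lerD//.
        rewrite !normrM (ger0_norm V0) ger0_norm// ler_pM// ?mulr_ge0//.
        by rewrite ler_pM// ?mulr_ge0// ler_pM2l.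
      rewrite !normrM normfV normrX (ger0_norm (ltW ur)).
      rewrite ler_pM// ?mulr_ge0// ?invr_ge0 ?exprn_ge0 ?(ltW ur)//.
        by rewrite ler_pM// ?mulr_ge0// expr2 ler_pM.
      by rewrite -!exprVn lerXn2r// nnegrE// invr_ge0 ltW.
    rewrite normrM (ger0_norm l0) ler_wpM2l// (le_trans (ler_normD _ _))// lerD//.
    by rewrite normrM ler_pM.
- have sd : - d <= s by apply: le_trans s0; rewrite oppr_le0 ltW.
  have us x := up s x sd.
  have un x : u s x != 0 by rewrite gt_eqF.
  pose y x := ln (u s x); pose y1 x := u1 s x / u s x.
  pose y2 x := u2 s x / u s x - u1 s x * u1 s x / u s x ^+ 2.
  have dy : deriv1 y y1 by exact: deriv1_ln.
  have dy1 : deriv1 y1 y2 by exact: deriv1_div.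
  have cy2 : continuous y2.
    apply: contB; apply: contM => //; first exact: contV.
    - exact: contM.
    - by apply: contV; [move=> x; rewrite expf_neq0|exact: contX].
  have u0L : u s 0 = u s L by exact: heat_0L.
  have u10L : u1 s 0 = u1 s L by exact: heat_0L.
  have u20L : u2 s 0 = u2 s L by exact: heat_0L.
  have := fisher_dissipation L0 dy dy1 cy2; rewrite /y /y1 u0L u10L => /(_ erefl erefl).
  set A := itg _; set D := itg _ => AD.
  have cy1 := deriv1_continuous dy1; have cy := deriv1_continuous dy.
  have iA : intg (fun x => expR (y x) * y1 x ^+ 2).
    by apply: intg_continuous; apply: contM; [exact: cont_expR|exact: contX].
  have iD : intg (fun x => expR (y x) * y2 x ^+ 2).
    by apply: intg_continuous; apply: contM; [exact: cont_expR|exact: contX].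
  suff -> : itg (dF s) = 2 * (freq ^+ 2 * A - D).
    by rewrite mulr_ge0_le0// subr_le0.
  rewrite -[A]/(itg (fun x => expR (y x) * y1 x ^+ 2)) -[D]/(itg (fun x => expR (y x) * y2 x ^+ 2)).
  rewrite -itgZ// -itgB//; last by exact: intgZ.
  rewrite -itgZ; last by apply: intgB => //; exact: intgZ.
  apply/eqP; rewrite -subr_eq0 -itgB; first last.
  - by apply: intgZ; apply: intgB => //; exact: intgZ.
  - by apply: intg_continuous; exact: cdF.
  (* The difference of the two integrands is an exact derivative: the first two terms account for I'
     = - 2 D, the last one for H' = - A. *)
  apply/eqP/(itg_periodic0 L0 (f := fun x => (2 * (u1 s x * u2 s x) / u s x -
     u1 s x ^+ 3 / u s x ^+ 2) - l * (u1 s x * ln (u s x) + u1 s x))).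
  - apply: deriv1_eq.
      apply: deriv1B.
        apply: deriv1B; apply: deriv1_div => //.
        + by apply: deriv1Z; apply: deriv1M; [exact: d2x|exact: d3x].
        + by move=> x; rewrite expf_neq0.
        + by apply: deriv1X; exact: d2x.
        + by apply: deriv1X; exact: d1x.
      apply: deriv1Z; apply: deriv1D; last exact: d2x.
      by apply: deriv1M; [exact: d2x|exact: dy].
    move=> x; rewrite /dF /y /y1 /y2 lnK ?posrE// /l.
    have := un x; have := us x.
    move: (u s x) (u1 s x) (u2 s x) (u3 s x) => v v1 v2 v3 v0 vn /=.
    by field.
  - apply: contB; first exact: cdF.
    by apply: contZ; apply: contB; [apply: contZ|]; apply: contM => //;
      try exact: cont_expR; exact: contX.
  - by rewrite u0L u10L u20L.
Qed.

(** A quadratic upper bound for x ln x around m, from ln (x / m) <= x / m - 1 multiplied by x. *)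
Lemma ent_upper (m x : R) : 0 < m -> 0 < x ->
  x * ln x <= m * ln m + (ln m + 1) * (x - m) + (x - m) ^+ 2 / m.
Proof.
move=> m0 x0; have xm : 0 < x / m by rewrite divr_gt0.
have := ler_wpM2l (ltW x0) (ln_le_sub1 xm); rewrite ln_div ?posrE//.
have mn : m != 0 by rewrite gt_eqF.
rewrite (_ : x * (x / m - 1) = (x - m) + (x - m) ^+ 2 / m); last by field.
move: ((x - m) ^+ 2 / m) => q; nra.
Qed.

(** The Fenchel-Young inequality between e^g and its conjugate b ln b - b, from e^s >= 1 + s at s =
    g - ln b. It holds at b = 0 as well, which lets densities vanish. *)
Lemma ent_lower (b g : R) : 0 <= b -> b * g - expR g <= b * ln b - b.
Proof.
rewrite le_eqVlt => /predU1P[<-|b0]; first by rewrite !mul0r subr0 sub0r oppr_le0 expR_ge0.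
have := ler_wpM2l (ltW b0) (expR_ge1Dx (g - ln b)).
rewrite expRD expRN lnK ?posrE// mulrCA mulfV ?gt_eqF//; nra.
Qed.

(** The linear term of [ent_upper] integrates to zero because [u] has mean [m]. *)
Lemma ln_itg_le u (m c : R) : 0 < c -> continuous u -> (forall x, c <= u x) ->
  itg u = m * L -> 0 < m ->
  forall d, (forall x, `|u x - m| <= d) ->
  itg (fun x => u x * ln (u x)) <= L * (m * ln m) + L * d ^+ 2 / m.
Proof.
move=> c0 cu hc um m0 d hd.
have up x : 0 < u x by apply: lt_le_trans (hc x).
have iu : intg u by exact: intg_continuous.
apply: (@le_trans _ _ (itg (fun x => m * ln m + d ^+ 2 / m + (ln m + 1) * (u x - m)))).
  apply: itg_le.
  - by apply: intg_continuous; apply: contM => //; exact: cont_ln.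
  - apply: intgD; first exact: intg_cst.
    by apply: intgZ; apply: intgB => //; exact: intg_cst.
  - move=> x _; apply: le_trans (ent_upper m0 (up x)) _.
    rewrite addrAC lerD2r lerD2l ler_pM2r ?invr_gt0// -ler_sqrt ?sqr_ge0//.
    by rewrite !sqrtr_sqr (le_trans (hd x))// ler_norm.
rewrite itgD; [|exact: intg_cst|by apply: intgZ; apply: intgB => //; exact: intg_cst].
rewrite itgZ; last by apply: intgB => //; exact: intg_cst.
rewrite itgB//; last exact: intg_cst.
rewrite !itg_cst// um subrr mulr0 addr0 le_eqVlt; apply/orP; left; apply/eqP; ring.
Qed.

(** The flow converges uniformly to its mean [m] at rate exp (- freq^2 t), so its entropy approaches
    L m ln m while the Fisher information stays nonnegative. The monotone quantity I - 2 freq^2 H is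
    thus at least - 2 freq^2 L m ln m at time 0. *)
Lemma tp_logsobolev n a b (c m : R) : 0 < c -> (forall x, c <= tp n a b x) ->
  itg (tp n a b) = m * L ->
  2 * freq ^+ 2 * (itg (fun x => tp n a b x * ln (tp n a b x)) - L * (m * ln m)) <=
  itg (fun x => tp n (dcos L a b) (dsin L a b) x ^+ 2 / tp n a b x).
Proof.
move=> c0 hc um.
have w0 := freq_gt0 L0.
have l0 : 0 < 2 * freq ^+ 2 by rewrite mulr_gt0// exprn_gt0.
have m0 : 0 < m.
  rewrite -(pmulr_lgt0 m L0) -um; apply: lt_le_trans (_ : c * L <= _).
    by rewrite mulr_gt0.
  rewrite -itg_cst//; apply: itg_le => //; first exact: intg_cst.
  by apply: intg_continuous; exact: tp_continuous.
pose u := heat n a b; pose u1 := heat n (dcos L a b) (dsin L a b).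
have up t x : 0 <= t -> 0 < u t x by move=> /(heat_pos L0 hc x); apply: lt_le_trans.
have n0 : (0 < n)%N.
  case: n um {hc u u1 up} => // /eqP; rewrite itg_tp// eq_sym mulf_eq0.
  by rewrite !gt_eqF.
have um' t : itg (u t) = m * L.
  rewrite -um /u /heat !itg_tp//; case: n n0 {um u u1 up hc} => // n _.
  by rewrite /hcoef mul0r expr0n/= mul0r oppr0 expR0 mulr1.
have a0m : a 0%N = m.
  have Ln : L != 0 by rewrite gt_eqF.
  by move: um; rewrite itg_tp//; case: n n0 {u u1 up hc um'} => // n _ /(mulIf Ln).
pose B := \sum_(j < n) (`|a j| + `|b j|).
have B0 : 0 <= B by apply: sumr_ge0 => j _; rewrite addr_ge0.
have hB t x : 0 <= t -> `|u t x - m| <= B * expR (- (freq ^+ 2 * t)).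
  move=> t0; rewrite -a0m /u /heat /tp /B; case: n n0 {um u u1 up hc um' B B0} => // n _.
  rewrite !big_ord_recl/= {1}/tpterm {1 2}/hcoef mulr0n !mul0r expr0n/= mul0r oppr0 expR0.
  rewrite cos0 sin0 !mulr1 mulr0 addr0 addrAC subrr add0r mulrDl.
  apply: (@le_trans _ _ ((\sum_(i < n) (`|a (bump 0 i)| + `|b (bump 0 i)|)) * expR (- (freq ^+ 2 * t)))); last first.
    by rewrite lerDr mulr_ge0 ?expR_ge0// addr_ge0.
  apply: (le_trans (ler_norm_sum _ _ _)); rewrite mulr_suml; apply: ler_sum => j _.
  apply: (le_trans (ler_normD _ _)); rewrite /hcoef !normrM mulrDl.
  have E : `|expR (- (((bump 0 j)%:R * freq) ^+ 2 * t))| <= expR (- (freq ^+ 2 * t)).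
    rewrite ger0_norm ?expR_ge0// ler_expR lerN2 ler_wpM2r//.
    by rewrite exprMn ler_peMl ?sqr_ge0// expr_ge1// ler1n.
  apply: lerD; rewrite -mulrA ler_wpM2l//; apply: le_trans E; rewrite ler_piMr//.
    by rewrite cos_max.
  by rewrite sin_max.
have key t : 0 <= t -> - (2 * freq ^+ 2 * (L * (m * ln m) + L * (B * expR (- (freq ^+ 2 * t))) ^+ 2 / m)) <=
   itg (entfisher (u 0) (u1 0)).
  move=> t0; apply: le_trans (entfisher_decreasing c0 hc t0).
  have cu : continuous (u t) by exact: heat_continuous.
  have cu1 : continuous (u1 t) by exact: heat_continuous.
  have iu : intg (fun x => u t x * ln (u t x)).
    by apply: intg_continuous; apply: contM => //; apply: cont_ln => // x; exact: up.
  apply: (@le_trans _ _ (itg (fun x => - (2 * freq ^+ 2) * (u t x * ln (u t x))))).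
    rewrite itgZ// mulNr lerN2 ler_pM2l//.
    apply: (ln_itg_le c0 cu) => // x; last exact: hB.
    exact: heat_pos.
  apply: itg_le.
  - by apply: intgZ.
  - apply: intgB; last exact: intgZ.
    apply: intg_continuous; apply: contM; first exact: contX.
    by apply: contV => // x; rewrite gt_eqF ?up.
  - by move=> x _; rewrite /entfisher mulNr lerDr divr_ge0 ?sqr_ge0// ltW// up.
have u0E : u 0 = tp n a b by apply/funext => x; exact: heat0.
have u10E : u1 0 = tp n (dcos L a b) (dsin L a b) by apply/funext => x; exact: heat0.
have up0 x : 0 < tp n a b x by apply: lt_le_trans (hc x).
have i1 : intg (fun x => tp n (dcos L a b) (dsin L a b) x ^+ 2 / tp n a b x).
  apply: intg_continuous; apply: contM; first by apply: contX; exact: tp_continuous.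
  by apply: contV => [x|]; [rewrite gt_eqF|exact: tp_continuous].
have i2 : intg (fun x => tp n a b x * ln (tp n a b x)).
  by apply: intg_continuous; apply: contM; [|apply: cont_ln => //]; exact: tp_continuous.
have E : itg (entfisher (u 0) (u1 0)) =
    itg (fun x => tp n (dcos L a b) (dsin L a b) x ^+ 2 / tp n a b x) -
    2 * freq ^+ 2 * itg (fun x => tp n a b x * ln (tp n a b x)).
  rewrite u0E u10E -itgZ// -itgB//; exact: intgZ.
apply: (@le_of_approx _ _ _ (2 * freq ^+ 2 * (L * B ^+ 2 / m))).
  by rewrite mulr_ge0 ?(ltW l0)// divr_ge0 ?(ltW m0)// mulr_ge0 ?sqr_ge0// ltW.
move=> e e0 e1.
(* At this time the decay factor is exp (- 1 / e), which is at most e because exp s >= 1 + s. *)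
have t0 : 0 <= e^-1 / freq ^+ 2 by rewrite divr_ge0 ?sqr_ge0// invr_ge0 ltW.
have := key _ t0; rewrite E [freq ^+ 2 * (_ / _)]mulrC divfK ?expf_neq0 ?gt_eqF//.
have ee : expR (- e^-1) <= e.
  rewrite expRN -[leRHS]invrK lef_pV2 ?posrE ?expR_gt0 ?invr_gt0//.
  by apply: le_trans (expR_ge1Dx _); rewrite lerDr.
have ee2 : expR (- e^-1) ^+ 2 <= e.
  rewrite expr2; apply: (@le_trans _ _ (e * 1)); last by rewrite mulr1.
  by apply: ler_pM; rewrite ?expR_ge0// (le_trans ee).
have lB : 0 <= 2 * freq ^+ 2 * (L * B ^+ 2 / m).
  by rewrite mulr_ge0 ?(ltW l0)// divr_ge0 ?(ltW m0)// mulr_ge0 ?sqr_ge0// ltW.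
have := ler_wpM2l lB ee2.
rewrite exprMn (_ : L * (B ^+ 2 * expR (- e^-1) ^+ 2) / m =
   (L * B ^+ 2 / m) * expR (- e^-1) ^+ 2); last by ring.
move: (expR _ ^+ 2) (L * B ^+ 2 / m) (2 * freq ^+ 2) => X Y l.
move: (itg _) (itg _) (L * _) => P I Q.
lra.
Qed.

Lemma conv_ge k w (c x : R) : intg w -> (forall z, z \in `[0, L] -> c <= w z) -> c <= conv k w x.
Proof.
move=> iw cw; rewrite -[leLHS](conv_cst L0 k c x); apply: conv_le => //.
exact: intg_cst.
Qed.

Lemma cont_pos_lb (w : R -> R) : continuous w -> (forall x, 0 < w x) ->
  exists2 c : R, 0 < c & forall x, x \in `[0, L] -> c <= w x.
Proof.
move=> cw w0; have [C wC] : exists C : R, forall x, x \in `[0, L] -> `|(w x)^-1| <= C.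
  by apply: (cont_bounded L0); apply: contV => // x; rewrite gt_eqF.
have C0 : 0 < C.
  have z0 : 0 \in `[0, L] by rewrite in_itv/= lexx ltW.
  by apply: lt_le_trans (wC 0 z0); rewrite normr_gt0 invr_eq0 gt_eqF.
exists C^-1; first by rewrite invr_gt0.
move=> x /wC; rewrite gtr0_norm ?invr_gt0// => H.
by rewrite -[leRHS]invrK lef_pV2 ?posrE// invr_gt0.
Qed.

(* Jensen's inequality for the jointly convex function (p, q) -> p^2 / q. *)
Lemma conv_perspective k (w w1 : R -> R) x : continuous w -> (forall x, 0 < w x) -> continuous w1 ->
  conv k w1 x ^+ 2 / conv k w x <= conv k (fun z => w1 z ^+ 2 / w z) x.
Proof.
move=> cw w0 cw1; have [c c0 hc] := cont_pos_lb cw w0.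
have iw : intg w by exact: intg_continuous.
have iw1 : intg w1 by exact: intg_continuous.
have iq : intg (fun z => w1 z ^+ 2 / w z).
  apply: intg_continuous; apply: contM; first exact: contX.
  by apply: contV => // z; rewrite gt_eqF.
have U0 : 0 < conv k w x by apply: lt_le_trans (conv_ge k x iw hc).
set s := conv k w1 x / conv k w x.
have : 0 <= conv k (fun z => w1 z ^+ 2 / w z + (- (2 * s) * w1 z + s ^+ 2 * w z)) x.
  apply: itg_ge0 => z _; rewrite mulr_ge0 ?bumpker_ge0//.
  have wn : w z != 0 by rewrite gt_eqF.
  rewrite (_ : _ + _ = (w1 z - s * w z) ^+ 2 / w z); last by field.
  by rewrite divr_ge0 ?sqr_ge0// ltW.
rewrite convD//; last by apply: intgD; exact: intgZ.
rewrite (convD L0 k (intgZ _ iw1) (intgZ _ iw)).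
rewrite !convZ// => H; rewrite -subr_ge0; apply: le_trans H _.
have Un : conv k w x != 0 by rewrite gt_eqF.
by rewrite le_eqVlt; apply/orP; left; apply/eqP; rewrite /s; field.
Qed.

(** Applied first to [conv k w], a trigonometric polynomial with the same mass and a positive lower
    bound. The Fisher information does not increase by [conv_perspective], and the entropy of [w] is
    recovered for large k. *)
Lemma logsobolev w w1 (m : R) : deriv1 w w1 -> continuous w1 -> w 0 = w L ->
  (forall x, 0 < w x) -> itg w = m * L ->
  2 * freq ^+ 2 * (itg (fun x => w x * ln (w x)) - L * (m * ln m)) <=
  itg (fun x => w1 x ^+ 2 / w x).
Proof.
move=> dw cw1 p0 w0 wm.
have cw := deriv1_continuous dw.
have [c c0 hc] := cont_pos_lb cw w0.
have iw : intg w by exact: intg_continuous.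
have iw1 : intg w1 by exact: intg_continuous.
have cln : continuous (fun x => ln (w x)) by exact: cont_ln.
have iwl : intg (fun x => w x * ln (w x)) by apply: intg_continuous; exact: contM.
have iq : intg (fun z => w1 z ^+ 2 / w z).
  apply: intg_continuous; apply: contM; first exact: contX.
  by apply: contV => // z; rewrite gt_eqF.
have [C C0 lw] := deriv1_lipschitz_per L0 dw cw1 p0.
have [B hB] := cont_bounded L0 cln.
have B0 : 0 <= B by rewrite (le_trans _ (hB 0 _))// in_itv/= lexx ltW.
have l0 : 0 < 2 * freq ^+ 2 by rewrite mulr_gt0// exprn_gt0// freq_gt0.
have H k : 2 * freq ^+ 2 * (itg (fun x => conv k w x * ln (conv k w x)) - L * (m * ln m)) <=
    itg (fun x => w1 x ^+ 2 / w x).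
  have [n [b E]] := conv_tp L0 k.
  have dE := deriv1E (deriv1_conv L0 k dw cw1 p0).
  have dE' := deriv1E (deriv1_tp L n (fun j => b j * coscoef L w j) (fun j => b j * sincoef L w j)).
  rewrite -E// in dE'; rewrite dE in dE'.
  apply: (@le_trans _ _ (itg (fun x => conv k w1 x ^+ 2 / conv k w x))).
    rewrite dE' E//; apply: (tp_logsobolev c0); rewrite -E//.
    - by move=> x; exact: conv_ge.
    - by rewrite itg_conv.
  rewrite -(itg_conv L0 k iq); apply: itg_le.
  - apply: intg_continuous; apply: contM; first by apply: contX; exact: conv_continuous.
    apply: contV; last exact: conv_continuous.
    by move=> x; rewrite gt_eqF//; apply: lt_le_trans (conv_ge k x iw hc).
  - by apply: intg_continuous; exact: conv_continuous.
  - by move=> x _; exact: conv_perspective.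
apply: (@le_of_approx _ _ _ (2 * freq ^+ 2 * ((1 + B) * L))).
  by rewrite mulr_ge0 ?(ltW l0)// mulr_ge0 ?(ltW L0)// addr_ge0.
move=> e e0 e1.
have [K HK] := conv_lipschitz_per L0 C0 lw (intg_meas iw) e0.
apply: le_trans (lerD (H K) (lexx _)); rewrite (mulrCA e) -mulrDr ler_pM2l//.
rewrite -addrA (addrC (- _)) addrA lerD2r.
have cK : continuous (conv K w) by exact: conv_continuous.
have uK x : 0 < conv K w x by apply: lt_le_trans (conv_ge K x iw hc).
have iK : intg (fun x => conv K w x * ln (conv K w x)).
  by apply: intg_continuous; apply: contM => //; exact: cont_ln.
rewrite (mulrA e) -(itg_cst L0) -itgD//; last exact: intg_cst.
apply: itg_le => //; first by apply: intgD => //; exact: intg_cst.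
move=> x xL; have := HK K (leqnn _) x xL; have := hB x xL.
(* Only the tangent bound of the entropy at w is required: w ln w <= u ln u + (w - u)(1 + ln w),
   with |w - u| <= e and |ln w| <= B. *)
have := ent_lower (ln (w x)) (ltW (uK x)); rewrite lnK ?posrE//.
move: (conv K w x) (ln (conv K w x)) (w x) (ln (w x)) => u lu v lv.
by rewrite !ler_norml => h /andP[h1 h2] /andP[h3 h4]; nra.
Qed.

Lemma entropy_dissipation_smooth y y1 y2 (m : R) : deriv1 y y1 -> deriv1 y1 y2 ->
  continuous y2 -> y 0 = y L -> y1 0 = y1 L -> itg (fun x => expR (y x)) = m * L ->
  2 * freq ^+ 4 * (itg (fun x => expR (y x) * y x) - L * (m * ln m)) <=
  itg (fun x => expR (y x) * y2 x ^+ 2).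
Proof.
move=> d1 d2 c2 p0 p1 hm; apply: le_trans (fisher_dissipation L0 d1 d2 c2 p0 p1).
rewrite (exprD freq 2 2) (mulrCA 2) -mulrA.
rewrite ler_pM2l; last by rewrite exprn_gt0// freq_gt0.
have := @logsobolev (fun x => expR (y x)) (fun x => expR (y x) * y1 x) m.
have -> : (fun x => expR (y x) * ln (expR (y x))) = (fun x => expR (y x) * y x).
  by apply/funext => x; rewrite expRK.
have -> : (fun x => (expR (y x) * y1 x) ^+ 2 / expR (y x)) = (fun x => expR (y x) * y1 x ^+ 2).
  by apply/funext => x; have := expR_gt0 (y x) => e0; field; rewrite gt_eqF.
apply.
- exact: deriv1_expR.
- apply: contM; last exact: deriv1_continuous d2.
  by apply: cont_expR; exact: deriv1_continuous d1.
- by rewrite p0.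
- by move=> x; exact: expR_gt0.
- exact: hm.
Qed.

End LogSobolevTrig.

(** * Sobolev functions on the circle *)

Section Primitive.
Context {R : realType}.
Variable L : R.
Hypothesis L0 : 0 < L.
Implicit Types (f g h : R -> R).
Local Notation mu := (@lebesgue_measure R).
Local Notation intg := (intg L).
Local Notation itg := (itg L).
Local Notation freq := (freq L).
Local Notation conv := (conv L).

Lemma ae_mono (P Q : R -> Prop) : {ae mu, forall x, P x} -> (forall x, P x -> Q x) ->
  {ae mu, forall x, Q x}.
Proof.
move=> aeP PQ; apply: filterS aeP; last exact: PQ.
exact: (ae_filter_ringOfSetsType mu).
Qed.

Definition prim f (x : R) : R := \int[mu]_(t in `[0, x]) f t.

Lemma itg_cutoff f x : 0 <= x -> x <= L ->
  prim f x = itg (fun t => f t * \1_`[0, x]%classic t).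
Proof.
move=> x0 xL; rewrite /prim /itg Rintegral_mkcond [RHS]Rintegral_mkcond.
congr Rintegral; apply/funext => t; rewrite !patchE indicE.
have [|] := boolP (t \in `[0, x]%classic).
  rewrite inE/= in_itv/= => /andP[t0 tx].
  by rewrite mem_set ?mulr1//= in_itv/= t0 (le_trans tx).
by rewrite mulr0; case: ifP.
Qed.

Lemma indic_le1 (A : set R) x : `|\1_A x : R| <= 1.
Proof. by rewrite indicE; case: (_ \in _); rewrite /= ?normr1 ?normr0. Qed.

Lemma intg_indicM f (A : set R) : measurable A -> intg f -> intg (fun t => f t * \1_A t).
Proof.
move=> mA fi; apply: (@intgM _ _ _ _ 1) => //; last by move=> x _; exact: indic_le1.
Qed.

Lemma prim0 f : prim f 0 = 0.
Proof. by rewrite /prim set_itv1 Rintegral_set1. Qed.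

Lemma primL f : prim f L = itg f.
Proof. by []. Qed.

Lemma primB_le f g x : 0 <= x -> x <= L -> intg f -> intg g ->
  `|prim f x - prim g x| <= itg (fun t => `|f t - g t|).
Proof.
move=> x0 xL fi gi; rewrite !itg_cutoff// -itgB; [|exact: intg_indicM|exact: intg_indicM].
have ifg : intg (fun t => f t - g t) by exact: intgB.
apply: (@le_trans _ _ (itg (fun t => `|(f t - g t) * \1_`[0, x]%classic t|))).
  rewrite (_ : (fun x0 => _) = fun t => (f t - g t) * \1_`[0, x]%classic t).
    by apply: itg_norm; exact: intg_indicM.
  by apply/funext => t; rewrite mulrBl.
apply: itg_le; [by apply: intg_norm; exact: intg_indicM|exact: intg_norm|].
by move=> t _; rewrite normrM ler_piMr// indic_le1.
Qed.

Lemma prim_within f : intg f -> {within `[0, L], continuous (prim f)}.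
Proof. by move=> fi; exact: (parameterized_integral_continuous (ltW L0) fi). Qed.

Lemma within_intg f : {within `[0, L], continuous f} -> intg f.
Proof. by move=> cf; apply: continuous_compact_integrable => //; exact: segment_compact. Qed.

(** For continuous densities this is the classical integration by parts. Both sides are continuous
    in [f] for the L^1 norm, in which continuous functions are dense. *)
Lemma prim_ibp f p q : intg f -> deriv1 p q -> continuous q ->
  itg (fun x => prim f x * q x) = itg f * p L - itg (fun x => f x * p x).
Proof.
move=> fi pq cq.
have cp := deriv1_continuous pq.
have [C1 hC1] := cont_bounded L0 cp; have [C2 hC2] := cont_bounded L0 cq.
have z0 : 0 \in `[0, L] by rewrite in_itv/= lexx ltW.
have zL : L \in `[0, L] by rewrite in_itv/= lexx ltW.
have C10 : 0 <= C1 by rewrite (le_trans _ (hC1 0 _)).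
have C20 : 0 <= C2 by rewrite (le_trans _ (hC2 0 _)).
have iPf h : intg h -> intg (fun x => prim h x * q x).
  by move=> hi; apply: intgMc => //; apply: within_intg; exact: prim_within.
have H0 g : continuous g -> itg (fun x => prim g x * q x) = itg g * p L - itg (fun x => g x * p x).
  move=> cg; have gi : intg g by exact: intg_continuous.
  have := @Rintegration_by_parts R (prim g) p g q 0 L L0.
  rewrite prim0 mul0r subr0; apply.
  - exact: continuous_subspaceT.
  - have /(continuous_within_itvP _ L0)[_ c1 c2] := prim_within gi.
    split => //; move=> x; rewrite in_itv/= => /andP[x0 xL].
    by have [] := continuous_FTC1_closed xL gi x0 (@cg x).
  - move=> x; rewrite in_itv/= => /andP[x0 xL].
    by have [_] := continuous_FTC1_closed xL gi x0 (@cg x).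
  - exact: continuous_subspaceT.
  - exact: deriv1_LRcontinuous pq.
  - by move=> x _; rewrite (deriv1E pq).
have H1 g d : continuous g -> itg (fun t => `|f t - g t|) <= d ->
   `|itg (fun x => prim f x * q x) - (itg f * p L - itg (fun x => f x * p x))| <= d * (C2 * L + 2 * C1).
  move=> cg fgd; have gi : intg g by exact: intg_continuous.
  have d0 : 0 <= d by apply: le_trans fgd; apply: itg_ge0 => t _.
  rewrite (_ : _ - _ = (itg (fun x => prim f x * q x) - itg (fun x => prim g x * q x)) -
     ((itg f - itg g) * p L - (itg (fun x => f x * p x) - itg (fun x => g x * p x)))); last first.
    by rewrite (H0 g cg); ring.
  rewrite -!itgB//; try exact: iPf; try exact: intgMc.
  have E1 : `|itg (fun x => prim f x * q x - prim g x * q x)| <= d * (C2 * L).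
    apply: (le_trans (itg_norm _)); first by apply: intgB; exact: iPf.
    rewrite mulrA -(itg_cst L0); apply: itg_le.
    - by apply: intg_norm; apply: intgB; exact: iPf.
    - exact: intg_cst.
    - move=> x xI; rewrite -mulrBl normrM; apply: ler_pM => //; last exact: hC2.
      move: xI; rewrite in_itv/= => /andP[x0 xL].
      exact: le_trans (primB_le x0 xL fi gi) _.
  have E2 : `|itg (fun x => f x - g x) * p L| <= d * C1.
    rewrite normrM; apply: ler_pM => //; last exact: hC1.
    by apply: (le_trans (itg_norm _)) => //; exact: intgB.
  have E3 : `|itg (fun x => f x * p x - g x * p x)| <= d * C1.
    apply: (le_trans (itg_norm _)); first by apply: intgB; exact: intgMc.
    apply: (@le_trans _ _ (itg (fun x => C1 * `|f x - g x|))).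
      apply: itg_le.
      - by apply: intg_norm; apply: intgB; exact: intgMc.
      - by apply: intgZ; apply: intg_norm; exact: intgB.
      - by move=> x xI; rewrite -mulrBl normrM mulrC ler_wpM2r// hC1.
    rewrite itgZ; first by rewrite mulrC ler_wpM2r.
    by apply: intg_norm; exact: intgB.
  apply: (le_trans (ler_normB _ _)).
  rewrite mulrDr lerD// (le_trans (ler_normB _ _))//.
  by rewrite (_ : 2 * C1 = C1 + C1) ?mulrDr ?lerD//; ring.
have muL : (mu `[0%R, L]%classic < +oo)%E by rewrite [X in (X < _)%E](mu0L L0) ltry.
have [g_ [cg ig gcvg]] := approximation_continuous_integrable (measurable_itv `[0, L]) muL fi.
have {}gcvg : itg (fun t => `|f t - g_ n t|) @[n --> \oo] --> 0.
  by apply: fine_cvg; exact: gcvg.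
apply/eqP; rewrite -subr_eq0 -normr_le0.
apply: (@le_of_approx _ _ _ (C2 * L + 2 * C1)).
  by rewrite addr_ge0// mulr_ge0// ltW.
move=> e e0 _; rewrite add0r.
have /cvgrPdist_le/(_ _ e0)[n _ /(_ n (leqnn _))] := gcvg.
rewrite /= sub0r normrN => Hn; apply: (H1 (g_ n)) => //.
exact: le_trans (ler_norm _) Hn.
Qed.

Lemma itg_dominated (F : nat -> R -> R) f g : (forall n, intg (F n)) -> intg g ->
  (forall n x, x \in `[0, L] -> `|F n x| <= g x) -> intg f ->
  {ae mu, forall x, x \in `[0, L] -> F n x @[n --> \oo] --> f x} ->
  itg (F n) @[n --> \oo] --> itg f.
Proof.
move=> iF ig Fg fi cvgF.
have mF n : measurable_fun `[0, L] (EFin \o F n) by apply/measurable_EFinP; exact: intg_meas.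
have mf : measurable_fun `[0, L] (EFin \o f) by apply/measurable_EFinP; exact: intg_meas.
have cE : {ae mu, forall x, `[0, L]%classic x -> (F n x)%:E @[n --> \oo] --> (f x)%:E}.
  refine (ae_mono cvgF _) => x H xI.
  by apply/fine_cvgP; split; [exact: nearW|exact: H].
have bE : {ae mu, forall x, forall n, `[0, L]%classic x -> (`|(F n x)%:E| <= (g x)%:E)%E}.
  by apply: aeW => x n xI; rewrite lee_fin; exact: Fg.
have [] := @dominated_convergence _ _ _ mu `[0, L]%classic (measurable_itv _)
   (fun n => EFin \o F n) (EFin \o f) (EFin \o g) mF mf cE ig bE.
have fE : (\int[mu]_(x in `[0%R, L]) (EFin \o f) x)%E = (itg f)%:E.
  by rewrite /itg /Rintegral fineK// integrable_fin_num.
by move=> _ _; rewrite fE => H; apply: fine_cvg; exact: H.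
Qed.

Lemma neq_ae (p : R) : {ae mu, forall x : R, x != p}.
Proof.
exists [set p]; split => //=; first exact: lebesgue_measure_set1.
by move=> x /= /negP; rewrite negbK => /eqP.
Qed.

Lemma ae_and (P Q : R -> Prop) : {ae mu, forall x, P x} -> {ae mu, forall x, Q x} ->
  {ae mu, forall x, P x /\ Q x}.
Proof.
move=> aP aQ; apply: filterS2 aP aQ => //.
exact: (ae_filter_ringOfSetsType mu).
Qed.

Lemma le_near (x z p : R) : `|x - z| < `|x - p| ->
  (p <= z) = (p <= x) /\ (z <= p) = (x <= p).
Proof.
rewrite ltr_norml => /andP[]; case: (ltrgtP x p) => [xp|xp|->]; last first.
- by move=> h1 h2; exfalso; lra.
- move=> h1 h2; have pz : p < z by lra.
  by rewrite (ltW pz) leNgt pz.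
- move=> h1 h2; have pz : z < p by lra.
  by rewrite (ltW pz) leNgt pz.
Qed.

Lemma conv_indic_cvg (p q x : R) : x \in `]0, L[ -> x != p -> x != q ->
  conv k (\1_`[p, q]%classic) x @[k --> \oo] --> (\1_`[p, q]%classic x : R).
Proof.
rewrite in_itv/= => /andP[x0 xL] xp xq.
apply/cvgrPdist_le => e e0.
have [||||K HK] := @conv_approx R L L0 \1_`[p, q]%classic 1 [set x] _ _ _ _ e e0.
- exact: measurable_indic.
- by move=> z _; exact: indic_le1.
- by move=> z _; exact: indic_le1.
- move=> e' e'0.
  (* Within this radius the indicator does not change; being also at most x and L - x, it excludes
     points that are close only around the end point. *)
  pose r := Num.min (Num.min `|x - p| `|x - q|) (Num.min x (L - x)).
  have r0 : 0 < r by rewrite !lt_min !normr_gt0 !subr_eq0 xp xq x0 subr_gt0.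
  have [d d0 Hd] := cosbump_modulus L0 r0.
  exists d => // _ z -> zI /Hd[].
    rewrite !lt_min => /andP[/andP[zp zq] _].
    suff -> : (\1_`[p, q]%classic z : R) = \1_`[p, q]%classic x.
      by rewrite subrr normr0 ltW.
    rewrite !indicE; congr (_%:R); congr nat_of_bool.
    have [zp1 _] := le_near zp; have [_ zq2] := le_near zq.
    by apply/idP/idP; rewrite !inE/= !in_itv/= zp1 zq2.
  move: zI; rewrite in_itv/= => /andP[z0 zL].
  have rx : r <= x by rewrite !ge_min lexx !orbT.
  have rLx : r <= L - x by rewrite !ge_min lexx !orbT.
  by case: (ler0P (x - z)) => ? ?; lra.
exists K => // k /= Kk; rewrite distrC; exact: HK.
Qed.

Lemma conv_indic_bound (A : set R) k x : measurable A -> `|conv k (\1_A) x| <= 1.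
Proof.
move=> mA.
have iA : intg (\1_A : R -> R).
  by apply: (@intg_bounded _ _ L0 _ 1) => // z _; exact: indic_le1.
rewrite ger0_norm.
  rewrite -[leRHS](conv_cst L0 k 1 x); apply: conv_le => //; first exact: intg_cst.
by apply: itg_ge0 => z _; rewrite mulr_ge0 ?bumpker_ge0// indicE.
Qed.

Lemma conv_indic_ae (p q : R) : {ae mu, forall x, x \in `[0, L] ->
   conv k (\1_`[p, q]%classic) x @[k --> \oo] --> (\1_`[p, q]%classic x : R)}.
Proof.
refine (ae_mono (ae_and (ae_and (neq_ae 0) (neq_ae L)) (ae_and (neq_ae p) (neq_ae q))) _).
move=> x [[x0 xL] [xp xq]] xI; apply: conv_indic_cvg => //.
move: xI; rewrite !in_itv/= !le_eqVlt eq_sym (negbTE x0)/= (negbTE xL)//.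
Qed.

Lemma itg_indic_cvg h (p q : R) : intg h ->
  itg (fun x => h x * conv k (\1_`[p, q]%classic) x) @[k --> \oo] -->
  itg (fun x => h x * \1_`[p, q]%classic x).
Proof.
move=> hi; apply: (@itg_dominated _ _ (fun x => `|h x|)).
- by move=> k; apply: intgMc => //; apply: conv_continuous => //; exact: intg_indic.
- exact: intg_norm.
- by move=> k x _; rewrite normrM ler_piMr// conv_indic_bound.
- exact: intg_indicM.
- refine (ae_mono (conv_indic_ae p q) _) => x H xI.
  by apply: cvgM; [exact: cvg_cst|exact: H].
Qed.

(** Extended by zero, [h] has an identically zero primitive on the whole line, and Lebesgue's
    differentiation theorem identifies [h] a.e. with its derivative. *)
Lemma ae_eq0_of_prim h : intg h -> (forall x, x \in `[0, L] -> prim h x = 0) ->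
  {ae mu, forall x, x \in `[0, L] -> h x = 0}.
Proof.
move=> hi h0.
pose f := h \_ `[0, L].
have fi : mu.-integrable setT (EFin \o f).
  by rewrite -restrict_EFin; apply/integrable_restrict => //; rewrite setTI.
have fE y : \int[mu]_(t in `]-oo, y]) f t = 0.
  rewrite Rintegral_mkcond -/f.
  have [y0|y0] := ltP y 0.
    rewrite (_ : (fun t => _) = fun=> 0) ?Rintegral_cst ?mul0r//.
    apply/funext => t; rewrite !patchE; case: ifPn => //; rewrite inE/= in_itv/= => ty.
    by rewrite /f patchE memNset//= in_itv/= => /andP[t0 _]; move: (le_lt_trans (le_trans t0 ty) y0); rewrite ltxx.
  have zI : Num.min y L \in `[0, L].
    by rewrite in_itv/= le_min y0 (ltW L0) ge_min lexx orbT.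
  rewrite -(h0 _ zI) /prim [RHS]Rintegral_mkcond; congr Rintegral.
  apply/funext => t; rewrite !patchE; case: ifPn => ty; last first.
    rewrite memNset//=; rewrite in_itv/= le_min => /andP[_ /andP[ty' _]].
    by move: ty; rewrite notin_setE/= in_itv/= ty'.
  case: ifPn; rewrite !(inE, notin_setE)/= !in_itv/=.
    move=> /andP[t0]; rewrite le_min => /andP[_ tL].
    by rewrite /f patchE mem_set//= in_itv/= t0.
  move=> nt; rewrite /f patchE memNset//= in_itv/= => /andP[t0 tL].
  by apply: nt; rewrite t0 le_min tL andbT; move: ty; rewrite inE/= in_itv.
have loc : locally_integrable [set: R] f by exact: integrable_locally.
have iy y : mu.-integrable `]-oo, y] (EFin \o f) by exact: integrableS fi.
have := FTC1Ny iy loc.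
rewrite (_ : (fun x => _) = (fun=> 0)); last by apply/funext => y; exact: fE.
move=> H; refine (ae_mono H _) => x [_ +] xI.
by rewrite derive1_cst /f patchE mem_set// => <-.
Qed.

(** Self-adjointness moves the kernel from the indicator of [0, x] onto [h], whose convolution
    vanishes with its coefficients. In the limit the primitive of [h] is zero at every x. *)
Lemma coef_eq0 h : intg h -> (forall j, coscoef L h j = 0) -> (forall j, sincoef L h j = 0) ->
  {ae mu, forall x, x \in `[0, L] -> h x = 0}.
Proof.
move=> hi hc hs; apply: ae_eq0_of_prim => // x; rewrite in_itv/= => /andP[x0 xL].
rewrite itg_cutoff//.
have := @itg_indic_cvg h 0 x hi.
rewrite (_ : (fun k => _) = fun=> 0); last first.
  apply/funext => k; rewrite conv_selfadjoint//; last exact: intg_indic.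
  have [n [b E]] := conv_tp L0 k.
  rewrite -[RHS](mul0r L) -(itg_cst L0); apply: eq_itg => z _.
  rewrite E// /tp big1 ?mulr0// => j _.
  by rewrite hc hs /tpterm !mulr0 !mul0r addr0.
by move=> /cvg_lim <-//; rewrite lim_cst.
Qed.

End Primitive.

(** * Weak derivatives through Fourier coefficients, and a Lipschitz representative *)

Section Sobolev.
Context {R : realType}.
Variable L : R.
Hypothesis L0 : 0 < L.
Implicit Types (f g h y phi : R -> R).
Local Notation mu := (@lebesgue_measure R).
Local Notation intg := (intg L).
Local Notation itg := (itg L).
Local Notation freq := (freq L).
Local Notation conv := (conv L).

Lemma Lnorm_restrict (D : set R) (p : R) f : p != 0 ->
  (Lnorm mu p%:E (EFin \o (f \_ D)%R) `^ p = \int[mu]_(x in D) (`|f x| `^ p)%:E)%E.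
Proof.
move=> p0; rewrite (poweR_Lnorm _ _ p0) [RHS]integral_mkcond; congr integral.
apply/funext => x.
have -> : (`|(EFin \o (f \_ D)%R) x| = (`|(f \_ D) x|%R)%:E)%E by [].
rewrite poweR_EFin !patchE; case: ifP => // _.
by rewrite normr0 powR0.
Qed.

Lemma Lnorm_lty (D : set R) (p : R) f : p != 0 ->
  (Lnorm mu p%:E (EFin \o (f \_ D)%R) < +oo)%E <->
  (\int[mu]_(x in D) (`|f x| `^ p)%:E < +oo)%E.
Proof.
move=> p0; rewrite -Lnorm_restrict//; split; first exact: poweR_lty.
exact: lty_poweRy.
Qed.

Lemma Lp1P f : Lp L 1 f <-> [/\ periodic f L, measurable_fun setT f & intg f].
Proof.
have E : (\int[mu]_(x in `[0%R, L]) (`|f x| `^ 1)%:E = \int[mu]_(x in `[0%R, L]) `|(f x)%:E|)%E.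
  by apply: eq_integral => x _; rewrite powRr1.
split=> -[pf mf H]; split => //.
- apply/integrableP; split; first by apply/measurable_EFinP; exact: measurable_funTS.
  by rewrite -E; apply/(@Lnorm_lty _ 1 f) => //; exact: oner_neq0.
- have /integrableP[_ H'] := H.
  by apply/(@Lnorm_lty _ 1 f); [exact: oner_neq0|rewrite E].
Qed.

Lemma Lp2P f : Lp L 2 f <-> [/\ periodic f L, measurable_fun setT f & intg (fun x => f x ^+ 2)].
Proof.
have E : (\int[mu]_(x in `[0%R, L]) (`|f x| `^ 2)%:E = \int[mu]_(x in `[0%R, L]) `|(f x ^+ 2)%:E|)%E.
  by apply: eq_integral => x _; rewrite powR_mulrn//= normrX.
have n2 : 2 != 0 :> R by rewrite pnatr_eq0.
split=> -[pf mf H]; split => //.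
- apply/integrableP; split.
    by apply/measurable_EFinP; apply: measurable_funX; exact: measurable_funTS.
  by rewrite -E; apply/(Lnorm_lty _ _ n2).
- have /integrableP[_ H'] := H.
  by apply/(Lnorm_lty _ _ n2); rewrite E.
Qed.

Lemma snorm_Lp_ge0 (p : R) f : 0 <= snorm (Lp L p) f.
Proof. by rewrite fine_ge0// Lnorm_ge0. Qed.

Lemma snorm_Lp2 f : Lp L 2 f -> snorm (Lp L 2) f ^+ 2 = itg (fun x => f x ^+ 2).
Proof.
move=> [_ _ H]; have n2 : 2 != 0 :> R by rewrite pnatr_eq0.
have fin : Lnorm mu 2%:E (EFin \o (f \_ `[0, L])) \is a fin_num.
  by rewrite ge0_fin_numE// Lnorm_ge0.
have := Lnorm_restrict `[0, L] f n2; rewrite -(fineK fin) poweR_EFin => E.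
rewrite -powR_mulrn ?snorm_Lp_ge0// /itg /Rintegral.
have -> : (\int[mu]_(x in `[0%R, L]) (f x ^+ 2)%:E = \int[mu]_(x in `[0%R, L]) (`|f x| `^ 2)%:E)%E.
  by apply: eq_integral => x _; rewrite powR_mulrn// real_normK// num_real.
by rewrite -E.
Qed.

Lemma smooth_deriv1 phi n : smooth phi -> deriv1 (derive1n n phi) (derive1n n.+1 phi).
Proof.
move=> sp x; rewrite derive1nS; apply: DeriveDef; first exact: sp.
by rewrite derive1E.
Qed.

Lemma smooth_continuous phi n : smooth phi -> continuous (derive1n n phi).
Proof. by move=> sp; exact: deriv1_continuous (smooth_deriv1 n sp). Qed.

Lemma deriv1_unique f g h : deriv1 f g -> deriv1 f h -> g = h.
Proof. by move=> /deriv1E <- /deriv1E <-. Qed.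

Lemma deriv1_periodic f g : deriv1 f g -> periodic f L -> periodic g L.
Proof.
move=> fg pf; have : deriv1 f (fun x => g (x + L)).
  apply: (@deriv1_eqf _ (fun x => f (x + L))) => //.
  apply: deriv1_eq; first apply: (deriv1_comp fg (deriv1D deriv1_id (deriv1_cst L))).
  by move=> x; rewrite addr0 mulr1.
by move=> /(deriv1_unique fg) E x; rewrite [in RHS]E.
Qed.

Lemma smooth_periodic phi n : smooth phi -> periodic phi L -> periodic (derive1n n phi) L.
Proof.
move=> sp pp; elim: n => // n IH.
exact: deriv1_periodic (smooth_deriv1 n sp) IH.
Qed.

Lemma periodic0L f : periodic f L -> f 0 = f L.
Proof. by move=> /(_ 0); rewrite add0r. Qed.

Lemma derive1n_tp k n a b : exists a' b', derive1n k (tp L n a b) = tp L n a' b'.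
Proof.
elim: k => [|k [a' [b' IH]]]; first by exists a, b.
exists (dcos L a' b'), (dsin L a' b').
by rewrite derive1nS IH (deriv1E (deriv1_tp L n a' b')).
Qed.

Lemma tp_smooth n a b : smooth (tp L n a b).
Proof.
move=> k x; have [a' [b' ->]] := derive1n_tp k n a b.
exact: deriv1_derivable (deriv1_tp L n a' b').
Qed.

Lemma tp_periodic n a b : periodic (tp L n a b) L.
Proof. by move=> x; exact: tp_period. Qed.

Lemma continuous_Lp1 f : continuous f -> periodic f L -> Lp L 1 f.
Proof.
move=> cf pf; apply/Lp1P; split => //; last exact: intg_continuous.
exact: continuous_measurable_fun.
Qed.

Lemma continuous_Lp2 f : continuous f -> periodic f L -> Lp L 2 f.
Proof.
move=> cf pf; apply/Lp2P; split => //; first exact: continuous_measurable_fun.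
by apply: intg_continuous; exact: contX.
Qed.

Lemma itg_ibp f f1 g g1 : deriv1 f f1 -> deriv1 g g1 -> continuous f1 -> continuous g1 ->
  f 0 = f L -> g 0 = g L -> itg (fun x => f x * g1 x) = - itg (fun x => f1 x * g x).
Proof.
move=> df dg cf1 cg1 pf pg.
have cf := deriv1_continuous df; have cg := deriv1_continuous dg.
apply/eqP; rewrite -subr_eq0 opprK -itgD; [|by apply: intg_continuous; exact: contM|
  by apply: intg_continuous; exact: contM].
apply/eqP/(itg_periodic0 L0 (f := fun x => f x * g x)).
- by apply: deriv1_eq; [exact: (deriv1M df dg)|move=> x; rewrite addrC].
- by apply: contD; exact: contM.
- by rewrite pf pg.
Qed.

Lemma smooth_weak_deriv f j : smooth f -> periodic f L ->
  is_weak_deriv L j f (derive1n j f).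
Proof.
move=> sf pf; split.
- by apply: continuous_Lp1 => //; exact: (@smooth_continuous f 0).
- by apply: continuous_Lp1; [exact: smooth_continuous|exact: smooth_periodic].
- move=> phi sp pp.
  suff H i : (i <= j)%N -> itg (fun x => f x * derive1n j phi x) =
      (-1) ^+ i * itg (fun x => derive1n i f x * derive1n (j - i) phi x).
    by have := H j (leqnn _); rewrite subnn.
  elim: i => [|i IH] ij; first by rewrite expr0 mul1r subn0.
  rewrite IH; last exact: ltnW.
  rewrite exprS mulN1r mulNr -mulrN; congr (_ * _).
  have -> : (j - i = (j - i.+1).+1)%N by rewrite subnSK.
  apply: itg_ibp; try exact: smooth_deriv1; try exact: smooth_continuous.
  - by apply: periodic0L; exact: smooth_periodic.
  - by apply: periodic0L; exact: smooth_periodic.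
Qed.

Lemma smooth_H2 f : smooth f -> periodic f L -> H2 L f.
Proof.
move=> sf pf; split.
  by apply: continuous_Lp2 => //; exact: (@smooth_continuous f 0).
move=> j _; exists (derive1n j f); first exact: smooth_weak_deriv.
by apply: continuous_Lp2; [exact: smooth_continuous|exact: smooth_periodic].
Qed.

Lemma tp_H2 n a b : H2 L (tp L n a b).
Proof. by apply: smooth_H2; [exact: tp_smooth|exact: tp_periodic]. Qed.

Lemma cst_smooth (c : R) : smooth (fun=> c : R).
Proof.
move=> k x; suff [d ->] : exists d : R, derive1n k (fun=> c : R) = (fun=> d).
  exact: deriv1_derivable (deriv1_cst d).
elim: k => [|k [d IH]]; first by exists c.
by exists 0; rewrite derive1nS IH (deriv1E (deriv1_cst d)).
Qed.

Lemma cst_periodic (c : R) : periodic (fun=> c : R) L.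
Proof. by []. Qed.

Lemma cst_H2 (c : R) : H2 L (fun=> c).
Proof. by apply: smooth_H2; [exact: cst_smooth|exact: cst_periodic]. Qed.

Lemma cosl_tp j : (fun x => cos (j%:R * freq * x)) =
  tp L j.+1 (fun i => (i == j)%:R) (fun=> 0).
Proof.
apply/funext => x; rewrite /tp big_ord_recr/= /tpterm eqxx mul1r mul0r addr0.
rewrite big1 ?add0r// => i _.
by rewrite [(_ == _ :> nat)]ltn_eqF ?mul0r ?addr0.
Qed.

Lemma sinl_tp j : (fun x => sin (j%:R * freq * x)) =
  tp L j.+1 (fun=> 0) (fun i => (i == j)%:R).
Proof.
apply/funext => x; rewrite /tp big_ord_recr/= /tpterm eqxx mul1r mul0r add0r.
rewrite big1 ?add0r// => i _.
by rewrite [(_ == _ :> nat)]ltn_eqF ?mul0r ?addr0.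
Qed.

Lemma derive1n2_cosl (c : R) :
  derive1n 2 (fun x : R => cos (c * x)) = (fun x => - c ^+ 2 * cos (c * x)).
Proof.
rewrite !derive1nS derive1n0 (deriv1E (deriv1_cosl c)) (deriv1E (deriv1Z _ (deriv1_sinl c))).
by apply/funext => x; ring.
Qed.

Lemma derive1n2_sinl (c : R) :
  derive1n 2 (fun x : R => sin (c * x)) = (fun x => - c ^+ 2 * sin (c * x)).
Proof.
rewrite !derive1nS derive1n0 (deriv1E (deriv1_sinl c)) (deriv1E (deriv1Z _ (deriv1_cosl c))).
by apply/funext => x; ring.
Qed.

Lemma weak_deriv2_coscoef f g j : is_weak_deriv L 2 f g ->
  coscoef L g j = - (j%:R * freq) ^+ 2 * coscoef L f j.
Proof.
move=> [/Lp1P[_ _ fi] /Lp1P[_ _ gi] /(_ (fun x => cos (j%:R * freq * x)))].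
rewrite {1 2}cosl_tp => /(_ (@tp_smooth _ _ _) (@tp_periodic _ _ _)).
rewrite derive1n2_cosl sqrrN expr1n mul1r => E.
rewrite -[LHS]E /coscoef -itgZ; last exact: intg_mul_cosl.
by apply: eq_itg => x _; ring.
Qed.

Lemma weak_deriv2_sincoef f g j : is_weak_deriv L 2 f g ->
  sincoef L g j = - (j%:R * freq) ^+ 2 * sincoef L f j.
Proof.
move=> [/Lp1P[_ _ fi] /Lp1P[_ _ gi] /(_ (fun x => sin (j%:R * freq * x)))].
rewrite {1 2}sinl_tp => /(_ (@tp_smooth _ _ _) (@tp_periodic _ _ _)).
rewrite derive1n2_sinl sqrrN expr1n mul1r => E.
rewrite -[LHS]E /sincoef -itgZ; last exact: intg_mul_sinl.
by apply: eq_itg => x _; ring.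
Qed.

Definition ae_eq0L f g := {ae mu, forall x, x \in `[0, L] -> f x = g x}.

Lemma coef_eq f g : intg f -> intg g -> (forall j, coscoef L f j = coscoef L g j) ->
  (forall j, sincoef L f j = sincoef L g j) -> ae_eq0L f g.
Proof.
move=> fi gi hc hs.
have := @coef_eq0 R L L0 (fun x => f x - g x) (intgB fi gi) _ _.
move=> H; refine (ae_mono (H _ _) _).
- move=> j; rewrite -[RHS](subrr (coscoef L g j)) -{1}hc /coscoef -itgB; try exact: intg_mul_cosl.
  by apply: eq_itg => x _; rewrite mulrBl.
- move=> j; rewrite -[RHS](subrr (sincoef L g j)) -{1}hs /sincoef -itgB; try exact: intg_mul_sinl.
  by apply: eq_itg => x _; rewrite mulrBl.
- by move=> x E /E /eqP; rewrite subr_eq0 => /eqP.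
Qed.

(** Cosines and sines are admissible test functions, so the two derivatives share their Fourier
    coefficients. *)
Lemma weak_deriv_unique k f g g' : is_weak_deriv L k f g -> is_weak_deriv L k f g' ->
  ae_eq0L g g'.
Proof.
move=> [_ /Lp1P[_ _ gi] H] [_ /Lp1P[_ _ gi'] H'].
have E phi : smooth phi -> periodic phi L -> itg (fun x => g x * phi x) = itg (fun x => g' x * phi x).
  move=> sp pp; have := H phi sp pp; rewrite (H' phi sp pp) => e.
  by apply: (@mulfI _ ((-1) ^+ k)); [rewrite expf_neq0 ?oppr_eq0 ?oner_neq0|].
apply: coef_eq => // j; rewrite /coscoef/sincoef; apply: E.
- by rewrite cosl_tp; exact: tp_smooth.
- by rewrite cosl_tp; exact: tp_periodic.
- by rewrite sinl_tp; exact: tp_smooth.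
- by rewrite sinl_tp; exact: tp_periodic.
Qed.

Lemma wderivP k f g : is_weak_deriv L k f g -> is_weak_deriv L k f (wderiv L k f).
Proof. by move=> H; rewrite /wderiv; exact: (xgetPex _ (ex_intro _ g H)). Qed.

Lemma ae_eq0L_itg f g : intg f -> measurable_fun `[0, L] g -> ae_eq0L f g ->
  intg g /\ itg f = itg g.
Proof. by move=> fi mg fg; apply: ae_eq_itg. Qed.

Lemma ae_eq0L_itgE f g : intg f -> intg g -> ae_eq0L f g -> itg f = itg g.
Proof. by move=> fi gi fg; have [] := ae_eq0L_itg fi (intg_meas gi) fg. Qed.

(** The derivative chosen by [wderiv] need not be the square-integrable one that the carrier
    provides, but it equals it a.e. *)
Lemma H2_wderiv2 y : H2 L y -> is_weak_deriv L 2 y (wderiv L 2 y) /\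
  [/\ intg y, intg (wderiv L 2 y) & intg (fun x => wderiv L 2 y x ^+ 2)].
Proof.
move=> [/Lp2P[py my y2] /(_ 2 (leqnn _))[g wg /Lp2P[pg mg g2]]].
have W := wderivP wg; have [/Lp1P[_ _ iy] /Lp1P[_ mw iw] _] := W.
do 2 split => //.
have := @ae_eq0L_itg (fun x => g x ^+ 2) (fun x => wderiv L 2 y x ^+ 2) g2 _ _.
case=> //.
- by apply: measurable_funX; exact: measurable_funTS.
- by refine (ae_mono (weak_deriv_unique wg W) _) => x H /H ->.
Qed.

(** A weak derivative prescribes Fourier coefficients, and between trigonometric polynomials this is
    classical differentiation. *)
Lemma conv_weak_deriv2 k f g : is_weak_deriv L 2 f g ->
  exists2 v, deriv1 (conv k f) v & deriv1 v (conv k g) /\ v 0 = v L.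
Proof.
move=> W; have [/Lp1P[_ _ fi] /Lp1P[_ _ gi] _] := W.
have [n [b E]] := conv_tp L0 k; rewrite !E//.
eexists; [exact: deriv1_tp|split; last by rewrite tp_0L].
apply: deriv1_eq; first exact: deriv1_tp.
move=> x; rewrite tp_lapl; apply: eq_bigr => j _; rewrite /lapl.
rewrite (weak_deriv2_coscoef j W) (weak_deriv2_sincoef j W).
by congr (tpterm _ _ _ _ _); ring.
Qed.

Lemma conv_ae k f g : intg f -> intg g -> ae_eq0L f g -> conv k f = conv k g.
Proof.
move=> fi gi fg; apply/funext => x; apply: ae_eq0L_itgE; try exact: intg_conv_arg.
by refine (ae_mono fg _) => z H /H ->.
Qed.

Lemma prim_lipschitz f (C x z : R) : intg f -> (forall t, t \in `[0, L] -> `|f t| <= C) ->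
  x \in `[0, L] -> z \in `[0, L] -> `|prim f x - prim f z| <= C * `|x - z|.
Proof.
move=> fi fC.
wlog xz : x z / x <= z => [H|] xI zI.
  have [|/ltW] := leP x z; first by move=> /H; exact.
  by rewrite distrC (distrC x) => /H; exact.
have := xI; have := zI; rewrite !in_itv/= => /andP[z0 zL] /andP[x0 xL].
rewrite !(@itg_cutoff R L f)// -itgB; [|exact: intg_indicM|exact: intg_indicM].
rewrite distrC (@ger0_norm _ (z - x)) ?subr_ge0// -(itg_indic x0 xz zL) -itgZ; last exact: intg_indic.
apply: (le_trans (itg_norm _)); first by apply: intgB; exact: intg_indicM.
apply: itg_le.
- by apply: intg_norm; apply: intgB; exact: intg_indicM.
- by apply: intgZ; exact: intg_indic.
- move=> t tI; rewrite -mulrBr normrM; have Ct := fC t tI.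
  apply: ler_pM => //.
  move: tI; rewrite !indicE in_itv/= => /andP[t0 _].
  rewrite (_ : (t \in `[0, x]%classic) = (t <= x)); last first.
    by apply/idP/idP; rewrite inE/= in_itv/= t0.
  rewrite (_ : (t \in `[0, z]%classic) = (t <= z)); last first.
    by apply/idP/idP; rewrite inE/= in_itv/= t0.
  rewrite (_ : (t \in `[x, z]%classic) = (x <= t <= z)); last first.
    by apply/idP/idP; rewrite inE/= in_itv/=.
  case: (leP t x) => tx; case: (leP t z) => tz; case: (leP x t) => xt //=;
    rewrite ?subrr ?normr0 ?subr0 ?sub0r ?normrN ?normr1//.
  by move: (le_lt_trans xz tz); rewrite ltNge tx.
  by move: (le_lt_trans xz tz); rewrite ltNge tx.
  by move: (lt_trans tx xt); rewrite ltxx.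
Qed.

(** A Sobolev embedding: [g] is integrated twice and the result has the same Fourier coefficients as
    [y]. Testing with a constant gives [g] mean zero, so the first primitive is periodic and
    bounded, and the second one is Lipschitz. *)
Lemma weak_deriv2_repr y g : is_weak_deriv L 2 y g ->
  exists C w, [/\ 0 <= C, lipschitz_per L C w, measurable_fun `[0, L] w & ae_eq0L y w].
Proof.
move=> W; have [/Lp1P[_ _ yi] /Lp1P[_ _ gi] _] := W.
have g0 : itg g = 0.
  have := weak_deriv2_coscoef 0 W; rewrite mul0r expr0n oppr0 mul0r => E.
  by rewrite -[RHS]E; apply: eq_itg => x _; rewrite !mul0r cos0 mulr1.
pose G := prim g; have Gc := prim_within L0 gi.
have Gi : intg G by exact: within_intg.
(* Subtracting the mean makes the second primitive periodic and only affects the mode j = 0. *)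
pose c := itg G / L.
pose G' x := G x - c.
have G'i : intg G' by apply: intgB => //; exact: intg_cst.
have G'0 : itg G' = 0.
  by rewrite itgB//; [rewrite itg_cst// divfK ?subrr// gt_eqF|exact: intg_cst].
pose psi := prim G'.
have psii : intg psi by apply: within_intg => //; exact: prim_within.
have prim_cos f (j : nat) : intg f -> itg f = 0 ->
    j%:R * freq * coscoef L (prim f) j = - sincoef L f j.
  move=> fi f0; have := prim_ibp L0 fi (deriv1_sinl (j%:R * freq))
    (contZ (deriv1_continuous (deriv1_cosl _))).
  rewrite f0 mul0r sub0r => <-.
  rewrite /coscoef -itgZ; last by apply: intg_mul_cosl => //; apply: within_intg => //; exact: prim_within.
  by apply: eq_itg => x _; ring.
have prim_sin f (j : nat) : intg f -> itg f = 0 ->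
    j%:R * freq * sincoef L (prim f) j = coscoef L f j.
  move=> fi f0; have := prim_ibp L0 fi (deriv1_cosl (j%:R * freq))
    (contZ (deriv1_continuous (deriv1_sinl _))).
  rewrite f0 mul0r sub0r /coscoef => /eqP; rewrite -eqr_oppLR => /eqP <-.
  rewrite -itgN; last first.
    apply: intgMc => //; first by apply: within_intg => //; exact: prim_within.
    by apply: contZ; exact: (deriv1_continuous (deriv1_sinl _)).
  rewrite /sincoef -itgZ; last by apply: intg_mul_sinl => //; apply: within_intg => //; exact: prim_within.
  by apply: eq_itg => x _; ring.
have cst_cos (j : nat) : j != 0%N -> coscoef L (fun=> c) j = 0.
  move=> /negbTE j0; have := itg_tpterm L0 c 0 j; rewrite j0 => E; rewrite -[RHS]E.
  by apply: eq_itg => x _; rewrite /tpterm mul0r addr0.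
have cst_sin (j : nat) : j != 0%N -> sincoef L (fun=> c) j = 0.
  move=> /negbTE j0; have := itg_tpterm L0 0 c j; rewrite j0 => E; rewrite -[RHS]E.
  by apply: eq_itg => x _; rewrite /tpterm mul0r add0r.
have cosG' (j : nat) : j != 0%N -> coscoef L G' j = coscoef L G j.
  move=> j0; rewrite -[RHS]subr0 -(cst_cos j j0) /coscoef -itgB; try by apply: intg_mul_cosl => //; exact: intg_cst.
  by apply: eq_itg => x _; rewrite mulrBl.
have sinG' (j : nat) : j != 0%N -> sincoef L G' j = sincoef L G j.
  move=> j0; rewrite -[RHS]subr0 -(cst_sin j j0) /sincoef -itgB; try by apply: intg_mul_sinl => //; exact: intg_cst.
  by apply: eq_itg => x _; rewrite mulrBl.
have jw (j : nat) : j != 0%N -> j%:R * freq != 0.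
  by move=> j0; rewrite mulf_neq0 ?pnatr_eq0// gt_eqF// freq_gt0.
have psicos (j : nat) : j != 0%N -> coscoef L psi j = coscoef L y j.
  move=> j0; apply: (mulfI (expf_neq0 2 (jw j j0))); rewrite expr2 -[LHS]mulrA -[RHS]mulrA.
  rewrite (prim_cos G')// mulrN sinG'// prim_sin//.
  by rewrite (weak_deriv2_coscoef j W); ring.
have psisin (j : nat) : j != 0%N -> sincoef L psi j = sincoef L y j.
  move=> j0; apply: (mulfI (expf_neq0 2 (jw j j0))); rewrite expr2 -[LHS]mulrA -[RHS]mulrA.
  rewrite (prim_sin G')// cosG'// prim_cos//.
  by rewrite (weak_deriv2_sincoef j W); ring.
(* The second primitive matches all modes j > 0; this constant adjusts the mean. *)
pose d := (coscoef L y 0 - coscoef L psi 0) / L.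
have GB x : x \in `[0, L] -> `|G' x| <= itg (fun t => `|g t|) + `|c|.
  rewrite in_itv/= => /andP[x0 xL]; rewrite (le_trans (ler_normB _ _))// lerD2r.
  have z0 : prim (fun=> 0 : R) x = 0 by rewrite /prim Rintegral_cst// mul0r.
  have := primB_le x0 xL gi (intg_cst L 0); rewrite z0 subr0 => H; apply: (le_trans H).
  by rewrite le_eqVlt; apply/orP; left; apply/eqP; apply: eq_itg => t _; rewrite subr0.
exists (itg (fun t => `|g t|) + `|c|), (fun x => psi x + d); split.
- by rewrite addr_ge0//; apply: itg_ge0 => t _.
- split; first by rewrite /psi prim0 primL G'0.
  move=> x z xI zI; rewrite opprD addrACA subrr addr0.
  exact: prim_lipschitz.
- by apply: intg_meas; apply: intgD => //; exact: intg_cst.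
- have cE (j : nat) : coscoef L (fun x => psi x + d) j = coscoef L psi j + coscoef L (fun=> d) j.
    rewrite /coscoef -itgD; try by apply: intg_mul_cosl => //; exact: intg_cst.
    by apply: eq_itg => x _; rewrite mulrDl.
  have sE (j : nat) : sincoef L (fun x => psi x + d) j = sincoef L psi j + sincoef L (fun=> d) j.
    rewrite /sincoef -itgD; try by apply: intg_mul_sinl => //; exact: intg_cst.
    by apply: eq_itg => x _; rewrite mulrDl.
  apply: coef_eq => //; first by apply: intgD => //; exact: intg_cst.
  + move=> j; rewrite cE; have := itg_tpterm L0 d 0 j; case: eqP => [-> E|/eqP j0 E].
      rewrite (_ : coscoef L (fun=> d) 0 = d * L); last first.
        by rewrite -[RHS]E; apply: eq_itg => x _; rewrite /tpterm; ring.
      by rewrite /d divfK ?gt_eqF// addrC subrK.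
    rewrite (_ : coscoef L (fun=> d) j = 0); last first.
      by rewrite -[RHS]E; apply: eq_itg => x _; rewrite /tpterm; ring.
    by rewrite addr0 psicos.
  + move=> j; rewrite sE; have := itg_tpterm L0 0 d j; case: eqP => [-> E|/eqP j0 E].
      have s0 h : sincoef L h 0 = 0.
        rewrite -[RHS](mul0r L) -(itg_cst L0); apply: eq_itg => x _.
        by rewrite !mul0r sin0 mulr0.
      by rewrite !s0 addr0.
    rewrite (_ : sincoef L (fun=> d) j = 0); last first.
      by rewrite -[RHS]E; apply: eq_itg => x _; rewrite /tpterm; ring.
    by rewrite addr0 psisin.
Qed.

End Sobolev.

(** * Entropy decay of the implicit scheme *)

Section Dissipation.
Context {R : realType}.
Variable L : R.
Hypothesis L0 : 0 < L.
Implicit Types (f g h y w : R -> R).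
Local Notation mu := (@lebesgue_measure R).
Local Notation intg := (intg L).
Local Notation itg := (itg L).
Local Notation freq := (freq L).
Local Notation conv := (conv L).
Local Notation ae_eq0L := (ae_eq0L L).

Lemma ae_eq0L_sym f g : ae_eq0L f g -> ae_eq0L g f.
Proof. by move=> fg; refine (ae_mono fg _) => x H /H. Qed.

Lemma ae_eq0L_comp (F : R -> R -> R) f g h : ae_eq0L f g ->
  ae_eq0L (fun x => F (f x) (h x)) (fun x => F (g x) (h x)).
Proof. by move=> fg; refine (ae_mono fg _) => x H /H ->. Qed.

Lemma expR_lip (B a b : R) : a <= B -> b <= B -> `|expR a - expR b| <= expR B * `|a - b|.
Proof.
wlog ab : a b / b <= a => [H aB bB|aB bB].
  have [|/ltW] := leP b a; first by move=> /H; exact.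
  by rewrite distrC (distrC a) => /H; exact.
rewrite !ger0_norm ?subr_ge0 ?ler_expR//.
have : expR a * (1 + (b - a)) <= expR b.
  have -> : expR b = expR a * expR (b - a) by rewrite -expRD addrC subrK.
  by rewrite ler_wpM2l ?expR_ge0// expR_ge1Dx.
have : expR a * (a - b) <= expR B * (a - b).
  by rewrite ler_wpM2r ?subr_ge0// ler_expR.
lra.
Qed.

Lemma lipschitz_per_expR C (B : R) w : 0 <= C -> lipschitz_per L C w ->
  (forall x, x \in `[0, L] -> `|w x| <= B) -> lipschitz_per L (expR B * C) (fun x => expR (w x)).
Proof.
move=> C0 [w0 wl] wB; split; first by rewrite w0.
move=> x z xI zI; apply: (le_trans (expR_lip (B := B) _ _)).
- by rewrite (le_trans (ler_norm _))// wB.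
- by rewrite (le_trans (ler_norm _))// wB.
- by rewrite -mulrA ler_wpM2l ?expR_ge0// wl.
Qed.

Lemma conv_bound k w (B x : R) : intg w -> (forall z, z \in `[0, L] -> `|w z| <= B) ->
  `|conv k w x| <= B.
Proof.
move=> wi wB; rewrite ler_norml; apply/andP; split.
- rewrite -[leLHS](conv_cst L0 k (- B) x); apply: conv_le => //; first exact: intg_cst.
  by move=> z /wB; rewrite ler_norml => /andP[].
- rewrite -[leRHS](conv_cst L0 k B x); apply: conv_le => //; first exact: intg_cst.
  by move=> z /wB; rewrite ler_norml => /andP[].
Qed.

Lemma measurable_expR_comp w : measurable_fun `[0, L] w -> measurable_fun `[0, L] (fun x => expR (w x)).
Proof. by move=> mw; apply: measurableT_comp mw; exact: measurable_expR. Qed.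

Lemma conv_lipschitz_per_cvg C w x : 0 <= C -> lipschitz_per L C w -> measurable_fun `[0, L] w ->
  x \in `[0, L] -> conv k w x @[k --> \oo] --> w x.
Proof.
move=> C0 wl mw xI; apply/cvgrPdist_le => e e0.
have [K HK] := conv_lipschitz_per L0 C0 wl mw e0.
by exists K => // k /= /HK/(_ x xI); rewrite distrC.
Qed.

(** The smooth estimate is applied to v = [conv k w]. Since [g] is merely square integrable, (conv
    g)^2 is not controlled pointwise: Jensen's inequality replaces it by conv (g^2), and
    self-adjointness moves the kernel onto e^w, which converges uniformly. *)
Lemma H2_dissipation_aux w g (C m : R) : 0 <= C -> lipschitz_per L C w -> measurable_fun `[0, L] w ->
  intg g -> intg (fun x => g x ^+ 2) ->
  (forall k, exists2 v, deriv1 (conv k w) v & deriv1 v (conv k g) /\ v 0 = v L) ->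
  itg (fun x => expR (w x)) = m * L ->
  2 * freq ^+ 4 * (itg (fun x => expR (w x) * w x) - L * (m * ln m)) <=
  itg (fun x => expR (w x) * g x ^+ 2).
Proof.
move=> C0 wl mw ig ig2 dv em.
set B := `|w 0| + C * L.
have wB : forall x, x \in `[0, L] -> `|w x| <= B := lipschitz_per_bounded L0 C0 wl.
have iw : intg w := intg_bounded L0 mw wB.
have B0 : 0 <= B by rewrite addr_ge0// mulr_ge0// ltW.
have mew := measurable_expR_comp mw.
have ewB x : x \in `[0, L] -> `|expR (w x)| <= expR B.
  by move=> xI; rewrite ger0_norm ?expR_ge0// ler_expR (le_trans (ler_norm _))// wB.
have iew : intg (fun x => expR (w x)) := intg_bounded L0 mew ewB.
have m0 : 0 < m.
  rewrite -(pmulr_lgt0 m L0) -em; apply: lt_le_trans (_ : expR (- B) * L <= _).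
    by rewrite mulr_gt0 ?expR_gt0.
  rewrite -(itg_cst L0); apply: itg_le => //; first exact: intg_cst.
  by move=> x xI; rewrite ler_expR; have := wB x xI; rewrite ler_norml => /andP[].
pose v k := conv k w.
have vB k x : `|v k x| <= B by exact: conv_bound.
have cv k : continuous (v k) by exact: conv_continuous.
have evB k x : `|expR (v k x)| <= expR B.
  by rewrite ger0_norm ?expR_ge0// ler_expR (le_trans (ler_norm _)).
have cev k : continuous (fun x => expR (v k x)) by exact: cont_expR.
have vc x : x \in `[0, L] -> v k x @[k --> \oo] --> w x by exact: conv_lipschitz_per_cvg wl mw.
have evc x : x \in `[0, L] -> expR (v k x) @[k --> \oo] --> expR (w x).
  by move=> xI; exact: (cvg_comp _ _ (vc x xI) (@continuous_expR R (w x))).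
(* Convolving the logarithm does not preserve the mass of the exponential, so the mean varies with k
   and is recovered in the limit. *)
pose mk k := itg (fun x => expR (v k x)) / L.
have mkc : mk k @[k --> \oo] --> m.
  have -> : m = itg (fun x => expR (w x)) / L by rewrite em mulfK// gt_eqF.
  apply: cvgM; last exact: cvg_cst.
  apply: (itg_dominated (g := fun=> expR B)) => //.
  - by move=> k; exact: intg_continuous.
  - exact: intg_cst.
  - by apply: aeW => x; exact: evc.
have ivv k : intg (fun x => expR (v k x) * v k x) by apply: intg_continuous; exact: contM.
have iww : intg (fun x => expR (w x) * w x) by apply: (intgM iew mw wB).
have Hc : itg (fun x => expR (v k x) * v k x) @[k --> \oo] --> itg (fun x => expR (w x) * w x).
  apply: (itg_dominated (g := fun=> expR B * B)) => //.
  - exact: intg_cst.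
  - by move=> k x _; rewrite normrM ler_pM.
  - by apply: aeW => x xI; apply: cvgM; [exact: evc|exact: vc].
have lhs : 2 * freq ^+ 4 * (itg (fun x => expR (v k x) * v k x) - L * (mk k * ln (mk k)))
   @[k --> \oo] --> 2 * freq ^+ 4 * (itg (fun x => expR (w x) * w x) - L * (m * ln m)).
  apply: cvgM; first exact: cvg_cst.
  apply: cvgB => //; apply: cvgM; first exact: cvg_cst.
  by apply: cvgM => //; exact: (cvg_comp _ _ mkc (continuous_ln m0)).
have iwg : intg (fun x => g x ^+ 2 * expR (w x)) by apply: (intgM ig2 mew ewB).
have rhs : itg (fun x => g x ^+ 2 * conv k (fun z => expR (w z)) x) @[k --> \oo] -->
   itg (fun x => g x ^+ 2 * expR (w x)).
  apply: (itg_dominated (g := fun x => g x ^+ 2 * expR B)) => //.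
  - by move=> k; apply: intgMc => //; exact: conv_continuous.
  - by apply: intgMc => // x; exact: cvg_cst.
  - move=> k x _; rewrite normrM ger0_norm ?sqr_ge0// ler_wpM2l ?sqr_ge0//.
    exact: conv_bound.
  - apply: aeW => x xI; apply: cvgM; first exact: cvg_cst.
    apply: conv_lipschitz_per_cvg (lipschitz_per_expR C0 wl wB) mew xI.
    by rewrite mulr_ge0// expR_ge0.
have -> : itg (fun x => expR (w x) * g x ^+ 2) = itg (fun x => g x ^+ 2 * expR (w x)).
  by apply: eq_itg => x _; rewrite mulrC.
set I := itg (fun x => g x ^+ 2 * expR (w x)).
have I0 : 0 <= I by apply: itg_ge0 => x _; rewrite mulr_ge0 ?sqr_ge0 ?expR_ge0.
apply: (@le_of_approx _ _ _ I) => // e e0 _.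
have e1 : 0 < 1 + e by rewrite addr_gt0.
(* If v is within ln (1 + e) of w, then e^v <= (1 + e) e^w; this exchanges the weights before
   self-adjointness is used. *)
have le0 : 0 < ln (1 + e) by rewrite ln_gt0// ltrDl.
have [K HK] := conv_lipschitz_per L0 C0 wl mw le0.
have -> : I + e * I = (1 + e) * I by rewrite mulrDl mul1r.
have rhs' : (1 + e) * itg (fun x => g x ^+ 2 * conv k (fun z => expR (w z)) x) @[k --> \oo] -->
   (1 + e) * I by apply: cvgM => //; exact: cvg_cst.
apply: (ler_cvg_to lhs rhs').
exists K => // k /= Kk.
have cg : continuous (conv k g) by exact: conv_continuous.
have [v1 dv1 [dv2 v10]] := dv k.
apply: (@le_trans _ _ (itg (fun x => expR (v k x) * conv k g x ^+ 2))).
  apply: (entropy_dissipation_smooth L0 dv1 dv2 cg) => //.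
    have [n [b E]] := conv_tp L0 k.
    by rewrite E// tp_0L.
  by rewrite divfK// gt_eqF.
have ice : intg (fun x => expR (w x) * conv k g x ^+ 2) by apply: intgMc => //; exact: contX.
apply: (@le_trans _ _ ((1 + e) * itg (fun x => expR (w x) * conv k g x ^+ 2))).
  rewrite -itgZ//; apply: itg_le.
  - by apply: intg_continuous; apply: contM => //; exact: contX.
  - exact: intgZ.
  - move=> x xI; rewrite mulrA ler_wpM2r ?sqr_ge0//.
    rewrite -[1 + e]lnK ?posrE// -expRD ler_expR -lerBlDr.
    exact: le_trans (ler_norm _) (HK k Kk x xI).
rewrite ler_pM2l//.
apply: (@le_trans _ _ (itg (fun x => expR (w x) * conv k (fun z => g z ^+ 2) x))).
  apply: itg_le => //.
  - by apply: intgMc => //; exact: conv_continuous.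
  - by move=> x _; rewrite ler_wpM2l ?expR_ge0//; exact: conv_jensen.
by rewrite conv_selfadjoint.
Qed.

Lemma H2_repr y : H2 L y -> exists C w, [/\ 0 <= C, lipschitz_per L C w, measurable_fun `[0, L] w & ae_eq0L y w].
Proof. by move=> /(H2_wderiv2 L0)[W _]; exact: weak_deriv2_repr W. Qed.

Lemma H2_meas y : H2 L y -> periodic y L /\ measurable_fun setT y.
Proof. by move=> [/Lp2P[]]. Qed.

Lemma H2_intgM y h : H2 L y -> intg h -> intg (fun x => h x * y x) /\ intg (fun x => h x * expR (y x)).
Proof.
move=> Hy hi; have [C [w [C0 wl mw yw]]] := H2_repr Hy.
have [_ my] := H2_meas Hy.
have wB := lipschitz_per_bounded L0 C0 wl.
have mh := intg_meas hi.
have myL : measurable_fun `[0, L] y by exact: measurable_funTS.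
split.
- have i1 : intg (fun x => h x * w x) by apply: (intgM hi mw wB).
  apply: (ae_eq0L_itg i1 _ _).1; first exact: measurable_funM.
  exact: (ae_eq0L_comp (fun a b => b * a) h (ae_eq0L_sym yw)).
- have i1 : intg (fun x => h x * expR (w x)).
    apply: (intgM hi (measurable_expR_comp mw) (C := expR (`|w 0| + C * L))) => x xI.
    by rewrite ger0_norm ?expR_ge0// ler_expR (le_trans (ler_norm _))// wB.
  apply: (ae_eq0L_itg i1 _ _).1.
    by apply: measurable_funM => //; exact: measurable_expR_comp.
  exact: (ae_eq0L_comp (fun a b => b * expR a) h (ae_eq0L_sym yw)).
Qed.

Lemma H2_intg_expR y : H2 L y -> intg (fun x => expR (y x)).
Proof.
move=> Hy; have [_] := H2_intgM Hy (intg_cst L 1).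
by under [X in intg X]eq_fun do rewrite mul1r.
Qed.

Theorem H2_dissipation y (m : R) : H2 L y -> itg (fun x => expR (y x)) = m * L ->
  2 * freq ^+ 4 * (itg (fun x => expR (y x) * y x) - L * (m * ln m)) <=
  itg (fun x => expR (y x) * wderiv L 2 y x ^+ 2).
Proof.
move=> Hy em; have [C [w [C0 wl mw yw]]] := H2_repr Hy.
have [W [iy ig ig2]] := H2_wderiv2 L0 Hy.
have iw : intg w := intg_bounded L0 mw (lipschitz_per_bounded L0 C0 wl).
have iey := H2_intg_expR Hy.
have mew := measurable_expR_comp mw.
have wB := lipschitz_per_bounded L0 C0 wl.
have ewB x : x \in `[0, L] -> `|expR (w x)| <= expR (`|w 0| + C * L).
  by move=> xI; rewrite ger0_norm ?expR_ge0// ler_expR (le_trans (ler_norm _))// wB.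
have iew : intg (fun x => expR (w x)) := intg_bounded L0 mew ewB.
have E1 : itg (fun x => expR (y x)) = itg (fun x => expR (w x)).
  by apply: ae_eq0L_itgE => //; exact: (ae_eq0L_comp (fun a _ => expR a) w yw).
have E2 : itg (fun x => expR (y x) * y x) = itg (fun x => expR (w x) * w x).
  apply: ae_eq0L_itgE; [by have [] := H2_intgM Hy iey| |].
    by apply: (intgM iew mw wB).
  exact: (ae_eq0L_comp (fun a _ => expR a * a) w yw).
have E3 : itg (fun x => expR (y x) * wderiv L 2 y x ^+ 2) = itg (fun x => expR (w x) * wderiv L 2 y x ^+ 2).
  apply: ae_eq0L_itgE.
  - have [_ H] := H2_intgM Hy ig2.
    by under [X in intg X]eq_fun do rewrite mulrC.
  - under [X in intg X]eq_fun do rewrite mulrC.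
    exact: (intgM ig2 mew ewB).
  - exact: (ae_eq0L_comp (fun a b => expR a * b ^+ 2) _ yw).
rewrite E2 E3; apply: (H2_dissipation_aux C0 wl) => //; last by rewrite -E1.
by move=> k; rewrite -(conv_ae L0 k iy iw yw); exact: conv_weak_deriv2 W.
Qed.

End Dissipation.

(** * One implicit step and its iteration *)

Section Semidiscrete.
Context {R : realType}.
Variable L : R.
Hypothesis L0 : 0 < L.
Implicit Types (f g h y w : R -> R).
Local Notation mu := (@lebesgue_measure R).
Local Notation intg := (intg L).
Local Notation itg := (itg L).
Local Notation freq := (freq L).

(** This is int f ln (f / m) when f has mass m L; with the constant split off, f is the only
    argument of the logarithm. *)
Definition entropy (m : R) f : R := itg (fun x => f x * ln (f x)) - L * (m * ln m).

Definition rate : R := 2 * freq ^+ 4.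

Lemma rate_gt0 : 0 < rate.
Proof. by rewrite mulr_gt0// exprn_gt0// freq_gt0. Qed.

Lemma rateE : rate = 32 * pi ^+ 4 / L ^+ 4.
Proof.
rewrite /rate freqE; have Ln : L != 0 by rewrite gt_eqF.
by field.
Qed.

Lemma wderiv2_cst (c : R) : ae_eq0L L (wderiv L 2 (fun=> c)) (fun=> 0).
Proof.
have [W _] := H2_wderiv2 L0 (cst_H2 L0 c).
apply: (weak_deriv_unique L0 W).
have := smooth_weak_deriv L0 2 (@cst_smooth R c) (@cst_periodic R L c).
by rewrite !derive1nS derive1n0 !(deriv1E (deriv1_cst _)).
Qed.

(** Testing with 1 conserves the mass, testing with [y] yields the decay. The logarithm of the
    previous density [a] is compared with [y] only by Fenchel-Young, so [a] may vanish, as the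
    initial datum does. *)
Lemma implicit_step (tau m : R) (a y : R -> R) : 0 < tau ->
  intg a -> (forall x, 0 <= a x) -> intg (fun x => a x * ln (a x)) -> itg a = m * L ->
  H2 L y ->
  (forall phi, H2 L phi -> tau^-1 * itg (fun x => (expR (y x) - a x) * phi x) +
    itg (fun x => expR (y x) * wderiv L 2 y x * wderiv L 2 phi x) = 0) ->
  itg (fun x => expR (y x)) = m * L /\
  entropy m (fun x => expR (y x)) * (1 + tau * rate) <= entropy m a.
Proof.
move=> tau0 ia a0 ial am Hy H.
have iey := H2_intg_expR L0 Hy.
have tn : tau^-1 != 0 by rewrite invr_eq0 gt_eqF.
have [W [iy ig ig2]] := H2_wderiv2 L0 Hy.
have em : itg (fun x => expR (y x)) = m * L.
  have := H _ (cst_H2 L0 1).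
  rewrite (_ : itg (fun x => expR (y x) * wderiv L 2 y x * wderiv L 2 (fun=> 1) x) = 0); last first.
    have [_ ieg] := H2_intgM L0 Hy ig.
    have i0 : intg (fun x => expR (y x) * wderiv L 2 y x * 0).
      by under [X in intg X]eq_fun do rewrite mulr0; exact: intg_cst.
    have [W1 [_ i1 _]] := H2_wderiv2 L0 (cst_H2 L0 (1:R)).
    rewrite -[RHS](mul0r L) -(itg_cst L0).
    have m1 : measurable_fun `[0, L] (fun x => expR (y x) * wderiv L 2 y x * wderiv L 2 (fun=> 1) x).
      apply: measurable_funM; last exact: intg_meas i1.
      by apply: measurable_funM; [exact: intg_meas iey|exact: intg_meas ig].
    have [_ <-] := ae_eq0L_itg i0 m1 (ae_eq0L_sym (ae_eq0L_comp
      (fun a b => b * a) (fun x => expR (y x) * wderiv L 2 y x) (wderiv2_cst 1))).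
    by apply: eq_itg => x _; rewrite mulr0.
  rewrite addr0 => /eqP; rewrite mulf_eq0 (negbTE tn)/= => /eqP E.
  rewrite -am; apply/eqP; rewrite -subr_eq0 -itgB//; apply/eqP; rewrite -[RHS]E.
  by apply: eq_itg => x _; rewrite mulr1.
split => //.
have [iay _] := H2_intgM L0 Hy ia.
have [iby _] := H2_intgM L0 Hy iey.
have eE : entropy m (fun x => expR (y x)) = itg (fun x => expR (y x) * y x) - L * (m * ln m).
  by rewrite /entropy; congr (_ - _); apply: eq_itg => x _; rewrite expRK.
have D := H2_dissipation L0 Hy em.
(* Legendre duality, as the masses of a and exp y agree *)
have K : itg (fun x => a x * y x) <= itg (fun x => a x * ln (a x)).
  rewrite -[leRHS]addr0 -(subrr (m * L)) -{1}em -{1}am -itgB// -itgD//; last exact: intgB.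
  apply: itg_le => //; first by apply: intgD => //; exact: intgB.
  by move=> x _; have := ent_lower (y x) (a0 x); lra.
have := H _ Hy.
rewrite (_ : itg (fun x => (expR (y x) - a x) * y x) =
    itg (fun x => expR (y x) * y x) - itg (fun x => a x * y x)); last first.
  by rewrite -itgB//; apply: eq_itg => x _; rewrite mulrBl.
rewrite (_ : itg (fun x => expR (y x) * wderiv L 2 y x * wderiv L 2 y x) =
   itg (fun x => expR (y x) * wderiv L 2 y x ^+ 2)); last first.
  by apply: eq_itg => x _; rewrite expr2 mulrA.
move=> E; rewrite eE /entropy.
move: D E K; rewrite -/rate.
move: (itg _) (itg (fun x => a x * y x)) (itg (fun x => a x * ln (a x))) (itg _) (L * _) => B A Al G Q D E K.
have {}E : G - A = - tau * B.
  have tn' : tau != 0 by rewrite gt_eqF.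
  have -> : B = - (tau^-1 * (G - A)) by lra.
  by field.
have := ler_wpM2l (ltW tau0) D; nra.
Qed.

Lemma semidiscrete_decay (u0 : R -> R) (T m : R) (N : nat) (y : nat -> R -> R) :
  0 < T -> (0 < N)%N -> intg u0 -> (forall x, 0 <= u0 x) -> intg (fun x => u0 x * ln (u0 x)) ->
  itg u0 = m * L -> semidiscrete L u0 T N y ->
  forall k, (k <= N)%N ->
  [/\ intg (exp_iter u0 y k), (forall x, 0 <= exp_iter u0 y k x),
     intg (fun x => exp_iter u0 y k x * ln (exp_iter u0 y k x)),
     itg (exp_iter u0 y k) = m * L &
     entropy m (exp_iter u0 y k) * (1 + T / N%:R * rate) ^+ k <= entropy m u0].
Proof.
move=> T0 N0 iu u00 iul um sd.
have tau0 : 0 < T / N%:R by rewrite divr_gt0// ltr0n.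
have r0 : 0 <= 1 + T / N%:R * rate by rewrite addr_ge0// mulr_ge0// ltW// rate_gt0.
elim=> [|k IH] kN; first by rewrite expr0 mulr1.
have [ia a0 ial am Ea] := IH (ltnW kN).
have [Hy Hs] := sd k kN.
have [em Ee] := implicit_step tau0 ia a0 ial am Hy Hs.
have iey := H2_intg_expR L0 Hy.
split => //=.
- have [H _] := H2_intgM L0 Hy iey.
  by under [X in intg X]eq_fun do rewrite expRK.
- apply: le_trans Ea; rewrite exprS mulrA ler_wpM2r// exprn_ge0//.
Qed.

(** Jensen's inequality, from the tangent line of x ln x at x = m, which is [ent_lower] with g = ln
    m. *)
Lemma entropy_ge0 (m : R) f : 0 < m -> intg f -> (forall x, 0 <= f x) ->
  intg (fun x => f x * ln (f x)) -> itg f = m * L -> 0 <= entropy m f.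
Proof.
move=> m0 fi f0 ifl fm; rewrite /entropy subr_ge0.
have -> : L * (m * ln m) = itg (fun x => ln m * f x + (f x - m)).
  rewrite itgD ?itgZ ?itgB ?itg_cst ?fm//.
  - by ring.
  - exact: intg_cst.
  - exact: intgZ.
  - by apply: intgB => //; exact: intg_cst.
apply: itg_le => //.
  by apply: intgD; [exact: intgZ|apply: intgB => //; exact: intg_cst].
by move=> x _; have := ent_lower (ln m) (f0 x); rewrite lnK ?posrE//; lra.
Qed.

(** From 1 / (1 + a) = 1 - a / (1 + a) <= exp (- a / (1 + a)). The rate is reduced by the factor 1 /
    (1 + a), which tends to 1 with the step size. *)
Lemma geometric_decay (a t : R) (k : nat) : 0 <= a -> t <= k%:R * a ->
  ((1 + a) ^+ k)^-1 <= expR (- (t / (1 + a))).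
Proof.
move=> a0 tk; have a1 : 0 < 1 + a by rewrite ltr_pwDl.
have h : (1 + a)^-1 <= expR (- (a / (1 + a))).
  apply: le_trans (expR_ge1Dx _).
  have an : 1 + a != 0 by rewrite gt_eqF.
  by rewrite le_eqVlt; apply/orP; left; apply/eqP; field.
rewrite -exprVn; apply: (@le_trans _ _ (expR (- (a / (1 + a))) ^+ k)).
  by rewrite lerXn2r// ?nnegrE ?expR_ge0// invr_ge0 ltW.
rewrite -expRM_natl ler_expR mulrN lerN2 mulrA ler_wpM2r// invr_ge0 ltW//.
Qed.

Lemma semidiscrete_entropy_le (u0 : R -> R) (T m s : R) (N : nat) (y : nat -> R -> R) :
  0 < T -> (0 < N)%N -> 0 < m -> intg u0 -> (forall x, 0 <= u0 x) ->
  intg (fun x => u0 x * ln (u0 x)) ->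
  itg u0 = m * L -> semidiscrete L u0 T N y ->
  forall k, (k <= N)%N -> s <= k%:R * (T / N%:R) ->
  entropy m (exp_iter u0 y k) <=
    expR (- (rate * s / (1 + T / N%:R * rate))) * entropy m u0.
Proof.
move=> T0 N0 m0 iu u00 iul um sd k kN sk.
have [_ _ _ _ E] := semidiscrete_decay T0 N0 iu u00 iul um sd kN.
have tau0 : 0 < T / N%:R by rewrite divr_gt0// ltr0n.
have r0 := rate_gt0.
have tr : 0 <= T / N%:R * rate by rewrite mulr_ge0// ltW.
have r1 : 0 < 1 + T / N%:R * rate by rewrite ltr_pwDl.
have U0 := entropy_ge0 m0 iu u00 iul um.
apply: (@le_trans _ _ (((1 + T / N%:R * rate) ^+ k)^-1 * entropy m u0)).
  by rewrite mulrC ler_pdivlMr ?exprn_gt0.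
rewrite ler_wpM2r//; apply: geometric_decay => //.
by rewrite mulrA mulrC ler_pM2r.
Qed.

End Semidiscrete.

(** * Integrability and positive mass of the initial datum *)

Section InitialDatum.
Context {R : realType}.
Variable L : R.
Hypothesis L0 : 0 < L.
Variable u0 : R -> R.
Hypothesis u0_meas : measurable_fun setT u0.
Hypothesis u0_ge0 : forall x, 0 <= u0 x.
Hypothesis u0_log : (@lebesgue_measure R).-integrable `[0, L]
     (fun x => ((u0 x)%:E - lne (u0 x)%:E)%E).
Local Notation mu := (@lebesgue_measure R).

(** Since ln 2 <= 1, ln (a / 2) <= a / 2 - 1 gives ln a <= a / 2. At a = 0 the right-hand side is
    infinite. Hence integrability of u0 - log u0 entails that of u0. *)
Lemma lne_bound (a : R) : 0 <= a -> (`|(a%:E)| <= `|2%:E * (a%:E - lne a%:E)|)%E.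
Proof.
rewrite le_eqVlt => /predU1P[<-|a0].
  by rewrite abse0.
rewrite lne_EFin// -EFinB -EFinM !abse_EFin lee_fin.
have h : ln a <= a / 2.
  have := ln_le_sub1 (divr_gt0 a0 (ltr0Sn R 1)); rewrite ln_div ?posrE//.
  have := ln_le_sub1 (ltr0Sn R 1); lra.
rewrite !ger0_norm; [lra|lra|exact: ltW].
Qed.

Lemma intg_u0 : intg L u0.
Proof.
apply: (le_integrable _ _ _ (integrableZl _ 2 u0_log)) => //.
- by apply/measurable_EFinP; exact: measurable_funTS.
- by move=> x _; exact: lne_bound.
Qed.

(** Zero mass would make u0 vanish a.e., hence - log u0 = +oo a.e., against integrability. The
    contradiction is drawn as 1 = 0 a.e. on [0, L], which forces L = 0. *)
Lemma mass_gt0 : 0 < itg L u0.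
Proof.
rewrite lt_neqAle itg_ge0 ?andbT//; apply/eqP => u00.
have fin : {ae mu, forall x, `[0, L]%classic x -> ((u0 x)%:E - lne (u0 x)%:E)%E \is a fin_num}.
  by apply: integrable_ae u0_log.
have iu := intg_u0.
have z : {ae mu, forall x, `[0, L]%classic x -> (u0 x)%:E = 0%E}.
  have mE : measurable_fun `[0, L] (EFin \o u0) by apply/measurable_EFinP; exact: intg_meas iu.
  have [+ _] := @ae_eq_integral_abs _ _ _ mu `[0, L]%classic (measurable_itv _) _ mE.
  apply; transitivity (itg L u0)%:E; last by rewrite -u00.
  rewrite /itg /Rintegral fineK ?integrable_fin_num//.
  by apply: eq_integral => x _; rewrite /= ger0_norm.
have : itg L (fun=> 1 : R) = itg L (fun=> 0 : R).
  apply: ae_eq0L_itgE; try exact: intg_cst.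
  refine (ae_mono (ae_and fin z) _) => x [h1 h2] xI; exfalso.
  by have [e] := h2 xI; have := h1 xI; rewrite e le0_lneNy.
by rewrite !itg_cst// mul1r mul0r => /eqP; rewrite gt_eqF.
Qed.

End InitialDatum.

(** * Selection of times *)

Section TimeSelection.
Import HBNNSimple.
Context {R : realType}.
Local Notation mu := (@lebesgue_measure R).

(* The norms of LpB integrate functions of time that are not known to be
   measurable; the integral is then still the supremum over the nonnegative
   simple functions below, hence monotone. *)
Lemma le_integral_nonmeasurable (f g : R -> \bar R) :
  (forall x, (0 <= f x)%E) -> (forall x, (f x <= g x)%E) ->
  (\int[mu]_x f x <= \int[mu]_x g x)%E.
Proof.
move=> f0 fg; have g0 x : (0 <= g x)%E by apply: le_trans (fg x).
rewrite !ge0_integralTE//; apply: le_ereal_sup => _ [h /= hf <-].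
by exists h => // x; apply: le_trans (fg x).
Qed.

(** As [G] and [W] may fail to be measurable, the bound is applied to each simple function [h] below
    [G]. Off the null set, max (h - c, 0) / 2 is measurable and lies below [W]; cut off to zero
    elsewhere, it is compared with [W] everywhere. *)
Lemma ae_integral_lty (D : set R) (G W : R -> R) (c : R) : measurable D -> (mu D < +oo)%E ->
  0 <= c -> (forall x, 0 <= G x) -> (forall x, 0 <= W x) ->
  {ae mu, forall x, D x -> G x <= c + 2 * W x} ->
  (\int[mu]_(x in D) (W x)%:E < +oo)%E -> (\int[mu]_(x in D) (G x)%:E < +oo)%E.
Proof.
move=> mD muD c0 G0 W0 [Z [mZ muZ sZ]] IW.
apply: (@le_lt_trans _ _ (c%:E * mu D + 2%:E * \int[mu]_(x in D) (W x)%:E)%E); last first.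
  rewrite lte_add_pinfty//; first by rewrite lte_mul_pinfty.
  by rewrite lte_mul_pinfty.
rewrite [leLHS]integral_mkcond ge0_integralTE; last first.
  by move=> x; rewrite patchE; case: ifP; rewrite ?lee_fin.
apply: ge_ereal_sup => _ [h /= hG <-].
pose hh := (fun x => h x) : R -> R.
have hG' (x : R) : hh x <= (if x \in D then G x else 0).
  by have := hG x; rewrite -/(hh x); rewrite patchE; case: ifP => _; rewrite lee_fin.
rewrite -integralT_nnsfun.
pose k (x : R) : R := (Num.max (hh x - c) 0 / 2) * \1_(D `\` Z) x.
have mhh : measurable_fun setT hh by exact: (measurable_funPT h).
have mk : measurable_fun setT k.
  apply: measurable_funM; last by apply: measurable_indic; exact: measurableD.
  apply: measurable_funM => //; apply: measurable_maxr => //.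
  exact: measurable_funB.
have k0 x : 0 <= k x.
  by rewrite mulr_ge0 ?divr_ge0 ?le_max ?lexx ?orbT// indicE.
have mh : measurable_fun setT (EFin \o h) by apply/measurable_EFinP.
have mc : measurable_fun setT (fun x => (c * \1_D x + 2 * k x)%:E).
  apply/measurable_EFinP; apply: measurable_funD; apply: measurable_funM => //.
apply: (@le_trans _ _ (\int[mu]_x (c * \1_D x + 2 * k x)%:E)%E).
  apply: ae_ge0_le_integral => //.
  - by move=> x _; rewrite lee_fin.
  - by move=> x _; rewrite lee_fin addr_ge0//; apply: mulr_ge0.
  - exists Z; split => // x /= /not_implyP[_].
    apply: contra_notP => nZ; rewrite lee_fin.
    have := hG' x; rewrite !indicE; case: (boolP (x \in D)) => xD hx; last first.
      by rewrite mulr0 add0r (le_trans hx)// mulr_ge0.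
    rewrite /k indicE (_ : x \in D `\` Z); last by rewrite inE; split => //; exact/set_mem.
    rewrite !mulr1 mulrCA divff ?mulr1//.
    by rewrite -lerBlDl le_max lexx.
under eq_integral do rewrite EFinD.
rewrite ge0_integralD//.
- rewrite leeD//.
    under eq_integral do rewrite EFinM.
    rewrite ge0_integralZl//; first by rewrite integral_indic// setIT.
    by apply/measurable_EFinP.
  under eq_integral do rewrite EFinM.
  rewrite ge0_integralZl//; first last.
  + by move=> x _; rewrite lee_fin.
  + exact/measurable_EFinP.
  rewrite lee_pmul2l//; rewrite [leRHS]integral_mkcond.
  apply: le_integral_nonmeasurable => x; first by rewrite lee_fin.
  rewrite patchE; case: (boolP (x \in D)) => xD; last first.
    by rewrite /k indicE (_ : x \in D `\` Z = false) ?mulr0//; apply/negbTE/negP; rewrite inE => -[/mem_set]; rewrite (negbTE xD).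
  rewrite lee_fin /k indicE; case: (boolP (x \in D `\` Z)) => xZ; last by rewrite mulr0.
  rewrite mulr1 ler_pdivrMr// ge_max mulr_ge0// andbT.
  have := hG' x; rewrite xD => hx.
  have /contrapT : ~ ~ (D x -> G x <= c + 2 * W x).
    by move=> /sZ; move: xZ; rewrite inE => -[].
  by move: xD; rewrite inE => xD /(_ xD); lra.
- by move=> x _; rewrite lee_fin mulr_ge0// indicE.
- by apply/measurable_EFinP; apply: measurable_funM.
- by move=> x _; rewrite lee_fin mulr_ge0.
- by apply/measurable_EFinP; apply: measurable_funM.
Qed.

(** Chebyshev's inequality: if [G] were at least e on ]p, q[ off a null set, its integral would be
    at least e (q - p). Any a.e. property can be secured at the same point. *)
Lemma not_ae_ge (p q e T : R) (G : R -> R) : 0 <= p -> p < q -> q <= T -> 0 < e ->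
  (forall x, 0 <= G x) ->
  (\int[mu]_(x in `]0%R, T[) (G x)%:E < (e * (q - p))%:E)%E ->
  forall P : R -> Prop, {ae mu, forall x, x \in `]0, T[ -> P x} ->
  exists2 x, x \in `]p, q[ & P x /\ G x < e.
Proof.
move=> p0 pq qT e0 G0 HI P [Z [mZ muZ sZ]].
apply: contrapT => H; move: HI; apply/negP; rewrite -leNgt.
have HZ x : x \in `]p, q[ -> ~ Z x -> e <= G x.
  move=> xI nZ; rewrite leNgt; apply/negP => Gx.
  have xT : x \in `]0, T[.
    move: xI; rewrite !in_itv/= => /andP[px xq].
    by rewrite (le_lt_trans p0)//= (lt_le_trans xq).
  have /contrapT Px : ~ ~ (x \in `]0, T[ -> P x) by move=> /sZ.
  by apply: H; exists x => //; split => //; exact: Px.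
rewrite [leRHS]integral_mkcond.
apply: (@le_trans _ _ (\int[mu]_x (e * \1_(`]p, q[ `\` Z) x)%:E)%E); last first.
  apply: le_integral_nonmeasurable => x.
    by rewrite lee_fin mulr_ge0 ?(ltW e0)// indicE.
  rewrite indicE; case: (boolP (x \in _)) => [|_]; last first.
    by rewrite mulr0 patchE; case: ifP; rewrite ?lee_fin.
  rewrite inE => -[/= xI nZ]; rewrite mulr1 patchE mem_set ?lee_fin; first exact: HZ.
  move: xI; rewrite /= !in_itv/= => /andP[px xq].
  by rewrite (le_lt_trans p0)//= (lt_le_trans xq).
under eq_integral do rewrite EFinM.
have mI : measurable (`]p, q[%classic `\` Z) by apply: measurableD.
rewrite ge0_integralZl//; first last.
- by rewrite lee_fin ltW.
- by apply/measurable_EFinP.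
rewrite integral_indic// setIT EFinM lee_pmul2l//.
have -> : (q - p)%:E = mu `]p, q[%classic.
  by rewrite lebesgue_measure_itv/= lte_fin pq EFinB.
have sI : `]p, q[%classic `<=` (`]p, q[%classic `\` Z) `|` Z by move=> x xI; case: (pselect (Z x)); [right|left].
apply: (le_trans (le_measure mu _ _ sI)); rewrite ?inE//; first exact: measurableU.
apply: (le_trans (measureU2 mu mI mZ)).
by rewrite [X in (_ + X <= _)%E](_ : _ = 0%E) ?adde0.
Qed.

End TimeSelection.

(** * Square-integrable functions and the step function in time *)

Section Selection.
Context {R : realType}.
Variable L : R.
Hypothesis L0 : 0 < L.
Implicit Types (f g h y w : R -> R).
Local Notation mu := (@lebesgue_measure R).
Local Notation intg := (intg L).
Local Notation itg := (itg L).

Lemma Lp2_intgM f g : Lp L 2 f -> Lp L 2 g -> intg (fun x => f x * g x).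
Proof.
move=> /Lp2P[_ mf f2] /Lp2P[_ mg g2].
apply: (@intg_le _ _ _ (fun x => f x ^+ 2 + g x ^+ 2)).
- by apply: measurable_funM; exact: measurable_funTS.
- exact: intgD.
- move=> x _; rewrite [leRHS]ger0_norm ?addr_ge0 ?sqr_ge0//.
  rewrite normrM -(@real_normK _ (f x)) ?num_real// -(@real_normK _ (g x)) ?num_real//.
  have := sqr_ge0 (`|f x| - `|g x|); have := normr_ge0 (f x); have := normr_ge0 (g x); nra.
Qed.

Lemma itg_cauchy_schwarz f g : Lp L 2 f -> Lp L 2 g ->
  itg (fun x => f x * g x) ^+ 2 <= itg (fun x => f x ^+ 2) * itg (fun x => g x ^+ 2).
Proof.
move=> Hf Hg; have fg := Lp2_intgM Hf Hg.
have /Lp2P[_ _ f2] := Hf; have /Lp2P[_ _ g2] := Hg.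
set A := itg (fun x => f x ^+ 2); set B := itg (fun x => g x ^+ 2); set S := itg _.
have Q (l : R) : 0 <= A - 2 * l * S + l ^+ 2 * B.
  rewrite /A /S /B -!itgZ// -itgB//; last exact: intgZ.
  rewrite -itgD//; [|by apply: intgB => //; exact: intgZ|exact: intgZ].
  apply: itg_ge0 => x _; rewrite (_ : _ + _ = (f x - l * g x) ^+ 2) ?sqr_ge0//; ring.
have A0 : 0 <= A by apply: itg_ge0 => x _; exact: sqr_ge0.
have [B0|B0] : B = 0 \/ 0 < B.
  have : 0 <= B by apply: itg_ge0 => x _; exact: sqr_ge0.
  by rewrite le_eqVlt => /predU1P[<-|]; [left|right].
- have [->|S0] := eqVneq S 0; first by rewrite expr0n/= B0 mulr0.
  (* When B = 0 the quadratic is affine in l, and at this value it would equal -1. *)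
  have := Q ((A + 1) / (2 * S)); rewrite B0 mulr0 addr0.
  rewrite (_ : A - _ = -1) ?oppr_ge0 ?ler10//; by field.
- have := Q (S / B).
  rewrite (_ : A - _ + _ = A - S ^+ 2 / B); last by field; rewrite gt_eqF.
  by rewrite subr_ge0 ler_pdivrMr.
Qed.

Lemma Lp2_sqrB f g : Lp L 2 f -> Lp L 2 g ->
  intg (fun x => (f x - g x) ^+ 2) /\
  itg (fun x => (f x - g x) ^+ 2) <= 2 * itg (fun x => f x ^+ 2) + 2 * itg (fun x => g x ^+ 2).
Proof.
move=> Hf Hg; have fg := Lp2_intgM Hf Hg.
have /Lp2P[_ mf f2] := Hf; have /Lp2P[_ mg g2] := Hg.
have i : intg (fun x => (f x - g x) ^+ 2).
  rewrite (_ : (fun x => _) = (fun x => f x ^+ 2 - 2 * (f x * g x) + g x ^+ 2)).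
    by apply: intgD => //; apply: intgB => //; exact: intgZ.
  by apply/funext => x; ring.
split => //; rewrite -!itgZ// -itgD; [|exact: intgZ|exact: intgZ].
apply: itg_le => //; first by apply: intgD; exact: intgZ.
by move=> x _; have := sqr_ge0 (f x + g x); nra.
Qed.

Lemma Lp2B f g : Lp L 2 f -> Lp L 2 g -> Lp L 2 (f - g).
Proof.
move=> Hf Hg; have [i _] := Lp2_sqrB Hf Hg.
have /Lp2P[pf mf _] := Hf; have /Lp2P[pg mg _] := Hg.
apply/Lp2P; split => //; last exact: measurable_funB.
by move=> x; rewrite /GRing.add/GRing.opp/= pf pg.
Qed.

(** The index is the least k whose interval ends at or after s; since intervals are open on the
    left, a single term of the sum survives. *)
Lemma stepE (V : lmodType R) (T : R) (N : nat) (a : nat -> V) (s : R) :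
  0 < T -> (0 < N)%N -> 0 < s -> s <= T ->
  exists k, [/\ (k < N)%N, s <= k.+1%:R * (T / N%:R) & step T N a s = a k.+1].
Proof.
move=> T0 N0 s0 sT; have tau0 : 0 < T / N%:R by rewrite divr_gt0// ltr0n.
pose P k := (s <= k.+1%:R * (T / N%:R)).
have exP : exists k, P k.
  by exists N.-1; rewrite /P prednK// mulrC divfK// pnatr_eq0 -lt0n.
case: (ex_minnP exP) => k; rewrite {1}/P => Pk kmin; exists k.
have kN : (k < N)%N.
  rewrite -[N in (_ < N)%N]prednK// ltnS; apply: kmin.
  by rewrite /P prednK// mulrC divfK// pnatr_eq0 -lt0n.
split => //; rewrite /step (bigD1 (Ordinal kN))//= big1 ?addr0.
  rewrite indicE mem_set ?scale1r//= in_itv/= Pk andbT.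
  case: k kmin kN Pk => [|k] kmin kN Pk; first by rewrite mul0r.
  by rewrite ltNge; apply/negP => /kmin; rewrite ltnn.
move=> j jk; rewrite indicE memNset ?scale0r//= in_itv/= => /andP[h1 h2].
have jk' : (j : nat) != k by apply: contra jk => /eqP jk; apply/eqP/val_inj.
have := kmin j h2; rewrite leq_eqVlt eq_sym (negbTE jk')/= => kj.
have : j%:R * (T / N%:R) < k.+1%:R * (T / N%:R) by apply: lt_le_trans h1 Pk.
by rewrite ltr_pM2r// ltr_nat ltnS leqNgt kj.
Qed.

End Selection.

Lemma dual_sub (R : realType) (V : lmodType R) (X : nspace V) (F G : V -> R) :
  dual X F -> dual X G -> dual X (F - G).
Proof.
move=> [Fl [C FC]] [Gl [D GD]]; split=> [a v w Xv Xw|].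
  rewrite !(_ : forall x, (F - G) x = F x - G x)// Fl// Gl//; ring.
exists (C + D) => v Xv; rewrite mulrDl; apply: (le_trans (ler_normB _ _)).
by apply: lerD; [exact: FC|exact: GD].
Qed.

(** * Evaluation of functionals controlled by the dual norm *)

Section DualNorm.
Context {R : realType}.
Variable L : R.
Hypothesis L0 : 0 < L.
Implicit Types (f g h y w phi : R -> R).
Local Notation mu := (@lebesgue_measure R).
Local Notation intg := (intg L).
Local Notation itg := (itg L).

Lemma Lp2_scale (c : R) f : Lp L 2 f -> Lp L 2 (c *: f).
Proof.
move=> /Lp2P[pf mf f2]; apply/Lp2P; split.
- by move=> x; rewrite /GRing.scale/= pf.
- by apply: measurable_funM.
- rewrite (_ : (fun x => _) = (fun x => c ^+ 2 * f x ^+ 2)); first exact: intgZ.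
  by apply/funext => x; rewrite -exprMn.
Qed.

Lemma is_weak_deriv_scale k (c : R) f g : is_weak_deriv L k f g -> is_weak_deriv L k (c *: f) (c *: g).
Proof.
have S h : Lp L 1 h -> Lp L 1 (c *: h).
  move=> /Lp1P[ph mh ih]; apply/Lp1P; split; [|exact: measurable_funM|exact: intgZ].
  by move=> x; rewrite /GRing.scale/= ph.
move=> [Hf Hg H]; split; [exact: S|exact: S|] => phi sp pp.
have E h h' : itg (fun x => h x * h' x) = itg (fun x => h' x * h x) by apply: eq_itg => x _; rewrite mulrC.
have Z h q : Lp L 1 h -> continuous q -> itg (fun x => (c *: h) x * q x) = c * itg (fun x => h x * q x).
  move=> /Lp1P[_ _ ih] qc; rewrite -itgZ; last exact: intgMc.
  by apply: eq_itg => x _; rewrite /GRing.scale/= mulrA.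
have := Z _ _ Hf (@smooth_continuous _ phi k sp); rewrite /itg => ->.
have := Z _ _ Hg (@smooth_continuous _ phi 0 sp); rewrite /itg => ->.
by rewrite H// mulrCA.
Qed.

Lemma wderiv_Lp2 k f g : is_weak_deriv L k f g -> Lp L 2 g -> Lp L 2 (wderiv L k f).
Proof.
move=> W /Lp2P[_ _ g2]; have W' := wderivP W.
have [_ /Lp1P[pw mw _] _] := W'; apply/Lp2P; split => //.
have := @ae_eq0L_itg _ L (fun x => g x ^+ 2) (fun x => wderiv L k f x ^+ 2) g2 _ _.
case=> //; first by apply: measurable_funX; exact: measurable_funTS.
by refine (ae_mono (weak_deriv_unique L0 W W') _) => x H /H ->.
Qed.

Definition H2_energy phi : R := \sum_(j < 3) itg (fun x => wderiv L j phi x ^+ 2).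

Lemma snorm_H2 phi : H2 L phi -> snorm (H2 L) phi = H2_energy phi `^ 2^-1.
Proof.
move=> [_ H]; congr (_ `^ _); apply: eq_bigr => j _.
have [g W g2] := H j (ltn_ord j).
by rewrite powR_mulrn ?snorm_Lp_ge0// snorm_Lp2//; exact: wderiv_Lp2 W g2.
Qed.

Lemma H2_scale (c : R) phi : H2 L phi -> H2 L (c *: phi).
Proof.
move=> [H1 H]; split=> [|j jk]; first exact: Lp2_scale.
have [g W g2] := H j jk; exists (c *: g); first exact: is_weak_deriv_scale.
exact: Lp2_scale.
Qed.

Lemma H2_energy_scale (c : R) phi : H2 L phi -> H2_energy (c *: phi) = c ^+ 2 * H2_energy phi.
Proof.
move=> Hp; rewrite /H2_energy mulr_sumr; apply: eq_bigr => j _.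
have [_ /(_ j (ltn_ord j))[g W g2]] := Hp.
have [_ /(_ j (ltn_ord j))[g' W' g2']] := H2_scale c Hp.
have /Lp2P[_ _ i] := wderiv_Lp2 W g2; have /Lp2P[_ _ i'] := wderiv_Lp2 W' g2'.
rewrite -itgZ//; apply: ae_eq0L_itgE => //; first exact: intgZ.
have U := weak_deriv_unique L0 (is_weak_deriv_scale c (wderivP W)) (wderivP W').
by refine (ae_mono U _) => x xU /xU <-; rewrite /GRing.scale/= exprMn.
Qed.

(** The function [phi] is scaled into the unit ball by 1 / (1 + E), where E is its squared norm;
    this works since E <= (1 + E)^2 and avoids dividing by a norm that may vanish. *)
Lemma Hm2_bound phi : H2 L phi ->
  exists2 C : R, 0 < C & forall F, Hm2 L F -> `|F phi| <= C * snorm (Hm2 L) F.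
Proof.
move=> Hp; have E0 : 0 <= H2_energy phi.
  by apply: sumr_ge0 => j _; apply: itg_ge0 => x _; exact: sqr_ge0.
have C0 : 0 < 1 + H2_energy phi by rewrite ltr_pwDl.
exists (1 + H2_energy phi) => // F [Flin [C FC]].
pose c := (1 + H2_energy phi)^-1.
have c0 : 0 < c by rewrite invr_gt0.
have Hc := H2_scale c Hp.
have F0 : F 0 = 0.
  have H0 : H2 L 0 := cst_H2 L0 0.
  have := Flin 1 0 0 H0 H0; rewrite scale1r addr0 mul1r => /eqP.
  by rewrite -subr_eq0 opprD addrA subrr sub0r oppr_eq0 => /eqP.
have Fc : F (c *: phi) = c * F phi.
  by have := Flin c phi 0 Hp (cst_H2 L0 0); rewrite F0 !addr0.
suff : `|F (c *: phi)| <= snorm (Hm2 L) F.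
  by rewrite Fc normrM gtr0_norm// ler_pdivrMl.
apply: (@ub_le_sup _ [set `|F v| | v in [set v | H2 L v /\ snorm (H2 L) v <= 1]]).
  exists `|C| => _ [v [Hv v1] <-]; apply: (le_trans (FC v Hv)).
  have n0 : 0 <= snorm (H2 L) v by exact: powR_ge0.
  apply: (le_trans (ler_wpM2r n0 (ler_norm C))).
  by rewrite ler_piMr.
exists (c *: phi) => //; split => //; rewrite snorm_H2// H2_energy_scale//.
rewrite [leRHS](_ : 1 = 1 `^ 2^-1); last by rewrite powR1.
have h : 0 <= c ^+ 2 * H2_energy phi by rewrite mulr_ge0// sqr_ge0.
apply: ge0_ler_powR; rewrite ?nnegrE// ?invr_ge0//.
rewrite /c exprVn ler_pdivrMl ?exprn_gt0// mulr1; nra.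
Qed.

End DualNorm.

(** * Times at which the scheme is close to its limit *)

Section Selection.
Context {R : realType}.
Variable L : R.
Hypothesis L0 : 0 < L.
Implicit Types (f g h y w phi : R -> R).
Local Notation mu := (@lebesgue_measure R).
Local Notation intg := (intg L).
Local Notation itg := (itg L).

(** Chebyshev in time: convergence in L^2(0,T; L^2) leaves in every subinterval, for large i, a time
    at which the two functions are close in space. The bound [Q] keeps their distance square
    integrable in time. *)
Lemma LpB_select (F : nat -> R -> R -> R) (u : R -> R -> R) (T p q e : R) (P : R -> Prop) :
  (forall i s, 0 < s -> s <= T -> Lp L 2 (F i s)) ->
  (forall i, exists Q, forall s, 0 < s -> s <= T -> itg (fun x => F i s x ^+ 2) <= Q) ->
  strong_cvg (LpB 2 T (Lp L 2)) F u -> 0 <= p -> p < q -> q <= T -> 0 < e ->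
  {ae mu, forall s, s \in `]0, T[ -> P s} ->
  \forall i \near \oo, exists2 s, s \in `]p, q[ &
    [/\ P s, Lp L 2 (u s) & itg (fun x => (F i s x - u s x) ^+ 2) < e].
Proof.
move=> HF HQ [_ [[us [_ ae_u]] Nu] cvgF] p0 pq qT e0 aeP.
have n2 : 2 != 0 :> R by rewrite pnatr_eq0.
have T0 : 0 < T by rewrite (le_lt_trans p0)// (lt_le_trans pq).
pose G i s := `|snorm (Lp L 2) ((F i - u) s)| `^ 2.
have GE i s : 0 < s -> s <= T -> Lp L 2 (u s) -> G i s = itg (fun x => (F i s x - u s x) ^+ 2).
  move=> s0 sT Lu; rewrite /G ger0_norm ?snorm_Lp_ge0// powR_mulrn ?snorm_Lp_ge0//.
  by rewrite snorm_Lp2//; apply: Lp2B => //; exact: HF.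
(* [snorm] sends an infinite norm to 0 through [fine], so a small value only carries information
   once the norm is known to be finite. *)
have Gfin i : (\int[mu]_(s in `]0%R, T[) (G i s)%:E < +oo)%E.
  have [Q HQi] := HQ i.
  apply: (@ae_integral_lty _ _ _ (fun s => `|snorm (Lp L 2) (u s)| `^ 2) `|2 * Q|) => //.
  - by rewrite lebesgue_measure_itv/= lte_fin T0 -EFinB ltry.
  - by move=> s; exact: powR_ge0.
  - refine (ae_mono ae_u _) => s H sI; have [Lu _] := H sI.
    move: sI; rewrite /= in_itv/= => /andP[s0 /ltW sT].
    rewrite GE// (ger0_norm (snorm_Lp_ge0 _ _ (u s))) powR_mulrn ?snorm_Lp_ge0// snorm_Lp2//.
    have [_] := Lp2_sqrB (HF i s s0 sT) Lu; have := HQi s s0 sT; have := ler_norm (2 * Q); lra.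
  - by apply/(Lnorm_lty `]0%R, T[ (fun s => snorm (Lp L 2) (u s)) n2).
pose d := Num.sqrt (e * (q - p)).
have d0 : 0 < d by rewrite sqrtr_gt0 mulr_gt0// subr_gt0.
have aeP' : {ae mu, forall s, s \in `]0, T[ -> P s /\ Lp L 2 (u s)}.
  refine (ae_mono (ae_and aeP ae_u) _) => s [H1 H2 sI].
  by split; [exact: H1|have [] := H2 sI].
move/cvgrPdist_lt: cvgF => /(_ _ d0); apply: filterS => i.
rewrite sub0r normrN => Hi.
have NG : (\int[mu]_(s in `]0%R, T[) (G i s)%:E < (e * (q - p))%:E)%E.
  have := Lnorm_restrict `]0%R, T[ (fun s => snorm (Lp L 2) ((F i - u) s)) n2.
  rewrite -/(G i) => <-.
  have := (Lnorm_lty `]0%R, T[ (fun s => snorm (Lp L 2) ((F i - u) s)) n2).2 (Gfin i).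
  move: Hi; rewrite /LpB/=.
  have := Lnorm_ge0 mu 2%:E (EFin \o ((fun s => snorm (Lp L 2) ((F i - u) s)) \_ `]0, T[)).
  case: (Lnorm mu _ _) => [r| |]//=; rewrite lee_fin => r0 + _.
  rewrite ger0_norm// => rd; rewrite lte_fin powR_mulrn//.
  rewrite -[ltRHS]sqr_sqrtr ?mulr_ge0 ?subr_ge0 ?(ltW pq) ?(ltW e0)//.
  by rewrite ltrXn2r// nnegrE ltW.
have [s sI [[Ps Lu] Gs]] := not_ae_ge p0 pq qT e0 (fun s => powR_ge0 _ _) NG aeP'.
exists s => //; split => //; rewrite -GE//.
- by move: sI; rewrite in_itv/= => /andP[/(le_lt_trans p0)].
- by move: sI; rewrite in_itv/= => /andP[_ /ltW/le_trans]; exact.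
Qed.

Lemma H2_expR_Lp2 y : H2 L y -> Lp L 2 (fun x => expR (y x)).
Proof.
move=> Hy; have [py my] := H2_meas Hy; apply/Lp2P; split.
- by move=> x; rewrite py.
- exact: measurableT_comp.
- by have [_] := H2_intgM L0 Hy (H2_intg_expR L0 Hy).
Qed.

End Selection.

(** * Iterates converging to U(t) *)

Section Approximation.
Context {R : realType}.
Variable L : R.
Hypothesis L0 : 0 < L.
Variables (u0 : R -> R) (u : R -> R -> R) (U ut : R -> (R -> R) -> R) (m : R).
Hypothesis m0 : 0 < m.
Hypothesis iu : intg L u0.
Hypothesis u0_ge0 : forall x, 0 <= u0 x.
Hypothesis iul : intg L (fun x => u0 x * ln (u0 x)).
Hypothesis um : itg L u0 = m * L.
Hypothesis hu : weak_solution L u0 u U ut.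
Hypothesis hc : constructed L u0 u ut.
Local Notation mu := (@lebesgue_measure R).
Local Notation intg := (intg L).
Local Notation itg := (itg L).
Local Notation entropy := (entropy L).
Local Notation rate := (rate L).

(** The function [f] is the iterate active at a time s just after t. Its time interval ends at or
    after s, so it has decayed for at least the time t; the step size is at most e, whence the
    factor 1 + e [rate]. *)
Lemma iterate_near (t e : R) : 0 < t -> 0 < e -> e <= 1 ->
  exists f s, [/\ t < s, s < t + e,
      forall phi, H2 L phi -> Lp L 2 f /\ (itg (fun x => f x * phi x) - U s phi) ^+ 2 <= e * itg (fun x => phi x ^+ 2) &
    [/\ intg f, (forall x, 0 <= f x), intg (fun x => f x * ln (f x)), itg f = m * L &
      entropy m f <= expR (- (rate * t / (1 + e * rate))) * entropy m u0]].
Proof.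
move=> t0 e0 e1; have T0 : 0 < t + 1 by rewrite addr_gt0.
have [y [sd [n [[nlt n0] sc _ _]]]] := hc T0.
pose F i : R -> R -> R := step (t + 1) (n i) (exp_iter u0 (y (n i))).
have HF i s : 0 < s -> s <= t + 1 -> exists k, [/\ (k < n i)%N, s <= k.+1%:R * ((t + 1) / (n i)%:R),
    F i s = exp_iter u0 (y (n i)) k.+1 & Lp L 2 (exp_iter u0 (y (n i)) k.+1)].
  move=> s0 sT; have [k [kn sk E]] := stepE (exp_iter u0 (y (n i))) T0 (n0 i) s0 sT.
  exists k; split => //; apply: H2_expR_Lp2 => //.
  by have [] := sd (n i) (n0 i) k kn.
have H : \forall i \near \oo, exists2 s, s \in `]t, t + e[ &
    [/\ eqHm2 L (U s) (functional L (u s)), Lp L 2 (u s) & itg (fun x => (F i s x - u s x) ^+ 2) < e].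
  apply: (LpB_select (F := F) _ _ sc (ltW t0) _ _ e0 _).
  - by move=> i s s0 sT; have [k [_ _ -> ]] := HF i s s0 sT.
  - move=> i; exists (\sum_(k < n i) itg (fun x => exp_iter u0 (y (n i)) k.+1 x ^+ 2)) => s s0 sT.
    have [k [kn _ -> _]] := HF i s s0 sT.
    rewrite (bigD1 (Ordinal kn))//= lerDl; apply: sumr_ge0 => j _.
    by apply: itg_ge0 => x _; exact: sqr_ge0.
  - by rewrite ltrDl.
  - by rewrite lerD2l.
  - refine (ae_mono (ws_rep hu) _) => s + sI; apply.
    by move: sI; rewrite in_itv/= => /andP[].
(* One index must serve both the proximity to u and the smallness of the step size; the latter
   follows from n i >= i. *)
have [i [[s sI [Us Lu se]] ni]] : exists i, (exists2 s, s \in `]t, t + e[ &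
    [/\ eqHm2 L (U s) (functional L (u s)), Lp L 2 (u s) & itg (fun x => (F i s x - u s x) ^+ 2) < e])
    /\ (t + 1) / (n i)%:R <= e.
  have ine i : (i <= n i)%N.
    by elim: i => // i IH; apply: (leq_ltn_trans IH); exact: nlt.
  have [N NN] : exists N : nat, (t + 1) / e <= N%:R.
    exists (Num.truncn ((t + 1) / e)).+1; apply: ltW; exact: truncnS_gt.
  have [M _ HM] := H; exists (maxn M N); split; first by apply: HM; rewrite /= leq_maxl.
  rewrite ler_pdivrMr ?ltr0n// mulrC -ler_pdivrMr//; apply: (le_trans NN).
  by rewrite ler_nat; apply: leq_trans (ine _); exact: leq_maxr.
have [ts st] : t < s /\ s < t + e by move: sI; rewrite in_itv/= => /andP[].
have s0 : 0 < s by exact: lt_trans ts.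
have sT : s <= t + 1 by rewrite (le_trans (ltW st))// lerD2l.
have [k [kn sk FE Lf]] := HF i s s0 sT.
have [h1 h2 h3 h4 _] := semidiscrete_decay L0 T0 (n0 i) iu u0_ge0 iul um (sd _ (n0 i)) kn.
exists (exp_iter u0 (y (n i)) k.+1), s; split => //.
  move=> phi Hphi; split => //; have Lphi : Lp L 2 phi by case: Hphi.
  rewrite Us// /functional -/(itg _) -itgB; [|exact: Lp2_intgM|exact: Lp2_intgM].
  under eq_itg do rewrite -mulrBl.
  apply: (le_trans (itg_cauchy_schwarz (Lp2B Lf Lu) Lphi)).
  apply: ler_wpM2r; first by apply: itg_ge0 => x _; exact: sqr_ge0.
  by move: se; rewrite FE => /ltW.
split => //.
have ntau : t <= k.+1%:R * ((t + 1) / (n i)%:R) by rewrite (le_trans (ltW ts)).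
have := semidiscrete_entropy_le L0 T0 (n0 i) m0 iu u0_ge0 iul um (sd _ (n0 i)) kn ntau.
move=> /le_trans; apply; apply: ler_wpM2r; first exact: entropy_ge0.
have r0 := rate_gt0 L0.
have p1 : 0 < (t + 1) / (n i)%:R by rewrite divr_gt0// ltr0n.
rewrite ler_expR lerN2; apply: ler_wpM2l; first by rewrite mulr_ge0 ?(ltW r0) ?(ltW t0).
have q1 (a : R) : 0 < a -> 0 < 1 + a * rate by move=> a0; apply: ltr_pwDl => //; apply: mulr_ge0; apply: ltW.
by rewrite lef_pV2 ?posrE; [rewrite lerD2l ler_pM2r|exact: q1|exact: q1].
Qed.

(** The L^2 proximity only holds at the selected times s n, where U(s n) is represented by u;
    continuity of U in H^(-2) then replaces U(s n) by U(t). *)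
Lemma iterates_weak (t : R) : 0 < t -> exists f : nat -> R -> R,
  [/\ forall n, [/\ Lp L 2 (f n), intg (f n), (forall x, 0 <= f n x),
        intg (fun x => f n x * ln (f n x)) & itg (f n) = m * L],
      forall phi, H2 L phi -> itg (fun x => f n x * phi x) @[n --> \oo] --> U t phi &
      exists2 E : nat -> R, (forall n, entropy m (f n) <= E n) &
        E n @[n --> \oo] --> expR (- (rate * t)) * entropy m u0].
Proof.
move=> t0; pose e (n : nat) : R := n.+1%:R^-1.
have e0 n : 0 < e n by rewrite invr_gt0.
have e1 n : e n <= 1 by rewrite invf_le1// ler1n.
have ecv : e n @[n --> \oo] --> (0 : R).
  exact: (@cvg_harmonic R).
have /choice[f Hf] := fun n => iterate_near t0 (e0 n) (e1 n).
have /choice[s Hs] := Hf.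
exists f; split.
- by move=> n; have [_ _ H [? ? ? ? _]] := Hs n; have [] := H _ (cst_H2 L0 0).
- move=> phi Hphi.
  have scv : s n @[n --> \oo] --> t.
    apply: (@squeeze_cvgr _ _ _ _ (fun=> t) (fun n => t + e n)).
    + by near=> n; have [/ltW -> /ltW ->] := Hs n.
    + exact: cvg_cst.
    + by rewrite -[X in _ --> X]addr0; apply: cvgD => //; exact: cvg_cst.
  have [C C0 HC] := Hm2_bound L0 Hphi.
  have sn0 n : 0 <= s n by have [/ltW h _ _ _] := Hs n; rewrite (le_trans _ h)// ltW.
  have Ucv : U (s n) phi - U t phi @[n --> \oo] --> (0 : R).
    apply/cvgrPdist_lt => d d0.
    have dC : 0 < d / C by rewrite divr_gt0.
    have /cvgrPdist_lt/(_ _ dC) H := ws_cont hu (ltW t0).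
    have {}H : \forall n \near \oo, 0 <= s n -> `|0 - snorm (Hm2 L) (U (s n) - U t)| < d / C by exact: scv _ H.
    apply: (@filterS _ _ _ (fun n => 0 <= s n -> `|0 - snorm (Hm2 L) (U (s n) - U t)| < d / C)) H => n /(_ (sn0 n)); rewrite !sub0r !normrN => H.
    have D := dual_sub (ws_rep_Hm2 hu (sn0 n)) (ws_rep_Hm2 hu (ltW t0)).
    apply: (le_lt_trans (HC _ D)); rewrite mulrC -ltr_pdivlMr//.
    exact: (le_lt_trans (ler_norm _)).
  have dcv : itg (fun x => f n x * phi x) - U (s n) phi @[n --> \oo] --> (0 : R).
    have S0 : 0 <= itg (fun x => phi x ^+ 2) by apply: itg_ge0 => x _; exact: sqr_ge0.
    apply/cvgrPdist_lt => d d0.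
    have dS : 0 < d ^+ 2 / (1 + itg (fun x => phi x ^+ 2)) by rewrite divr_gt0 ?exprn_gt0// ltr_pwDl.
    have /cvgrPdist_lt/(_ _ dS) := ecv; apply: filterS => n.
    rewrite !sub0r !normrN gtr0_norm// ltr_pdivlMr ?ltr_pwDl// => He.
    have [_ _ /(_ _ Hphi)[_ H] _] := Hs n.
    rewrite -(@ltr_pXn2r _ 2)// ?nnegrE// ?(ltW d0)// real_normK ?num_real//.
    by apply: (le_lt_trans H); apply: le_lt_trans He; rewrite ler_wpM2l// ?(ltW (e0 n))// lerDr.
  rewrite (_ : (fun n => _) = (fun n => (itg (fun x => f n x * phi x) - U (s n) phi) +
     (U (s n) phi - U t phi) + U t phi)); last by apply/funext => n; ring.
  rewrite -[X in _ --> X]add0r -[X in _ --> X + _](addr0 0).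
  by apply: cvgD; [exact: cvgD|exact: cvg_cst].
- exists (fun n => expR (- (rate * t / (1 + e n * rate))) * entropy m u0).
    by move=> n; have [_ _ _ []] := Hs n.
  apply: cvgM; last exact: cvg_cst.
  have H : - (rate * t / (1 + e n * rate)) @[n --> \oo] --> - (rate * t).
    rewrite -[X in _ --> - X](divr1 (rate * t)) -[X in _ / X](addr0 1) -[X in 1 + X](mul0r rate).
    apply: cvgN; apply: cvgM; first exact: cvg_cst.
    apply: cvgV; first by rewrite mul0r addr0 oner_neq0.
    by apply: cvgD; [exact: cvg_cst|apply: cvgM => //; exact: cvg_cst].
  exact: (cvg_comp _ _ H (@continuous_expR R _)).
Unshelve. all: by end_near. Qed.

End Approximation.

(** * Weak limits of densities with bounded entropy *)

Section WeakLimit.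
Context {R : realType}.
Variable L : R.
Hypothesis L0 : 0 < L.
Implicit Types (g h phi : R -> R).
Local Notation mu := (@lebesgue_measure R).
Local Notation intg := (intg L).
Local Notation itg := (itg L).
Variables (f : nat -> R -> R) (B m : R).
Hypothesis fi : forall n, intg (f n).
Hypothesis f0 : forall n x, 0 <= f n x.
Hypothesis fli : forall n, intg (fun x => f n x * ln (f n x)).
Hypothesis fm : forall n, itg (f n) = m * L.
Hypothesis fB : forall n, itg (fun x => f n x * ln (f n x)) <= B.

Definition bdmeas (c : R) g := measurable_fun `[0, L] g /\ forall x, x \in `[0, L] -> `|g x| <= c.

Lemma bdmeas_intg c g : bdmeas c g -> intg g.
Proof. by move=> [mg gc]; exact: intg_bounded gc. Qed.

Lemma bdmeas_intgM c g n : bdmeas c g -> intg (fun x => f n x * g x).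
Proof. by move=> [mg gc]; exact: intgM gc. Qed.

Lemma bdmeasB c c' g h : bdmeas c g -> bdmeas c' h -> bdmeas (c + c') (fun x => g x - h x).
Proof.
move=> [mg gc] [mh hc]; split; first exact: measurable_funB.
by move=> x xI; rewrite (le_trans (ler_normB _ _))// lerD// ?gc ?hc.
Qed.

Lemma bdmeas_indic (A : set R) : measurable A -> bdmeas 1 (\1_A).
Proof.
move=> mA; split; last by move=> x _; exact: indic_le1.
by apply: measurable_indic.
Qed.

Lemma entr_ge (a : R) : 0 <= a -> 0 <= a * ln a + 1.
Proof. by move=> a0; have := ent_lower 0 a0; rewrite expR0; lra. Qed.

(* A bound on the entropy gives uniform integrability:
   f |g| <= K |g| + c (f ln f + 1) / ln K, according to whether f <= K. *)
Lemma ui_bound (c K : R) g n : 1 < K -> 0 <= c -> bdmeas c g ->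
  `|itg (fun x => f n x * g x)| <= K * itg (fun x => `|g x|) + c * (B + L) / ln K.
Proof.
move=> K1 c0 gb; have lK : 0 < ln K by exact: ln_gt0.
have gi := bdmeas_intg gb; have gn := intg_norm gi.
have i1 : intg (fun x => K * `|g x|) by exact: intgZ.
have i2 : intg (fun x => c / ln K * (f n x * ln (f n x) + 1)).
  by apply: intgZ; apply: intgD => //; exact: intg_cst.
apply: (le_trans (itg_norm (bdmeas_intgM n gb))).
apply: (@le_trans _ _ (itg (fun x => K * `|g x| + c / ln K * (f n x * ln (f n x) + 1)))).
  apply: itg_le; [exact: intg_norm (bdmeas_intgM n gb)|exact: intgD|].
  move=> x xI; rewrite normrM ger0_norm//; have gc := gb.2 x xI.
  have := entr_ge (f0 n x); have := f0 n x; set a := f n x => a0 e0.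
  have ck : 0 <= c / ln K by rewrite divr_ge0// ltW.
  have [aK|Ka] := leP a K.
    by apply: (@le_trans _ _ (K * `|g x|)); [exact: ler_wpM2r|rewrite lerDl mulr_ge0].
  have K0 : 0 < K by rewrite (lt_trans ltr01).
  have lKa : ln K <= ln a by rewrite ler_ln ?posrE// ?ltW// (lt_trans K0).
  apply: (@le_trans _ _ (c / ln K * (a * ln a + 1))); last first.
    by rewrite lerDr mulr_ge0// ltW.
  apply: (@le_trans _ _ (c / ln K * (a * ln K))).
    by rewrite mulrCA divfK ?gt_eqF// ler_wpM2l.
  by apply: ler_wpM2l => //; apply: (@le_trans _ _ (a * ln a)); [exact: ler_wpM2l|rewrite lerDl].
rewrite itgD// !itgZ//; last by apply: intgD => //; exact: intg_cst.
rewrite lerD2l [leRHS]mulrAC; apply: ler_wpM2l; first by rewrite divr_ge0// ltW.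
rewrite itgD//; last exact: intg_cst.
by rewrite itg_cst// mul1r lerD2r.
Qed.

Lemma ui_small (c e : R) (g : nat -> R -> R) : 0 <= c -> (forall j, bdmeas c (g j)) ->
  itg (fun x => `|g j x|) @[j --> \oo] --> (0 : R) -> 0 < e ->
  \forall j \near \oo, forall n, `|itg (fun x => f n x * g j x)| <= e.
Proof.
move=> c0 gb gcv e0.
have BL : 0 <= B + L.
  rewrite -[L]mul1r -itg_cst//; apply: (@le_trans _ _ (itg (fun x => f 0%N x * ln (f 0%N x) + 1))).
    by apply: itg_ge0 => x _; exact: entr_ge.
  by rewrite itgD//; [rewrite lerD2r|exact: intg_cst].
(* The truncation level is K = e^l, so ln K = l and the tail term c (B + L) / ln K is at most e /
   2. *)
pose l := 1 + 2 * (c * (B + L)) / e.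
have l0 : 0 < l by rewrite ltr_pwDl// divr_ge0 ?(ltW e0)// mulr_ge0// mulr_ge0.
pose K := expR l; have K1 : 1 < K by rewrite expR_gt1.
have K0 : 0 < K by exact: expR_gt0.
have h : c * (B + L) / l <= e / 2.
  rewrite ler_pdivrMr// (_ : e / 2 * l = e / 2 + c * (B + L)); last by rewrite /l; field; rewrite gt_eqF.
  by rewrite lerDr divr_ge0// ltW.
have d0 : 0 < e / 2 / K by rewrite !divr_gt0.
have /cvgrPdist_lt/(_ _ d0) := gcv; apply: filterS => j; rewrite sub0r normrN => Hj n.
apply: (le_trans (ui_bound n K1 c0 (gb j))); rewrite /K expRK -/K.
apply: (@le_trans _ _ (e / 2 + e / 2)); last by rewrite -splitr.
apply: lerD => //; rewrite mulrC -ler_pdivlMr//.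
exact: (le_trans (ler_norm _) (ltW Hj)).
Qed.

(** Uniform integrability makes the error between [phi j] and [g] small uniformly in n, so the
    limits in n and j may be exchanged. *)
Lemma approx_cvg (c : R) (phi : nat -> R -> R) g : 0 <= c -> (forall j, bdmeas c (phi j)) -> bdmeas c g ->
  itg (fun x => `|phi j x - g x|) @[j --> \oo] --> (0 : R) ->
  (forall j, cvgn (fun n => itg (fun x => f n x * phi j x))) ->
  cvgn (fun n => itg (fun x => f n x * g x)) /\
  limn (fun n => itg (fun x => f n x * phi j x)) @[j --> \oo] -->
    limn (fun n => itg (fun x => f n x * g x)).
Proof.
move=> c0 phib gb cv pc.
have db j : bdmeas (c + c) (fun x => phi j x - g x) by exact: bdmeasB.
have U e : 0 < e -> \forall j \near \oo, forall n,
    `|itg (fun x => f n x * phi j x) - itg (fun x => f n x * g x)| <= e.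
  move=> e0; have := ui_small (addr_ge0 c0 c0) db cv e0; apply: filterS => j H n.
  rewrite -itgB; [|exact: bdmeas_intgM (phib j)|exact: bdmeas_intgM gb].
  by have := H n; under eq_itg do rewrite mulrBr.
have cvg_g : cvgn (fun n => itg (fun x => f n x * g x)).
  apply/cauchy_cvgP; apply: cauchy_exP => e e0.
  have e2 : 0 < e / 2 by rewrite divr_gt0.
  have [j _ /(_ j (leqnn _)) Hj] := U _ e2.
  exists (limn (fun n => itg (fun x => f n x * phi j x))).
  have /cvgrPdist_lt/(_ _ e2) := pc j; apply: filterS => n H.
  rewrite /ball/= [e]splitr; apply: le_lt_trans (ler_distD (itg (fun x => f n x * phi j x)) _ _) _.
  by apply: ltr_leD => //; exact: Hj.
split => //; apply/cvgrPdist_le => e e0; have := U e e0; apply: filterS => j H.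
have D : `|itg (fun x => f n x * g x) - itg (fun x => f n x * phi j x)| @[n --> \oo] -->
   `|limn (fun n => itg (fun x => f n x * g x)) - limn (fun n => itg (fun x => f n x * phi j x))|.
  by apply: cvg_norm; apply: cvgB; [exact: cvg_g|exact: pc].
apply: (ler_cvg_to D (cvg_cst e)); near=> n; rewrite distrC; exact: H.
Unshelve. all: by end_near. Qed.

Lemma approx_ae_cvg (c : R) (phi : nat -> R -> R) g : 0 <= c -> (forall j, bdmeas c (phi j)) -> bdmeas c g ->
  {ae mu, forall x, x \in `[0, L] -> phi j x @[j --> \oo] --> g x} ->
  (forall j, cvgn (fun n => itg (fun x => f n x * phi j x))) ->
  cvgn (fun n => itg (fun x => f n x * g x)) /\
  limn (fun n => itg (fun x => f n x * phi j x)) @[j --> \oo] -->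
    limn (fun n => itg (fun x => f n x * g x)).
Proof.
move=> c0 phib gb pg pc; apply: (approx_cvg c0 phib gb _ pc).
have db j : bdmeas (c + c) (fun x => phi j x - g x) by exact: bdmeasB.
have cc0 : 0 <= c + c by exact: addr_ge0.
have z : itg (fun=> 0) = 0 by rewrite itg_cst// mul0r.
rewrite -{1}z; apply: (@itg_dominated _ _ _ _ (fun=> c + c)).
- by move=> j; apply: intg_norm; exact: bdmeas_intg (db j).
- exact: intg_cst.
- by move=> j x xI; rewrite ger0_norm//; exact: (db j).2.
- exact: intg_cst.
- refine (ae_mono pg _) => x H /H{}H.
  have : `|phi j x - g x| @[j --> \oo] --> `|g x - g x|.
    by apply: cvg_norm; apply: cvgB => //; exact: cvg_cst.
  by rewrite subrr normr0.
Qed.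

Lemma cvg_psum j (u : nat -> nat -> R) (l : nat -> R) : (forall i, u i n @[n --> \oo] --> l i) ->
  \sum_(i < j) u i n @[n --> \oo] --> \sum_(i < j) l i.
Proof.
move=> H; elim: j => [|j IH].
  by under eq_cvg do rewrite big_ord0; rewrite big_ord0; exact: cvg_cst.
by under eq_cvg do rewrite big_ord_recr/=; rewrite big_ord_recr/=; exact: cvgD.
Qed.

Lemma indic_psum (F : nat -> set R) x : trivIset [set: nat] F ->
  (exists2 k, F k x & forall j, \sum_(i < j) (\1_(F i) x : R) = (k < j)%:R) \/
  ((forall k, ~ F k x) /\ forall j, \sum_(i < j) (\1_(F i) x : R) = 0).
Proof.
move=> tF; have [[k Fk]|nF] := pselect (exists k, F k x); [left|right].
  exists k => // j; have [kj|jk] := ltnP k j.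
    rewrite (bigD1 (Ordinal kj))//= indicE mem_set// big1 ?addr0// => i ik.
    rewrite indicE memNset// => Fi; move/eqP: ik; apply; apply: val_inj => /=.
    by apply: tF => //; exists x.
  rewrite big1// => i _; rewrite indicE memNset// => Fi.
  have ik : i = k :> nat by apply: tF => //; exists x.
  by move: (ltn_ord i); rewrite ik ltnNge jk.
split=> [k Fk|j]; first by apply: nF; exists k.
by rewrite big1// => i _; rewrite indicE memNset// => Fi; apply: nF; exists i.
Qed.

Lemma indic_psum_le1 (F : nat -> set R) j x : trivIset [set: nat] F ->
  `|\sum_(i < j) (\1_(F i) x : R)| <= 1.
Proof.
move=> /(indic_psum x)[[k _ ->]|[_ ->]]; last by rewrite normr0.
by case: (k < j)%N; rewrite ?normr1 ?normr0.
Qed.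

Lemma indic_psum_cvg (F : nat -> set R) x : trivIset [set: nat] F ->
  \sum_(i < j) (\1_(F i) x : R) @[j --> \oo] --> (\1_(\bigcup_i F i) x : R).
Proof.
move=> /(indic_psum x)[[k Fk H]|[nF H]].
  rewrite indicE mem_set; last by exists k.
  apply: cvg_near_cst; exists k.+1 => // j kj; apply/eqP; rewrite H.
  by rewrite (_ : (k < j)%N).
rewrite indicE memNset; last by move=> [k _ /nF].
by rewrite (_ : (fun j => _) = (fun=> 0)); [exact: cvg_cst|apply/funext => j; rewrite H].
Qed.

Lemma bdmeas_psum (F : nat -> set R) j : (forall k, measurable (F k)) -> trivIset [set: nat] F ->
  bdmeas 1 (fun x => \sum_(i < j) (\1_(F i) x : R)).
Proof.
move=> mF tF; split; last by move=> x _; exact: indic_psum_le1.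
by apply: measurable_sum => i; exact: measurable_indic.
Qed.

Lemma itg_psum (F : nat -> set R) n j : (forall k, measurable (F k)) ->
  itg (fun x => f n x * \sum_(i < j) (\1_(F i) x : R)) = \sum_(i < j) itg (fun x => f n x * \1_(F i) x).
Proof.
move=> mF; rewrite -(@itg_sum _ L L0 j (fun i x => f n x * \1_(F i) x)); last first.
  by move=> i; exact: bdmeas_intgM (bdmeas_indic (mF i)).
by apply: eq_itg => x _; rewrite mulr_sumr.
Qed.

Hypothesis fcv : forall k a b, cvgn (fun n => itg (fun x => f n x * tp L k a b x)).

(** Convolutions of the indicator are trigonometric polynomials, bounded by 1 and convergent a.e.,
    so [fcv] passes to the indicator. *)
Lemma cvg_itv (p q : R) : cvgn (fun n => itg (fun x => f n x * \1_`[p, q]%classic x)).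
Proof.
have mI : measurable `[p, q]%classic by [].
apply: (@approx_ae_cvg 1 (fun j => conv L j (\1_`[p, q]%classic)) _ ler01 _ (bdmeas_indic mI) _ _).1.
- move=> j; split; last by move=> x _; exact: conv_indic_bound.
  have c := conv_continuous L0 (k := j) (intg_indic L0 p q).
  by apply: measurable_funTS; exact: continuous_measurable_fun.
- exact: conv_indic_ae.
- move=> j; have [n [b H]] := conv_tp L0 j.
  by rewrite (H _ (intg_indic L0 p q)); exact: fcv.
Qed.

(** The sets along which the integrals converge form a Dynkin system: complements use the common
    mass, disjoint unions uniform integrability. On [0, L] the generating rays are intervals ending
    at L. *)
Lemma cvg_borel (A : set R) : measurable A -> cvgn (fun n => itg (fun x => f n x * \1_A x)).
Proof.
move=> mA; apply: (@dynkin_induction _ (measurableTypeR R) (@RGenCInfty.G R)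
  (fun A => cvgn (fun n => itg (fun x => f n x * \1_A x)))).
- exact: RGenCInfty.measurableE.
- move=> _ _ [x ->] [y ->]; exists (Num.max x y).
  apply/seteqP; split => z /=; rewrite !in_itv/= !andbT ge_max; first by move=> [-> ->].
  by move=> /andP[].
- rewrite (_ : (fun n => _) = (fun=> m * L)); first exact: is_cvg_cst.
  by apply/funext => n; rewrite -(fm n); apply: eq_itg => x _; rewrite indicE mem_set// mulr1.
- move=> _ [p ->]; rewrite (_ : (fun n => _) = (fun n => itg (fun x => f n x * \1_`[p, L]%classic x))); first exact: cvg_itv.
  apply/funext => n; apply: eq_itg => x xI; congr (_ * _); rewrite !indicE; congr (_%:R).
  congr nat_of_bool; apply/idP/idP; rewrite !inE /= !in_itv/= ?andbT; last by move=> /andP[].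
  by move=> ->; move: xI; rewrite in_itv/= => /andP[].
- move=> S mS cS; rewrite (_ : (fun n => _) = (fun n => m * L - itg (fun x => f n x * \1_S x))).
    by apply: is_cvgB => //; exact: is_cvg_cst.
  apply/funext => n; rewrite -(fm n) -itgB//; last exact: bdmeas_intgM (bdmeas_indic mS).
  apply: eq_itg => x _; rewrite indicC indicE; case: (x \in S) => /=.
    by rewrite mulr0 mulr1 subrr.
  by rewrite mulr0 mulr1 subr0.
- move=> F mF tF cF.
  apply: (@approx_ae_cvg 1 (fun j x => \sum_(i < j) (\1_(F i) x : R)) _ ler01 _ _ _ _).1.
  + by move=> j; exact: bdmeas_psum.
  + by apply: bdmeas_indic; exact: bigcupT_measurable.
  + by apply: aeW => x _; exact: indic_psum_cvg.
  + move=> j; rewrite (_ : (fun n => _) = (fun n => \sum_(i < j) itg (fun x => f n x * \1_(F i) x))); last first.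
      by apply/funext => n; exact: itg_psum.
    apply/cvg_ex; exists (\sum_(i < j) limn (fun n => itg (fun x => f n x * \1_(F i) x))).
    exact: (@cvg_psum j (fun i n => itg (fun x => f n x * \1_(F i) x)) (fun i => limn (fun n => itg (fun x => f n x * \1_(F i) x))) cF).
- have : (RGenCInfty.G (R := R)).-sigma.-measurable A by rewrite -RGenCInfty.measurableE.
  by [].
Qed.

(* The absolute value only matters on non-measurable sets, where a measure has
   to be nonnegative too. *)
Let mass (A : set (measurableTypeR R)) : \bar R :=
  (`|limn (fun n => itg (fun x => f n x * \1_A x))|)%:E.

Let massE A : measurable A -> mass A = (limn (fun n => itg (fun x => f n x * \1_A x)))%:E.
Proof.
move=> mA; rewrite /mass ger0_norm//; apply: limr_ge; first exact: cvg_borel.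
by apply: nearW => n; apply: itg_ge0 => x _; rewrite mulr_ge0// indicE.
Qed.

Let mass0 : mass set0 = 0%E.
Proof.
rewrite massE// (_ : (fun n => _) = (fun=> 0)) ?lim_cst//.
apply/funext => n; rewrite (_ : (fun x => _) = (fun=> 0)) ?itg_cst ?mul0r//.
by apply/funext => x; rewrite indic0 mulr0.
Qed.

Let mass_ge0 A : (0 <= mass A)%E.
Proof. by rewrite lee_fin. Qed.

Let mass_sigma_additive : semi_sigma_additive mass.
Proof.
move=> F mF tF mUF; rewrite massE//.
have c k : cvgn (fun n => itg (fun x => f n x * \1_(F k) x)) by exact: (cvg_borel (mF k)).
have P j : itg (fun x => f n x * \sum_(i < j) (\1_(F i) x : R)) @[n --> \oo] -->
    \sum_(i < j) limn (fun n => itg (fun x => f n x * \1_(F i) x)).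
  rewrite (_ : (fun n => _) = (fun n => \sum_(i < j) itg (fun x => f n x * \1_(F i) x))); last first.
    by apply/funext => n; exact: itg_psum.
  exact: (@cvg_psum j (fun i n => itg (fun x => f n x * \1_(F i) x)) (fun i => limn (fun n => itg (fun x => f n x * \1_(F i) x))) c).
have pw : {ae mu, forall x, x \in `[0, L] -> \sum_(i < j) (\1_(F i) x : R) @[j --> \oo] --> (\1_(\bigcup_i F i) x : R)}.
  by apply: aeW => x _; exact: indic_psum_cvg.
have [_ H] := @approx_ae_cvg 1 (fun j x => \sum_(i < j) (\1_(F i) x : R)) (\1_(\bigcup_i F i)) ler01
  (fun j => bdmeas_psum j mF tF) (bdmeas_indic mUF) pw
  (fun j => cvgP _ (P j)).
have S j : (\sum_(0 <= i < j) mass (F i))%E =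
    (limn (fun n => itg (fun x => f n x * \sum_(i < j) (\1_(F i) x : R))))%:E.
  by rewrite (cvg_lim _ (P j))// big_mkord; under eq_bigr do rewrite massE//; rewrite sumEFin.
rewrite (funext S); apply: cvg_EFin; first exact: nearW.
exact: H.
Qed.

Let mass_fin : fin_num_fun mass.
Proof. by []. Qed.

HB.instance Definition _ := isMeasure.Build _ _ _ mass mass0 mass_ge0 mass_sigma_additive.
HB.instance Definition _ := @Measure_isFinite.Build _ _ _ mass mass_fin.

Let mass_dominated : mass `<< mu.
Proof.
apply/null_content_dominatesP => A mA A0; rewrite massE//.
rewrite (_ : (fun n => _) = (fun=> 0)) ?lim_cst//; apply/funext => n.
rewrite -[RHS](_ : itg (fun=> 0) = 0); last by rewrite itg_cst// mul0r.
apply: ae_eq0L_itgE; [exact: bdmeas_intgM (bdmeas_indic mA)|exact: intg_cst|].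
exists A; split => // x /= /not_implyP[_]; apply: contra_notP => nA.
by rewrite indicE memNset// mulr0.
Qed.

Lemma weak_density : exists h, [/\ intg h, measurable_fun setT h, (forall x, 0 <= h x) &
  forall A, measurable A -> itg (fun x => f n x * \1_A x) @[n --> \oo] --> itg (fun x => h x * \1_A x)].
Proof.
have [F [F0 Ffin iF HF]] := radon_nikodym_sigma_finite mass_dominated.
have FE x : F x = (fine (F x))%:E by rewrite fineK.
have mF : measurable_fun setT (fine \o F).
  by apply: measurableT_comp => //; exact: measurable_int iF.
have i : intg (fine \o F).
  apply: (@eq_integrable _ _ _ mu `[0, L]%classic _ F) => //.
  by apply: integrableS iF.
exists (fine \o F); split => //; first by move=> x; rewrite fine_ge0.
have E A : measurable A -> A `<=` `[0, L] -> limn (fun n => itg (fun x => f n x * \1_A x)) = itg (fun x => fine (F x) * \1_A x).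
  move=> mA AL; apply: EFin_inj; rewrite -massE// [LHS]HF//.
  have iA := intg_indicM mA i.
  rewrite [RHS]fineK; last exact: integrable_fin_num iA.
  rewrite [LHS]integral_mkcond [RHS]integral_mkcond; apply: eq_integral => x _.
  rewrite !patchE; case: (boolP (x \in A)) => xA.
    by rewrite mem_set; [rewrite indicE xA mulr1 -FE|apply: AL; exact: set_mem].
  by rewrite indicE (negbTE xA) mulr0; case: ifP.
move=> A mA; have mAL : measurable (A `&` `[0, L]) by exact: measurableI.
(* Integrals over the period only see the part of [A] in [0, L], while the Radon-Nikodym density is
   integrated over all of [A]. *)
have EI h : itg (fun x => h x * \1_(A `&` `[0, L]) x) = itg (fun x => h x * \1_A x).
  apply: eq_itg => x xI; congr (_ * _%:R); congr nat_of_bool.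
  by apply/idP/idP; rewrite !inE; [case|split].
rewrite -EI -E//.
have := cvg_borel mAL; rewrite (_ : (fun n => _) = (fun n => itg (fun x => f n x * \1_A x))).
  by [].
by apply/funext => n; rewrite EI.
Qed.

End WeakLimit.

(** * Weak convergence against bounded functions *)

Section WeakTest.
Context {R : realType}.
Variable L : R.
Hypothesis L0 : 0 < L.
Implicit Types (g phi : R -> R).
Local Notation mu := (@lebesgue_measure R).
Local Notation intg := (intg L).
Local Notation itg := (itg L).
Local Notation bdmeas := (bdmeas L).
Variables (f : nat -> R -> R) (h : R -> R) (m : R).
Hypothesis fi : forall n, intg (f n).
Hypothesis f0 : forall n x, 0 <= f n x.
Hypothesis fm : forall n, itg (f n) = m * L.
Hypothesis hi : intg h.
Hypothesis h0 : forall x, 0 <= h x.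
Hypothesis hcv : forall A, measurable A ->
  itg (fun x => f n x * \1_A x) @[n --> \oo] --> itg (fun x => h x * \1_A x).

Lemma weak_mass : itg h = m * L.
Proof.
have E k : itg (fun x => k x * \1_setT x) = itg k.
  by apply: eq_itg => x _; rewrite indicE mem_set// mulr1.
have := hcv measurableT; under eq_cvg do rewrite E fm; rewrite E => H.
exact: (cvg_unique _ H (cvg_cst _)).
Qed.

(** The class of valid bounded test functions: it contains indicators and is closed under linear
    combinations and uniform limits, hence contains every bounded measurable function. *)
Let W g := (exists c, bdmeas c g) /\
  (itg (fun x => f n x * g x) @[n --> \oo] --> itg (fun x => h x * g x)).

Lemma hg_intg c g : bdmeas c g -> intg (fun x => h x * g x).
Proof. by move=> [mg gc]; exact: intgM gc. Qed.

Let WD g g' : W g -> W g' -> W (fun x => g x + g' x).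
Proof.
move=> [[c gc] H] [[c' gc'] H']; split.
  exists (c + c'); split; first by apply: measurable_funD; [case: gc|case: gc'].
  by move=> x xI; apply: (le_trans (ler_normD _ _)); apply: lerD; [case: gc => _; exact|case: gc' => _; exact].
have E k : intg k -> intg (fun x => k x * g x) -> intg (fun x => k x * g' x) ->
    itg (fun x => k x * (g x + g' x)) = itg (fun x => k x * g x) + itg (fun x => k x * g' x).
  by move=> ki kg kg'; rewrite -itgD//; apply: eq_itg => x _; rewrite mulrDr.
rewrite (E h)//; [|exact: hg_intg gc|exact: hg_intg gc'].
under eq_cvg do rewrite E ?(bdmeas_intgM fi _ gc) ?(bdmeas_intgM fi _ gc')//.
exact: cvgD.
Qed.

Let WZ (a : R) g : W g -> W (fun x => a * g x).
Proof.
move=> [[c gc] H]; split.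
  exists (`|a| * c); split; first by apply: measurable_funM => //; case: gc.
  by move=> x xI; rewrite normrM ler_wpM2l//; case: gc => _; exact.
have E k : intg (fun x => k x * g x) -> itg (fun x => k x * (a * g x)) = a * itg (fun x => k x * g x).
  by move=> kg; rewrite -itgZ//; apply: eq_itg => x _; rewrite mulrCA.
rewrite (E h); last exact: hg_intg gc.
under eq_cvg do rewrite E ?(bdmeas_intgM fi _ gc)//.
by apply: cvgM => //; exact: cvg_cst.
Qed.

Let W_indic (A : set R) : measurable A -> W (\1_A).
Proof. by move=> mA; split; [exists 1; exact: bdmeas_indic|exact: hcv]. Qed.

Let W_cst (a : R) : W (fun=> a).
Proof.
have := WZ a (W_indic measurableT); congr W; apply/funext => x.
by rewrite indicE mem_set// mulr1.
Qed.

Let W_sum j (g : nat -> R -> R) : (forall i, W (g i)) -> W (fun x => \sum_(i < j) g i x).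
Proof.
move=> Wg; elim: j => [|j IH].
  by have := W_cst 0; congr W; apply/funext => x; rewrite big_ord0.
by have := WD IH (Wg j); congr W; apply/funext => x; rewrite big_ord_recr.
Qed.

Lemma itg_mul_small k g (e : R) : intg k -> (forall x, 0 <= k x) -> itg k = m * L -> intg (fun x => k x * g x) ->
  (forall x, x \in `[0, L] -> `|g x| <= e) -> `|itg (fun x => k x * g x)| <= m * L * e.
Proof.
move=> ki k0 km kg ge; apply: (le_trans (itg_norm kg)).
rewrite -km -itgZr//; apply: itg_le; [exact: intg_norm| |].
  by under [X in intg X]eq_fun do rewrite mulrC; exact: intgZ.
by move=> x xI; rewrite normrM ger0_norm// ler_wpM2l// ge.
Qed.

(** All densities have the same mass m L, so a uniform error d on the test function costs at most m
    L d, independently of n. *)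
Let W_unif c g : bdmeas c g ->
  (forall e : R, 0 < e -> exists2 phi, W phi & forall x, x \in `[0, L] -> `|g x - phi x| <= e) -> W g.
Proof.
move=> gc H; split; first by exists c.
have mL0 : 0 <= m * L by rewrite -(fm 0); apply: itg_ge0.
apply/cvgrPdist_le => e e0.
pose d := e / (3 * (m * L + 1)).
have d0 : 0 < d by rewrite divr_gt0// mulr_gt0// ltr_pwDr.
have md : m * L * d <= e / 3.
  rewrite /d -[3 * _]mulrC invfM mulrA mulrA ler_pM2r ?invr_gt0// -mulrA mulrC -mulrA.
  rewrite ler_piMr ?(ltW e0)// mulrC ler_pdivrMr ?ltr_pwDr// mul1r lerDl//.
have [phi [[c' pc] pcv] gp] := H d d0.
have e3 : 0 < e / 3 by rewrite divr_gt0.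
have K k : intg k -> (forall x, 0 <= k x) -> itg k = m * L ->
    `|itg (fun x => k x * g x) - itg (fun x => k x * phi x)| <= e / 3.
  move=> ki k0 km.
  have k1 : intg (fun x => k x * g x) by case: gc => mg gc; exact: intgM gc.
  have k2 : intg (fun x => k x * phi x) by case: pc => mg pc; exact: intgM pc.
  rewrite -itgB//; have E : (fun x => k x * g x - k x * phi x) = (fun x => k x * (g x - phi x)).
    by apply/funext => x; rewrite mulrBr.
  rewrite E; apply: le_trans md; apply: itg_mul_small => //.
  by rewrite -E; exact: intgB.
have /cvgrPdist_le/(_ _ e3) := pcv; apply: filterS => n Hn.
have A1 := K h hi h0 weak_mass; have A2 := K (f n) (fi n) (f0 n) (fm n).
move: A1 A2 Hn; set a := itg _; set b := itg _; set a' := itg _; set b' := itg _.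
rewrite !ler_norml => /andP[? ?] /andP[? ?] /andP[? ?]; apply/andP; split; lra.
Qed.

(** The sum counts the integers 1, ..., j below x, hence differs from x by at most 1 when x <= j. It
    serves to approximate functions uniformly by sums of indicators of superlevel sets. *)
Lemma staircase (x : R) j : 0 <= x ->
  Num.min x j.+1%:R - 1 <= \sum_(i < j) (i.+1%:R < x)%R%:R <= Num.min x j%:R.
Proof.
move=> x0; elim: j => [|j IH].
  rewrite big_ord0; apply/andP; split; last by rewrite le_min x0 lexx.
  by rewrite subr_le0 ge_min lexx orbT.
rewrite big_ord_recr/=; move: IH; set S := \sum_(i < j) _.
have -> : j.+2%:R = j.+1%:R + 1 :> R by rewrite -natr1.
have -> : j.+1%:R = j%:R + 1 :> R by rewrite -natr1.
have [h1|h1] := ltP (j%:R + 1) x; rewrite ?addr0 le_min => /and3P[H1 H2 H3]; apply/andP; split.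
- have : Num.min x (j%:R + 1 + 1) <= j%:R + 1 + 1 by rewrite ge_min lexx orbT.
  by rewrite (_ : true%:R = 1)//; lra.
- by rewrite (_ : true%:R = 1)//; lra.
- by apply: le_trans H1; rewrite lerD2r ge_min lexx.
- by [].
Qed.

Lemma weak_bounded c g : bdmeas c g ->
  itg (fun x => f n x * g x) @[n --> \oo] --> itg (fun x => h x * g x).
Proof.
move=> gc; suff [] : W g by [].
have c0 : 0 <= c.
  by have := gc.2 0; rewrite in_itv/= lexx ltW// => /(_ isT); exact: le_trans.
apply: (W_unif gc) => e e0.
(* As g + c ranges in [0, 2c], the rescaled function [t] ranges in [0, j + 1], and one stair of it
   has height D / (j + 1) <= e in terms of g; the added 1 keeps D positive. *)
pose D := 2 * c + 1; have D0 : 0 < D by rewrite ltr_pwDr// mulr_ge0.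
have [j Dj] : exists j : nat, D / e <= j.+1%:R.
  exists (Num.truncn (D / e)); apply: ltW; exact: truncnS_gt.
pose t x := j.+1%:R / D * (g x + c).
pose A (i : nat) := `[0, L]%classic `&` t @^-1` `]i.+1%:R, +oo[.
have mA i : measurable (A i).
  have mt : measurable_fun `[0, L] t.
    apply: measurable_funM => //; apply: measurable_funD => //; exact: gc.1.
  exact: mt.
exists (fun x => D / j.+1%:R * (\sum_(i < j.+1) \1_(A i) x) + - c).
  apply: WD; last exact: W_cst.
  by apply: WZ; apply: (W_sum _ (g := fun i => \1_(A i))) => i; exact: W_indic.
move=> x xI.
have -> : \sum_(i < j.+1) (\1_(A i) x : R) = \sum_(i < j.+1) (i.+1%:R < t x)%R%:R.
  apply: eq_bigr => i _; rewrite indicE; congr (_%:R); congr nat_of_bool.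
  apply/idP/idP; rewrite inE /A/= !in_itv/= andbT; first by case.
  by move=> H; split => //; move: xI; rewrite in_itv.
have /andP[gl gu] : - c <= g x <= c by rewrite -ler_norml; exact: gc.2.
have j0 : 0 < j.+1%:R :> R by [].
have jD : 0 < j.+1%:R / D by rewrite divr_gt0.
have t0 : 0 <= t x by rewrite mulr_ge0 ?(ltW jD)//; lra.
have tj : t x <= j.+1%:R.
  rewrite /t -mulrA ler_piMr//; rewrite mulrC ler_pdivrMr// mul1r /D; lra.
have := staircase j.+1 t0; set S := \sum_(i < _) _.
rewrite !min_l//; last by rewrite (le_trans tj)// ler_nat.
have -> : g x = D / j.+1%:R * t x - c.
  by rewrite /t; field; rewrite !gt_eqF.
have Dj' : D / j.+1%:R <= e by rewrite ler_pdivrMr// mulrC -ler_pdivrMr.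
have Dj0 : 0 < D / j.+1%:R by rewrite divr_gt0.
move=> /andP[s1 s2]; rewrite opprD opprK addrA addrAC subrK -mulrBr normrM gtr0_norm//.
apply: le_trans Dj'; rewrite ler_piMr ?(ltW Dj0)// ler_norml; apply/andP; split; lra.
Qed.

End WeakTest.

(** * Lower semicontinuity of the entropy *)

Section LowerSemicontinuity.
Context {R : realType}.
Variable L : R.
Hypothesis L0 : 0 < L.
Local Notation mu := (@lebesgue_measure R).
Local Notation intg := (intg L).
Local Notation itg := (itg L).
Local Notation bdmeas := (bdmeas L).

Definition clip (K a : R) : R := Num.max K^-1 (Num.min a K).

Lemma clip_bounds (K a : R) : 1 <= K -> K^-1 <= clip K a <= K.
Proof.
move=> K1; rewrite /clip le_max lexx/= ge_max ge_min lexx orbT andbT.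
by rewrite (@le_trans _ _ 1)// invf_le1// (lt_le_trans ltr01).
Qed.

Lemma clip_gt0 (K a : R) : 1 <= K -> 0 < clip K a.
Proof.
move=> K1; have /andP[h _] := clip_bounds a K1; apply: lt_le_trans h.
by rewrite invr_gt0 (lt_le_trans ltr01).
Qed.

Lemma clip_ln_bound (K a : R) : 1 <= K -> `|ln (clip K a)| <= ln K.
Proof.
move=> K1; have /andP[h1 h2] := clip_bounds a K1; have c0 := clip_gt0 a K1.
have K0 : 0 < K by rewrite (lt_le_trans ltr01).
by rewrite ler_norml -lnV ?posrE// !ler_ln ?posrE ?invr_gt0// h1.
Qed.

(** The constant 2 provides the nonnegativity that Fatou's lemma demands. The worst case is a < 1 /
    K, where a ln K <= 1 and 1 / K <= 1 are both subtracted. *)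
Lemma clip_legendre_ge0 (K a : R) : 1 <= K -> 0 <= a -> 0 <= a * ln (clip K a) - clip K a + 2.
Proof.
move=> K1 a0; have K0 : 0 < K by rewrite (lt_le_trans ltr01).
have KV : K^-1 <= 1 by rewrite invf_le1.
have lK : 0 <= ln K by exact: ln_ge0.
have E (b : R) : 0 <= b -> - 1 <= b * ln b - b.
  by move=> b0; have := ent_lower 0 b0; rewrite expR0; lra.
rewrite /clip; have [aK|Ka] := leP a K.
  have [Va|aV] := leP K^-1 a; first by have := E _ a0; lra.
  rewrite lnV ?posrE//; have : a * ln K <= K^-1 * ln K by apply: ler_wpM2r => //; exact: ltW.
  have : K^-1 * ln K <= 1.
    by rewrite mulrC ler_pdivrMr// mul1r; have := ln_le_sub1 K0; lra.
  lra.
rewrite max_r; last by rewrite (le_trans KV).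
have : K * ln K <= a * ln K by apply: ler_wpM2r => //; exact: ltW.
have := E _ (ltW K0); lra.
Qed.

(** For a > 0 the truncation is eventually inactive. At a = 0 the product vanishes for every k and
    only 1 / (k + 1) -> 0 remains. *)
Lemma clip_legendre_cvg (a : R) : 0 <= a ->
  a * ln (clip k.+1%:R a) - clip k.+1%:R a + 2 @[k --> \oo] --> a * ln a - a + 2.
Proof.
rewrite le_eqVlt => /predU1P[<-|a0].
  have H : - k.+1%:R^-1 + 2 @[k --> \oo] --> - (0 : R) + 2.
    by apply: cvgD; [apply: cvgN; exact: (@cvg_harmonic R)|exact: cvg_cst].
  rewrite mul0r subr0; rewrite oppr0 in H.
  rewrite (_ : (fun k => _) = (fun k : nat => - k.+1%:R^-1 + 2))//; apply/funext => k.
  by rewrite /clip min_l// max_l ?invr_ge0// mul0r sub0r.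
apply: cvg_near_cst.
have [N NN] : exists N : nat, Num.max a a^-1 <= N%:R.
  by exists (Num.truncn (Num.max a a^-1)).+1; apply: ltW; exact: truncnS_gt.
exists N => // k /= Nk; have kN : Num.max a a^-1 <= k.+1%:R.
  by rewrite (le_trans NN)// ler_nat leqW.
move: kN; rewrite ge_max => /andP[ak aV].
rewrite /clip (min_l ak) max_r//.
by rewrite -[leRHS]invrK lef_pV2 ?posrE// invr_gt0.
Qed.

Lemma limn_einf_le (u : nat -> \bar R) (c : \bar R) : (forall n, (u n <= c)%E) -> (limn_einf u <= c)%E.
Proof.
move=> uc; rewrite limn_einf_lim; apply: lime_le; first exact: is_cvg_einfs.
by apply: nearW => n; apply: (le_trans _ (uc n)); apply: ereal_inf_lbound; exists n => //=.
Qed.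

Variables (f : nat -> R -> R) (h : R -> R) (E : nat -> R) (e m : R).
Hypothesis fi : forall n, intg (f n).
Hypothesis f0 : forall n x, 0 <= f n x.
Hypothesis fli : forall n, intg (fun x => f n x * ln (f n x)).
Hypothesis fm : forall n, itg (f n) = m * L.
Hypothesis fE : forall n, itg (fun x => f n x * ln (f n x)) <= E n.
Hypothesis Ee : E n @[n --> \oo] --> e.
Hypothesis hi : intg h.
Hypothesis mh : measurable_fun setT h.
Hypothesis h0 : forall x, 0 <= h x.
Hypothesis hcv : forall A, measurable A ->
  itg (fun x => f n x * \1_A x) @[n --> \oo] --> itg (fun x => h x * \1_A x).

(* By Legendre duality the entropy of f n dominates the weakly continuous
   functional int (f n * g) - int e^g with g the logarithm of a truncation of h. *)
Lemma entropy_lsc : intg (fun x => h x * ln (h x)) /\ itg (fun x => h x * ln (h x)) <= e.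
Proof.
pose c k x := clip k.+1%:R (h x).
have k1 k : 1 <= k.+1%:R :> R by rewrite ler1n.
have mc k : measurable_fun setT (c k).
  by apply: measurable_maxr => //; apply: measurable_minr.
have ml k : measurable_fun setT (fun x => ln (c k x)) by exact: measurableT_comp.
have bc k : bdmeas k.+1%:R (c k).
  split; first exact: measurable_funTS.
  move=> x _; rewrite gtr0_norm; last exact: clip_gt0.
  by have /andP[] := clip_bounds (h x) (k1 k).
have bl k : bdmeas (ln k.+1%:R) (fun x => ln (c k x)).
  split; first exact: measurable_funTS.
  by move=> x _; exact: clip_ln_bound.
have hl k := hg_intg hi (bl k); have ci k := bdmeas_intg L0 (bc k).
have bound k : itg (fun x => h x * ln (c k x)) - itg (c k) <= e - m * L.
  have D : itg (fun x => f n x * ln (c k x)) - itg (c k) @[n --> \oo] --> itg (fun x => h x * ln (c k x)) - itg (c k).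
    by apply: cvgB; [exact: (weak_bounded L0 fi f0 fm hi h0 hcv (bl k))|exact: cvg_cst].
  have D' : E n - m * L @[n --> \oo] --> e - m * L by apply: cvgB => //; exact: cvg_cst.
  apply: (ler_cvg_to D D'); apply: nearW => n.
  have fl := bdmeas_intgM fi n (bl k).
  apply: (@le_trans _ _ (itg (fun x => f n x * ln (f n x)) - m * L)); last by rewrite lerD2r.
  rewrite -(fm n) -!itgB//; apply: itg_le; [exact: intgB|exact: intgB|] => x _.
  by have := ent_lower (ln (c k x)) (f0 n x); rewrite lnK// posrE; exact: clip_gt0.
pose G k x := h x * ln (c k x) - c k x + 2.
have iG k : intg (G k) by apply: intgD; [exact: intgB|exact: intg_cst].
have GE k : itg (G k) <= e - m * L + 2 * L.
  rewrite /G itgD; [|exact: intgB|exact: intg_cst].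
  by rewrite itgB// itg_cst// lerD2r.
have mG : measurable_fun `[0, L]%classic (fun x => (h x * ln (h x) - h x + 2)%:E).
  apply/measurable_EFinP; apply: measurable_funTS.
  by apply: measurable_funD => //; apply: measurable_funB => //; apply: measurable_funM => //; exact: measurableT_comp.
have H0 x : 0 <= h x * ln (h x) - h x + 2.
  by have := ent_lower 0 (h0 x); rewrite expR0; lra.
(* Fatou's lemma removes the truncation and yields the integrability of h ln h together with the
   bound; the added constant contributes 2 L on both sides. *)
have F : (\int[mu]_(x in `[0%R, L]) (h x * ln (h x) - h x + 2)%:E <= (e - m * L + 2 * L)%:E)%E.
  have -> : (\int[mu]_(x in `[0%R, L]) (h x * ln (h x) - h x + 2)%:E =
     \int[mu]_(x in `[0%R, L]) limn_einf (fun k => (G k x)%:E))%E.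
    apply: eq_integral => x _; apply/esym.
    apply: (cvg_limn_einf_sup _).1; apply: cvg_EFin; first exact: nearW.
    exact: clip_legendre_cvg.
  apply: (le_trans (@fatou _ _ _ mu _ _ (fun k x => (G k x)%:E) _ _)) => //.
  - by move=> k; apply/measurable_EFinP; exact: intg_meas (iG k).
  - by move=> k x _; rewrite lee_fin; exact: clip_legendre_ge0.
  apply: limn_einf_le => k; rewrite -[X in (X <= _)%E]fineK; last exact: integrable_fin_num (iG k).
  by rewrite lee_fin; exact: GE.
have iH : intg (fun x => h x * ln (h x) - h x + 2).
  apply/integrableP; split; first exact: mG.
  under eq_integral => x _ do rewrite /= ger0_norm//.
  exact: le_lt_trans F (ltry _).
have EH : (fun x => h x * ln (h x)) = (fun x => (h x * ln (h x) - h x + 2) + (h x - 2)).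
  by apply/funext => x; ring.
have i2 : intg (fun x => h x - 2) by apply: intgB => //; exact: intg_cst.
split; first by rewrite EH; exact: intgD.
rewrite EH itgD// itgB//; last exact: intg_cst.
rewrite itg_cst// (weak_mass fm hcv).
have : itg (fun x => h x * ln (h x) - h x + 2) <= e - m * L + 2 * L.
  by rewrite -lee_fin /itg fineK//; exact: integrable_fin_num iH.
lra.
Qed.

End LowerSemicontinuity.

(** * The decay estimate *)

Section Limit.
Context {R : realType}.
Variable L : R.
Hypothesis L0 : 0 < L.
Local Notation mu := (@lebesgue_measure R).
Local Notation intg := (intg L).
Local Notation itg := (itg L).
Local Notation entropy := (entropy L).

Lemma measurable_fundom : measurable_fun setT (fundom L).
Proof.
apply: measurable_funB; first exact: measurable_id.
apply: measurable_funM => //; apply: nondecreasing_measurable => // x y xy.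
by rewrite ler_int le_floor// ler_pM2r// invr_gt0.
Qed.

(** A Radon-Nikodym density need not be periodic, as [Lp] demands. Composing with the reduction
    modulo L changes it on [0, L] at the point L only. *)
Lemma periodize (h : R -> R) : measurable_fun setT h -> exists g : R -> R,
  [/\ periodic g L, measurable_fun setT g, ae_eq0L L h g & forall x, exists z, g x = h z].
Proof.
move=> mh; exists (fun x => h (fundom L x)); split.
- by move=> x; rewrite fundom_periodic.
- by apply: measurableT_comp => //; exact: measurable_fundom.
- refine (ae_mono (neq_ae L) _) => x xL xI; rewrite fundom_id//.
  by move: xI; rewrite !in_itv/= => /andP[-> ]; rewrite le_eqVlt (negbTE xL).
- by move=> x; exists (fundom L x).
Qed.

Lemma rel_entropyE (m : R) g : 0 < m -> intg g -> (forall x, 0 <= g x) ->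
  intg (fun x => g x * ln (g x)) -> itg g = m * L ->
  (\int[mu]_(x in `[0%R, L]) (g x * ln (g x / m))%:E = (entropy m g)%:E)%E.
Proof.
move=> m0 gi g0 gl gm.
have iZ : intg (fun x => ln m * g x) by exact: intgZ.
transitivity (\int[mu]_(x in `[0%R, L]) (g x * ln (g x) - ln m * g x)%:E)%E.
  apply: eq_integral => x _; congr (_%:E).
  have := g0 x; rewrite le_eqVlt => /predU1P[<-|gx]; first by rewrite !mul0r mulr0 subr0.
  by rewrite ln_div ?posrE//; ring.
rewrite -[LHS]fineK; last by exact: integrable_fin_num (intgB gl iZ).
congr (_%:E); transitivity (itg (fun x => g x * ln (g x) - ln m * g x)); first by [].
by rewrite itgB// itgZ// gm /entropy; ring.
Qed.

Variables (f : nat -> R -> R) (F : (R -> R) -> R) (E : nat -> R) (e m : R).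
Hypothesis fi : forall n, intg (f n).
Hypothesis f0 : forall n x, 0 <= f n x.
Hypothesis fli : forall n, intg (fun x => f n x * ln (f n x)).
Hypothesis fm : forall n, itg (f n) = m * L.
Hypothesis fE : forall n, entropy m (f n) <= E n.
Hypothesis Ee : E n @[n --> \oo] --> e.
Hypothesis fF : forall phi, H2 L phi -> itg (fun x => f n x * phi x) @[n --> \oo] --> F phi.

Lemma entropy_limit : exists g, [/\ Lp L 1 g, forall x, 0 <= g x, eqHm2 L F (functional L g) &
  [/\ intg (fun x => g x * ln (g x)), itg g = m * L & entropy m g <= e]].
Proof.
pose E' n := E n + L * (m * ln m).
have E'e : E' n @[n --> \oo] --> e + L * (m * ln m) by apply: cvgD => //; exact: cvg_cst.
have fE' n : itg (fun x => f n x * ln (f n x)) <= E' n.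
  by have := fE n; rewrite /E' /entropy; lra.
have [B HB] : exists B, forall n, E' n <= B.
  have := @cvg_seq_bounded _ _ E' (cvgP _ E'e) => -[M [_ /(_ (M + 1))]].
  rewrite ltrDl => /(_ ltr01) H; exists (M + 1) => n.
  by apply: (le_trans (ler_norm _)); exact: H.
have fB n : itg (fun x => f n x * ln (f n x)) <= B by apply: le_trans (fE' n) (HB n).
have fcv k a b : cvgn (fun n => itg (fun x => f n x * tp L k a b x)).
  by apply: cvgP; apply: fF; exact: tp_H2.
have [h [hi mh h0 hcv]] := weak_density L0 fi f0 fli fm fB fcv.
have [g [pg mg hg gh]] := periodize mh.
have [gi _] := ae_eq0L_itg hi (measurable_funTS mg) hg.
have g0 x : 0 <= g x by have [z ->] := gh x.
have gcv A : measurable A -> itg (fun x => f n x * \1_A x) @[n --> \oo] --> itg (fun x => g x * \1_A x).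
  move=> mA; rewrite -(@ae_eq0L_itgE _ L (fun x => h x * \1_A x)); [exact: hcv|exact: intg_indicM|exact: intg_indicM|].
  exact: (ae_eq0L_comp (fun a b => a * b) (\1_A) hg).
have [gl ge] := entropy_lsc L0 fi f0 fli fm fE' E'e gi mg g0 gcv.
have gm := weak_mass fm gcv.
exists g; split => //; first by apply/Lp1P.
  (* A function of H^2 agrees a.e. with a bounded one, so the weak convergence applies to it and
     identifies the limit with F. *)
  move=> phi Hphi; have [C [w [C0 wl mw yw]]] := H2_repr L0 Hphi.
  have wb : bdmeas L (`|w 0| + C * L) w by split => //; exact: lipschitz_per_bounded.
  have H := weak_bounded L0 fi f0 fm gi g0 gcv wb.
  have S k : intg k -> itg (fun x => k x * phi x) = itg (fun x => k x * w x).
    move=> ki; apply: ae_eq0L_itgE.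
    - exact: (H2_intgM L0 Hphi ki).1.
    - exact: (intgM ki mw wb.2).
    - exact: (ae_eq0L_comp (fun a b => b * a) k yw).
  transitivity (itg (fun x => g x * w x)); last exact: esym (S g gi).
  have := fF Hphi; under eq_cvg do rewrite S//; move=> H'.
  exact: (cvg_unique _ H' H).
by split => //; rewrite /entropy; move: ge; lra.
Qed.

End Limit.

(** As [U t] is a functional, its entropy is that of a density [f]. Such a density is unique a.e.,
    since cosines and sines belong to H^2 and determine its Fourier coefficients, so the existential
    does not weaken the estimate. *)
Theorem theorem9 (R : realType) (L : R) (hL : 0 < L)
  (u0 : R -> R)
  (u0_per : periodic u0 L)
  (u0_meas : measurable_fun setT u0)
  (u0_ge0 : forall x, 0 <= u0 x)
  (u0_log : (@lebesgue_measure R).-integrable `[0, L]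
     (fun x => ((u0 x)%:E - lne (u0 x)%:E)%E))
  (u0_ent : (@lebesgue_measure R).-integrable `[0, L]
     (fun x => (u0 x * ln (u0 x))%:E))
  (u : R -> R -> R) (U ut : R -> (R -> R) -> R)
  (hu : weak_solution L u0 u U ut)
  (hc : constructed L u0 u ut) :
  let ubar := (\int[lebesgue_measure]_(x in `[0, L]) u0 x) / L in
  let M := 32 * pi ^+ 4 / L ^+ 4 in
  forall t : R, 0 < t ->
    exists f : R -> R,
      [/\ Lp L 1 f, forall x, 0 <= f x, eqHm2 L (U t) (functional L f) &
          (\int[lebesgue_measure]_(x in `[0%R, L]) (f x * ln (f x / ubar))%:E
           <= (expR (- M * t))%:E *
              \int[lebesgue_measure]_(x in `[0%R, L])
                (u0 x * ln (u0 x / ubar))%:E)%E].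
Proof.
move=> ubar M t t0.
have iu := intg_u0 u0_meas u0_ge0 u0_log.
have ubar0 : 0 < ubar.
  by rewrite divr_gt0//; exact: (mass_gt0 hL u0_meas u0_ge0 u0_log).
have um : itg L u0 = ubar * L by rewrite /ubar divfK// gt_eqF.
have [f [Hf fF [E fE Ee]]] := iterates_weak hL ubar0 iu u0_ge0 u0_ent um hu hc t0.
have [g [g1 g0 gU [gl gm ge]]] : exists g, [/\ Lp L 1 g, forall x, 0 <= g x, eqHm2 L (U t) (functional L g) &
    [/\ intg L (fun x => g x * ln (g x)), itg L g = ubar * L &
        entropy L ubar g <= expR (- (rate L * t)) * entropy L ubar u0]].
  by apply: (entropy_limit hL _ _ _ _ fE Ee fF) => [n|n x|n|n]; have [] := Hf n.
have /Lp1P[_ _ gi] := g1.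
exists g; split => //; rewrite !rel_entropyE// -EFinM lee_fin.
by rewrite /M -rateE// mulNr.
Qed.
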